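(* If $w\in\mathrm{TGr}_0(3,8)$ is not in the relative interior of a cone in the $\mathfrak{S}_8$-orbit of $\mathcal{C}_{\mathsf{sp}}$, then $\mathrm{in}_w\mathrm{Gr}_0(3,8)$ is irreducible.
   Context: Everything is over $\mathbb{C}$. $\mathrm{Gr}_0(3,8)$ is the open locus of the Grassmannian $\mathrm{Gr}(3,8)\subset\mathbb{P}^{\binom{8}{3}-1}$ (of $3$-dimensional subspaces of $\mathbb{C}^8$, Plücker embedding) where all Plücker coordinates are nonzero; it is a closed subvariety of the torus $T=\mathbb{G}_m^{\binom{[8]}{3}}/\mathbb{G}_m$, with cocharacter lattice $N=\mathbb{Z}^{\binom{[8]}{3}}/\mathbb{Z}(1,\dots,1)$ and character lattice $M=\mathrm{Hom}(N,\mathbb{Z})$. Let $e_\lambda\in N$ denote the image of the standard basis vector indexed by $\lambda\in\binom{[8]}{3}$. Let $I\subset\mathbb{C}[M]$ be the prime ideal of $\mathrm{Gr}_0(3,8)$. For $w\in N_{\mathbb{R}}$ and $f=\sum_uc_ux^u$, $\mathrm{in}_wf$ is the sum of the terms $c_ux^u$ ($c_u\ne0$) with $\langle u,w\rangle$ minimal; $\mathrm{in}_wI=\langle\mathrm{in}_wf:f\in I\rangle$; $\mathrm{TGr}_0(3,8)=\{w\in N_{\mathbb{R}}:\mathrm{in}_wI\neq\langle1\rangle\}$; and for $w\in\mathrm{TGr}_0(3,8)$, $\mathrm{in}_w\mathrm{Gr}_0(3,8)\subset T$ is the closed subscheme defined by $\mathrm{in}_wI$. The symmetric group $\mathfrak{S}_8$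 acts on $N_{\mathbb{R}}$ by permuting the indices in $[8]$, preserving $\mathrm{TGr}_0(3,8)$. Let $L_{\mathbb{R}}\subset N_{\mathbb{R}}$ be the $7$-dimensional linear span of the vectors $\sum_{\lambda\ni i}e_\lambda$, $i\in[8]$. Let $\mathsf{Q}_{\mathsf{sp}}$ be the rank-$3$ matroid on $[8]$ whose bases are all elements of $\binom{[8]}{3}$ other than $126,145,178,235,248,347,368,567$ (where $ijk$ abbreviates $\{i,j,k\}$). The cone of $\mathrm{TGr}_0(3,8)$ (with its secondary fan structure) containing in its relative interior the corank vector of $\mathsf{Q}_{\mathsf{sp}}$ (whose $\lambda$-coordinate is $3-\mathrm{rank}(\lambda)$) is $$\mathcal{C}_{\mathsf{sp}}=\mathbb{R}_{\ge0}\langle e_{126},e_{145},e_{178},e_{235},e_{248},e_{347},e_{368},e_{567}\rangle+L_{\mathbb{R}}.$$ *)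

(* Defs.v *)
From HB Require Import structures.
From mathcomp Require Import all_boot all_order all_fingroup all_algebra.
From mathcomp Require Import boolp classical_sets reals.
From mathcomp Require Import complex finmap monalg.

Set Implicit Arguments.
Unset Strict Implicit.
Unset Printing Implicit Defensive.

Import Order.TTheory GRing.Theory Num.Theory.

Local Open Scope fset_scope.
Local Open Scope ring_scope.

(* The group algebra of an additive group. The ring structure that monalg puts
   on {malg R[G]} requires a monoid of monomials without nontrivial units, which
   excludes groups; hence the alias, carrying its own convolution product. *)
Definition grpalg (R : comNzRingType) (G : zmodType) : Type := {malg R[G]}.

Section GroupAlgebra.
Variables (R : comNzRingType) (G : zmodType).
Implicit Types (f g h : grpalg R G) (u v : G).

HB.instance Definition _ := GRing.Zmodule.on (grpalg R G).

Definition grpalg_one : grpalg R G := << 1 *g 0 >>.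

Definition grpalg_mul f g : grpalg R G :=
  \sum_(u <- msupp f) \sum_(v <- msupp g) << f@_u * g@_v *g u + v >>.

Lemma grpalg_mulw (d1 d2 : {fset G}) f g :
  msupp f `<=` d1 -> msupp g `<=` d2 ->
  grpalg_mul f g = \sum_(u <- d1) \sum_(v <- d2) << f@_u * g@_v *g u + v >>.
Proof.
move=> le_d1 le_d2; rewrite /grpalg_mul (big_fset_incl _ le_d1) /=.
  apply: eq_bigr => u _; apply: big_fset_incl => // v _ /mcoeff_outdom ->.
  by rewrite mulr0 monalgU0.
move=> u _ /mcoeff_outdom fu.
by rewrite big1 // => v _; rewrite fu mul0r monalgU0.
Qed.

Lemma grpalg_mulC : commutative grpalg_mul.
Proof.
move=> f g; rewrite /grpalg_mul exchange_big /=.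
apply: eq_bigr => u _; apply: eq_bigr => v _.
by rewrite mulrC addrC.
Qed.

Lemma grpalg_mulDl : left_distributive grpalg_mul +%R.
Proof.
move=> f g h.
rewrite (grpalg_mulw (msuppD_le f g) (fsubset_refl (msupp h))).
rewrite (grpalg_mulw (fsubsetUl (msupp f) (msupp g)) (fsubset_refl (msupp h))).
rewrite (grpalg_mulw (fsubsetUr (msupp f) (msupp g)) (fsubset_refl (msupp h))).
rewrite -big_split /=; apply: eq_bigr => u _.
rewrite -big_split /=; apply: eq_bigr => v _.
by rewrite mcoeffD mulrDl monalgUD.
Qed.

Lemma grpalg_mulDr : right_distributive grpalg_mul +%R.
Proof.
by move=> f g h; rewrite grpalg_mulC grpalg_mulDl !(grpalg_mulC f).
Qed.

Lemma grpalg_mul0 : left_zero 0 grpalg_mul.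
Proof. by move=> f; rewrite /grpalg_mul msupp0 big_seq_fset0. Qed.

Lemma grpalg_mulr0 : right_zero 0 grpalg_mul.
Proof. by move=> f; rewrite grpalg_mulC grpalg_mul0. Qed.

Lemma grpalg_mulUU (a b : R) u v :
  grpalg_mul << a *g u >> << b *g v >> = << a * b *g u + v >>.
Proof.
by rewrite (grpalg_mulw msuppU_le msuppU_le) !big_seq_fset1 !mcoeffUU.
Qed.

Lemma grpalg_ind (P : grpalg R G -> Prop) :
  P 0 -> (forall f g, P f -> P g -> P (f + g)) ->
  (forall a u, P << a *g u >>) -> forall f, P f.
Proof.
by move=> P0 PD PU f; rewrite (monalgE f); apply: big_ind => // u _; apply: PU.
Qed.

Lemma grpalg_mul1 : left_id grpalg_one grpalg_mul.
Proof.
elim/grpalg_ind => [|f g IHf IHg|a u]; first by rewrite grpalg_mulr0.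
  by rewrite grpalg_mulDr IHf IHg.
by rewrite grpalg_mulUU mul1r add0r.
Qed.

Lemma grpalg_mulA : associative grpalg_mul.
Proof.
elim/grpalg_ind => [|f1 f2 IH1 IH2|a u] g h; first by rewrite !grpalg_mul0.
  by rewrite !grpalg_mulDl IH1 IH2.
elim/grpalg_ind: g => [|g1 g2 IH1 IH2|b v].
- by rewrite grpalg_mulr0 !grpalg_mul0 grpalg_mulr0.
- by rewrite grpalg_mulDr !grpalg_mulDl grpalg_mulDr IH1 IH2.
elim/grpalg_ind: h => [|h1 h2 IH1 IH2|c x]; first by rewrite !grpalg_mulr0.
  by rewrite !grpalg_mulDr IH1 IH2.
by rewrite !grpalg_mulUU mulrA addrA.
Qed.

Lemma grpalg_one_neq0 : grpalg_one != 0.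
Proof.
by apply/eqP/malgP => /(_ 0)/eqP; rewrite mcoeffUU mcoeff0 oner_eq0.
Qed.

HB.instance Definition _ := GRing.Zmodule_isComNzRing.Build (grpalg R G)
  grpalg_mulA grpalg_mulC grpalg_mul1 grpalg_mulDl grpalg_one_neq0.

End GroupAlgebra.

Local Open Scope classical_set_scope.
Local Open Scope ring_scope.
Local Open Scope complex_scope.

Section Spectrum.
Variable A : comNzRingType.
Implicit Types (J P E : set A) (X Z : set (set A)).

Definition ideal J : Prop :=
  [/\ J 0, forall f g, J f -> J g -> J (f + g)
    & forall a f, J f -> J (a * f)].

Definition ideal_gen E : set A := smallest ideal E.

Definition prime_ideal P : Prop :=
  [/\ ideal P, ~ P 1 & forall f g, P (f * g) -> P f \/ P g].

(* The closed subset V(E) of Spec A; for E an ideal, this is the underlying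
   space of the closed subscheme of Spec A defined by E. *)
Definition zero_locus E : set (set A) :=
  [set P | prime_ideal P /\ E `<=` P].

Definition zariski_closed Z : Prop := exists E, Z = zero_locus E.

Definition irreducible X : Prop :=
  X !=set0 /\
  forall Z1 Z2, zariski_closed Z1 -> zariski_closed Z2 ->
    X `<=` Z1 `|` Z2 -> X `<=` Z1 \/ X `<=` Z2.

End Spectrum.

Definition triple : predArgType := {l : {set 'I_8} | #|l| == 3}.
HB.instance Definition _ := SubFinite.on triple.

(* M = Hom(N, Z): since N = Z^triple / Z(1,...,1), a character is an exponent
   vector with vanishing coordinate sum. *)
Definition sum_zero : {pred {ffun triple -> int}} :=
  [pred u : {ffun triple -> int} | \sum_l u l == 0].

Lemma sum_zero_zmod_closed : zmod_closed sum_zero.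
Proof.
split=> [|u v /eqP u0 /eqP v0]; rewrite inE.
  by rewrite big1 // => l _; rewrite ffunE.
under eq_bigr do rewrite !ffunE.
by rewrite sumrB u0 v0 subrr.
Qed.

HB.instance Definition _ :=
  GRing.isZmodClosed.Build _ sum_zero sum_zero_zmod_closed.

Definition character : Type := {u : {ffun triple -> int} | u \in sum_zero}.

HB.instance Definition _ := SubChoice.on character.
HB.instance Definition _ := [SubChoice_isSubZmodule of character by <:].

Section Grassmannian.
Variable R : realType.

Definition laurent : Type := grpalg R[i] character.
HB.instance Definition _ := GRing.ComNzRing.on laurent.

(* p is a lift of a point of T to nonzero homogeneous coordinates; as u has
   coordinate sum 0, the value does not depend on the lift. *)
Definition laurent_eval (f : laurent) (p : triple -> R[i]) : R[i] :=
  \sum_(u <- msupp f) f@_u * \prod_l p l ^ (val u l).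

(* The columns indexed by l, taken in increasing order. *)
Definition pluecker (A : 'M[R[i]]_(3, 8)) (l : triple) : R[i] :=
  \det (colsub (fun j : 'I_3 => nth ord0 (enum (val l)) j) A).

(* A 3-dimensional subspace of C^8 is given as the row space of A. *)
Definition Gr0 (A : 'M[R[i]]_(3, 8)) : Prop :=
  row_free A /\ forall l, pluecker A l != 0.

Definition Gr0_ideal : set laurent :=
  [set f | forall A, Gr0 A -> laurent_eval f (pluecker A) = 0].

(* A point of N_R = R^triple / R(1,...,1) is given by a lift to R^triple, and
   a subset of N_R by its preimage in R^triple. *)
Definition cochar : Type := {ffun triple -> R^o}.
Implicit Types (w x y : cochar) (C : set cochar).

Definition pairing (u : character) w : R := \sum_l (val u l)%:~R * w l.

Lemma pairing_shift u w (c : R) : pairing u (w + [ffun=> c]) = pairing u w.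
Proof.
rewrite /pairing; under eq_bigr do rewrite !ffunE mulrDr.
rewrite big_split /= -mulr_suml -rmorph_sum /=.
by rewrite (eqP (valP u)) mul0r addr0.
Qed.

Definition initial_form w (f : laurent) : laurent :=
  \sum_(u <- msupp f | all (fun v => pairing u w <= pairing v w) (msupp f))
    << f@_u *g u >>.

Definition initial_ideal w (J : set laurent) : set laurent :=
  ideal_gen (initial_form w @` J).

Definition TGr0 : set cochar :=
  [set w | initial_ideal w Gr0_ideal <> ideal_gen [set 1]].

(* The underlying space of the closed subscheme in_w Gr_0(3,8) of T. *)
Definition initial_degeneration w : set (set laurent) :=
  zero_locus (initial_ideal w Gr0_ideal).

Definition e_vec (l : triple) : cochar := [ffun m => (m == l)%:R].

(* The preimage of L_R in R^triple, hence the constant vectors. *)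
Definition lineality : set cochar :=
  [set x | exists (b : 'I_8 -> R) (c : R),
     x = \sum_i b i *: (\sum_(l : triple | i \in val l) e_vec l) + [ffun=> c]].

(* The element k of {1, ..., 8} is encoded as k - 1 in 'I_8. *)
Definition ijk (i j k : nat) : {set 'I_8} :=
  [set inord i.-1; inord j.-1; inord k.-1].

Definition Qsp_nonbasis (l : triple) : bool :=
  val l \in [:: ijk 1 2 6; ijk 1 4 5; ijk 1 7 8; ijk 2 3 5;
                ijk 2 4 8; ijk 3 4 7; ijk 3 6 8; ijk 5 6 7].

Definition Csp : set cochar :=
  [set x | exists (a : triple -> R) (y : cochar),
     [/\ forall l, 0 <= a l, lineality y
       & x = \sum_(l | Qsp_nonbasis l) a l *: e_vec l + y]].

Definition affine_hull C : set cochar :=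
  [set y | exists (n : nat) (t : 'I_n -> R) (x : 'I_n -> cochar),
     [/\ forall k, C (x k), \sum_k t k = 1 & y = \sum_k t k *: x k]].

(* Interior relative to the affine hull, for the sup norm on R^triple. As the
   quotient map to N_R is open, this commutes with taking preimages. *)
Definition relint C : set cochar :=
  [set w | C w /\ exists2 eps : R, 0 < eps &
     forall y, affine_hull C y -> (forall l, `|y l - w l| < eps) -> C y].

Lemma card_perm_triple (s : 'S_8) (l : triple) : #|s @: val l| == 3.
Proof. by rewrite card_imset ?(valP l) //; apply: perm_inj. Qed.

Definition perm_triple (s : 'S_8) (l : triple) : triple :=
  exist _ (s @: val l) (card_perm_triple s l).

(* The linear action with s e_l = e_(s l). *)
Definition perm_cochar (s : 'S_8) w : cochar :=
  \sum_l w l *: e_vec (perm_triple s l).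

End Grassmannian.

Arguments Csp R : clear implicits.

(* Main.v *)
(* The initial degeneration is irreducible as soon as there is a matrix V with
   entries in k[t^R], for a domain k over C, whose Pluecker coordinates have
   valuations w and leading coefficients so generic that the kernel of evaluation
   at them lies in every prime containing in_w I. Such a V is built one column at
   a time. A new column e has three free brackets, with transcendental leading
   coefficients; the other brackets with e are solved for by three-term Pluecker
   relations, as long as w makes the initial forms of these relations determine
   them.

   If this fails, then the stars of the old points meet pairwise without
   generating everything, hence are concurrent: the old points are matched into
   pairs that behave like lines through e, with strict inequalities in w. With at
   most five old points this is impossible. If each of seven points fails over
   the six others, a search through the compatible patterns leaves only the Fano
   plane, where binomials in the initial ideal force 2 = 0. If each of eight
   points fails over the seven others, the search leaves only the Moebius-Kantor
   configuration, whose ties and gaps put w in the relative interior of a cone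
   in the orbit of C_sp. *)
Require Import Defs.
From HB Require Import structures.
From mathcomp Require Import all_boot all_order all_fingroup all_algebra.
From mathcomp Require Import boolp classical_sets reals.
From mathcomp Require Import complex finmap monalg ring lra.

Set Implicit Arguments.
Unset Strict Implicit.
Unset Printing Implicit Defensive.

Import Order.TTheory GRing.Theory Num.Theory.

Local Open Scope ring_scope.

(** * Group algebras and their filtration *)

(** A column has three degrees of freedom, so beyond the three free brackets nothing about the
    column of [e] can be prescribed. Hence two passes: the orders of the other brackets are first
    bounded below by [w], and only then do their coefficients at [w] satisfy the initial relations.
    That these coefficients are nonzero comes from [TGr0 w]: they specialize to coordinates of [T],
    which are units modulo a prime over the initial ideal. The two inclusions for the kernel of
    evaluation differ in nature. It contains the initial forms of all of the ideal, because the
    brackets come from an honest matrix; it lies in every prime over the initial ideal by three-term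
    relations and invertibility of the coordinates alone. So no dimension theory enters. Weights are
    real, whence the exponent group of [t]. Nothing is divided: cancellation in a domain and
    Cramer's rule with cross products replace inverses of series. For a fixed point [i], the
    three-term relations make [w] a tree whose leaves are the other points; failure is read off from
    the branches at the leaf [e]. *)

Section GroupAlgebraTheory.
Variables (k : comNzRingType) (G : zmodType).
Implicit Types (f g : grpalg k G) (u v : G).

Lemma grpalgUU (a b : k) u v :
  (<< a *g u >> : grpalg k G) * (<< b *g v >> : grpalg k G)
  = << a * b *g u + v >>.
Proof. exact: grpalg_mulUU. Qed.

Lemma grpalg1E : (1 : grpalg k G) = << 1 *g 0 >>.
Proof. by []. Qed.

Lemma mcoeff_grpalgM f g u :
  (f * g : grpalg k G)@_u = \sum_(v <- msupp f) f@_v * g@_(u - v).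
Proof.
rewrite [f * g](grpalg_mulw (fsubset_refl _) (fsubset_refl _)) raddf_sum /=.
apply: eq_bigr => v _; rewrite raddf_sum /=.
have neq x : x != u - v -> (v + x == u) = false.
  by apply: contra_neqF => /eqP <-; rewrite addrC addKr.
have [vg|vg] := boolP (u - v \in msupp g).
  rewrite (bigD1_seq (u - v)) ?fset_uniq //= mcoeffU (addrC v) subrK eqxx mulr1n.
  rewrite big1 ?add0r ?addr0 // => x xne.
  by rewrite mcoeffU neq.
rewrite (mcoeff_outdom vg) mulr0 big1_seq // => x /andP[_ xg].
by rewrite mcoeffU neq //; apply: contraNneq vg => <-.
Qed.

Lemma mcoeff_grpalgMw (d : {fset G}) f g u : (msupp f `<=` d)%fset ->
  (f * g : grpalg k G)@_u = \sum_(v <- d) f@_v * g@_(u - v).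
Proof.
move=> fd; rewrite mcoeff_grpalgM; apply: big_fset_incl => // v _.
by move/mcoeff_outdom => ->; rewrite mul0r.
Qed.

Definition grpalgC (c : k) : grpalg k G := << c *g 0 >>.

Lemma grpalgC_is_additive : zmod_morphism grpalgC.
Proof. by move=> a b; rewrite /grpalgC monalgUB. Qed.

Lemma grpalgC_is_multiplicative : monoid_morphism grpalgC.
Proof. by split=> // a b; rewrite /grpalgC grpalgUU addr0. Qed.

HB.instance Definition _ :=
  GRing.isZmodMorphism.Build k (grpalg k G) grpalgC grpalgC_is_additive.
HB.instance Definition _ :=
  GRing.isMonoidMorphism.Build k (grpalg k G) grpalgC grpalgC_is_multiplicative.

Lemma mcoeff_grpalgCM c f u : (grpalgC c * f)@_u = c * f@_u.
Proof.
rewrite (@mcoeff_grpalgMw [fset 0]%fset) ?msuppU_le // big_seq_fset1.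
by rewrite mcoeffUU subr0.
Qed.

Definition grpalg_filter (P : pred G) f : grpalg k G :=
  \sum_(u <- msupp f | P u) << f@_u *g u >>.

Lemma mcoeff_grpalg_filter P f u :
  (grpalg_filter P f)@_u = if P u then f@_u else 0.
Proof.
rewrite raddf_sum /=.
have [uf|uf] := boolP (u \in msupp f); last first.
  rewrite (mcoeff_outdom uf) if_same big1_seq // => v /andP[_ vf].
  by rewrite mcoeffU (_ : (v == u) = false) //; apply: contraNF uf => /eqP <-.
rewrite big_mkcond (bigD1_seq u) ?fset_uniq //= mcoeffUU big1 ?addr0 // => v vu.
by rewrite mcoeffU (negPf vu); case: ifP.
Qed.

Lemma grpalg_filterD P f g :
  grpalg_filter P (f + g) = grpalg_filter P f + grpalg_filter P g.
Proof.
apply/malgP => u; rewrite mcoeffD !mcoeff_grpalg_filter mcoeffD.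
by case: ifP => //; rewrite addr0.
Qed.

Lemma grpalg_filterU P c u : grpalg_filter P << c *g u >> =
  if P u then << c *g u >> else 0.
Proof.
apply/malgP => v; rewrite mcoeff_grpalg_filter mcoeffU.
have [<-|uv] := eqVneq u v; first by case: ifP => _; rewrite ?mcoeff0 ?mcoeffUU.
by case: (P u); rewrite ?mcoeffU ?mcoeff0 ?(negPf uv) if_same.
Qed.

Section Eval.
Variables (B : comNzRingType) (iota : {rmorphism k -> B}) (h : G -> B).

Definition grpalg_eval f : B := mmap iota h f.

Lemma grpalg_eval0 : grpalg_eval 0 = 0. Proof. exact: mmap0. Qed.

Lemma grpalg_evalD f g : grpalg_eval (f + g) = grpalg_eval f + grpalg_eval g.
Proof. exact: mmapD. Qed.

Lemma grpalg_evalU c u : grpalg_eval << c *g u >> = iota c * h u.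
Proof. exact: mmapU. Qed.

Lemma grpalg_eval_sum (T : Type) (s : seq T) (P : pred T) (F : T -> grpalg k G) :
  grpalg_eval (\sum_(x <- s | P x) F x) = \sum_(x <- s | P x) grpalg_eval (F x).
Proof. exact: (big_morph _ grpalg_evalD grpalg_eval0). Qed.

Hypothesis h0 : h 0 = 1.
Hypothesis hD : forall u v, h (u + v) = h u * h v.

Lemma grpalg_eval1 : grpalg_eval 1 = 1.
Proof. by rewrite grpalg1E grpalg_evalU h0 rmorph1 mulr1. Qed.

Lemma grpalg_evalM f g : grpalg_eval (f * g) = grpalg_eval f * grpalg_eval g.
Proof.
elim/grpalg_ind: f => [|f1 f2 IH1 IH2|c u].
- by rewrite mul0r grpalg_eval0 mul0r.
- by rewrite mulrDl !grpalg_evalD IH1 IH2 mulrDl.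
elim/grpalg_ind: g => [|f1 f2 IH1 IH2|d v].
- by rewrite mulr0 grpalg_eval0 mulr0.
- by rewrite mulrDr !grpalg_evalD IH1 IH2 mulrDr.
by rewrite grpalgUU !grpalg_evalU rmorphM hD mulrACA.
Qed.

End Eval.

End GroupAlgebraTheory.

Section GroupAlgebraMap.
Variables (k k' : comNzRingType) (phi : {rmorphism k -> k'}) (G : zmodType).

Definition grpalg_map (f : grpalg k G) : grpalg k' G :=
  [malg u in msupp f => phi f@_u].

Lemma mcoeff_grpalg_map f u : (grpalg_map f)@_u = phi f@_u.
Proof.
rewrite mcoeffE; case: ifPn => // /mcoeff_outdom ->.
by rewrite rmorph0.
Qed.

Lemma msupp_grpalg_map f : (msupp (grpalg_map f) `<=` msupp f)%fset.
Proof.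
apply/fsubsetP => u; rewrite -!mcoeff_neq0 mcoeff_grpalg_map.
by apply: contra_neq => ->; rewrite rmorph0.
Qed.

Lemma grpalg_map_is_additive : zmod_morphism grpalg_map.
Proof.
by move=> f g; apply/malgP => u; rewrite mcoeffB !mcoeff_grpalg_map mcoeffB rmorphB.
Qed.

Lemma grpalg_map_is_multiplicative : monoid_morphism grpalg_map.
Proof.
split=> [|f g]; apply/malgP => u; rewrite mcoeff_grpalg_map.
  by rewrite !grpalg1E !mcoeffU rmorphMn rmorph1.
rewrite mcoeff_grpalgM rmorph_sum /= (mcoeff_grpalgMw _ _ (msupp_grpalg_map f)).
by apply: eq_bigr => v _; rewrite rmorphM !mcoeff_grpalg_map.
Qed.

HB.instance Definition _ := GRing.isZmodMorphism.Build
  (grpalg k G) (grpalg k' G) grpalg_map grpalg_map_is_additive.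
HB.instance Definition _ := GRing.isMonoidMorphism.Build
  (grpalg k G) (grpalg k' G) grpalg_map grpalg_map_is_multiplicative.

End GroupAlgebraMap.

Lemma seq_min (T : eqType) (R : realType) (F : T -> R) (s : seq T) :
  s != [::] -> exists2 x, x \in s & forall y, y \in s -> F x <= F y.
Proof.
elim: s => // x [|y s] IHs _.
  by exists x; rewrite ?mem_head // => y; rewrite inE => /eqP ->.
have [//|z zs zmin] := IHs.
have [xz|zx] := leP (F x) (F z).
  exists x; rewrite ?mem_head // => t; rewrite inE => /predU1P[->//|/zmin].
  exact: le_trans.
exists z; first by rewrite inE zs orbT.
move=> t; rewrite inE => /predU1P[->|/zmin //].
exact: ltW.
Qed.

(* Over a real exponent group the group algebra is filtered by the order of
   vanishing; [lo f a] says that this order is at least [a]. *)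
Section Valuation.
Variables (k : idomainType) (R : realType).
Implicit Types (f g : grpalg k R) (a b : R).

Definition lo f a : Prop := forall u : R, u < a -> f@_u = 0.

Lemma loW f a b : b <= a -> lo f a -> lo f b.
Proof. by move=> ba fa u ub; apply/fa/(lt_le_trans ub). Qed.

Lemma loM f g a b : lo f a -> lo g b -> lo (f * g) (a + b).
Proof.
move=> fa gb u uab; rewrite mcoeff_grpalgM big1_seq // => v _.
have [va|av] := ltP v a; first by rewrite fa ?mul0r.
by rewrite gb ?mulr0 // ltrBlDl (lt_le_trans uab) // lerD2r.
Qed.

(** In the convolution, any exponent other than [a] for [f] leaves one of the two factors strictly
    below its bound. *)
Lemma mcoeff_loM f g a b : lo f a -> lo g b -> (f * g)@_(a + b) = f@_a * g@_b.
Proof.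
move=> fa gb; rewrite (@mcoeff_grpalgMw _ _ (a |` msupp f)%fset) ?fsubsetUr //.
rewrite (bigD1_seq a) ?fset_uniq ?fset1U1 //= (addrC a b) addrK.
rewrite big1 ?addr0 // => v; have [va _|av|->] := ltgtP v a; last 2 first.
- by move=> _; rewrite (gb (b + a - v)) ?mulr0 // ltrBlDr ltrD2l.
- by [].
by rewrite fa ?mul0r.
Qed.

(** Replaces division by [g]: if [m] is the least exponent of [f], the coefficient of the product at
    [m + b] is a product of two nonzero elements of a domain, so [m + b] is not below [a + b]. *)
Lemma lo_mulKr f g a b : lo g b -> g@_b != 0 -> lo (f * g) (a + b) -> lo f a.
Proof.
move=> gb gb0 fgab u ua; apply/eqP; apply: contra_ltT ua => fu0.
have [|m] := @seq_min _ R id (msupp f).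
  apply/eqP => f0; move: fu0; rewrite mcoeff_neq0 => uf.
  by have : u \in enum_fset (msupp f) by []; rewrite f0.
rewrite -mcoeff_neq0 => fm0 mmin.
have fm : lo f m.
  move=> v vm; apply: contraTeq vm => fv0.
  by rewrite -leNgt mmin // -mcoeff_neq0.
rewrite (@le_trans _ _ m) ?mmin -?mcoeff_neq0 // leNgt -(ltrD2r b).
apply/negP => /fgab /eqP.
by rewrite mcoeff_loM // mulf_eq0 (negPf fm0) (negPf gb0).
Qed.

Lemma loU (c : k) a : lo << c *g a >> a.
Proof. by move=> u ua; rewrite mcoeffU gt_eqF. Qed.

End Valuation.

(** * Prime ideals and specializations *)

Section PrimeIdeals.
Local Open Scope classical_set_scope.
Variable A : comNzRingType.
Implicit Types (J Q : set A) (f g : A).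

Lemma idealN J f : ideal J -> J f -> J (- f).
Proof. by case=> _ _ JM /(JM (-1)); rewrite mulN1r. Qed.

Lemma idealB J f g : ideal J -> J f -> J g -> J (f - g).
Proof. by move=> iJ Jf Jg; case: (iJ) => _ JD _; apply: JD => //; exact: idealN. Qed.

Lemma ideal_gen_ideal (E : set A) : ideal (ideal_gen E).
Proof.
split=> [|f g Jf Jg|a f Jf] J JP; case: (JP) => -[J0 JD JM] _.
- exact: J0.
- by apply: JD; [apply: Jf | apply: Jg].
- by apply: JM; apply: Jf.
Qed.

Lemma sub_ideal_gen (E : set A) : E `<=` ideal_gen E.
Proof. by move=> f Ef J [_]; apply. Qed.

Lemma ideal_gen_sub (E J : set A) : ideal J -> E `<=` J -> ideal_gen E `<=` J.
Proof. by move=> iJ EJ f; apply. Qed.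

Lemma ideal_sign J f n : ideal J -> J ((-1) ^+ n * f) -> J f.
Proof.
by case=> _ _ JM /(JM ((-1) ^+ n)); rewrite mulrA -expr2 sqrr_sign mul1r.
Qed.

Lemma ideal_prime_sup J : ideal J -> ~ J 1 -> exists Q, prime_ideal Q /\ J `<=` Q.
Proof.
move=> iJ J1.
(* Zorn is applied to sets [X] for which the union with [J] is a proper ideal, rather than to ideals
   containing [J]: the empty chain, whose union is empty, then satisfies the hypothesis too. *)
pose P := [set X : set A | ideal (J `|` X) /\ ~ (J `|` X) 1].
have [F FP totF|X [[iX X1] Xmax]] := @Zorn_bigcup A P.
  split; last by move=> [/J1//|[Y FY Y1]]; case: (FP _ FY) => _; apply; right.
  have two f g : (J `|` \bigcup_(Y in F) Y) f -> (J `|` \bigcup_(Y in F) Y) g ->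
      exists Y, [/\ ideal (J `|` Y), (J `|` Y) `<=` (J `|` \bigcup_(Y in F) Y),
                    (J `|` Y) f & (J `|` Y) g].
    move=> [Jf|[Y FY Yf]] [Jg|[Z FZ Zg]].
    - exists set0; rewrite setU0; split=> // x Jx; by left.
    - exists Z; split; [by case: (FP _ FZ)| |by left|by right].
      by move=> x [|Zx]; [left|right; exists Z].
    - exists Y; split; [by case: (FP _ FY)| |by right|by left].
      by move=> x [|Yx]; [left|right; exists Y].
    have [YZ|ZY] := totF _ _ FY FZ.
    + exists Z; split; [by case: (FP _ FZ)| |by right; apply: YZ|by right].
      by move=> x [|Zx]; [left|right; exists Z].
    + exists Y; split; [by case: (FP _ FY)| |by right|by right; apply: ZY].
      by move=> x [|Yx]; [left|right; exists Y].
  split; first by left; case: iJ.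
    by move=> f g Uf Ug; have [Y [[_ YD _] sY Yf Yg]] := two _ _ Uf Ug; apply/sY/YD.
  by move=> a f Uf; have [Y [[_ _ YM] sY Yf _]] := two _ _ Uf Uf; apply/sY/YM.
exists (J `|` X); split; last by move=> x; left.
split=> // f g Qfg; apply: contrapT => /not_orP[Qf Qg].
case: (iX) => Q0 QD QM.
have gen h : ~ (J `|` X) h -> exists a b, (J `|` X) b /\ 1 = a * h + b.
  move=> Qh; apply: contrapT => no.
  pose Y := [set x | exists a b, (J `|` X) b /\ x = a * h + b].
  have QY : J `|` X `<=` Y by move=> b Qb; exists 0, b; rewrite mul0r add0r.
  have JY : J `|` Y = Y by apply/setUidPr => x Jx; apply: QY; left.
  apply: (Xmax Y).
    split; first by move=> x Xx; apply: QY; right.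
    move=> sYX; apply: Qh; right; apply: sYX; exists 1, 0.
    by rewrite mul1r addr0.
  split; rewrite JY //; split; first exact: QY.
    move=> _ _ [a [b [Qb ->]]] [c [d [Qd ->]]]; exists (a + c), (b + d).
    by split; [exact: QD | rewrite mulrDl addrACA].
  move=> c _ [a [b [Qb ->]]]; exists (c * a), (c * b).
  by split; [exact: QM | rewrite mulrDr mulrA].
have [a [b [Qb e1]]] := gen _ Qf; have [c [d [Qd e2]]] := gen _ Qg.
apply: X1; rewrite -[1]mulr1 {1}e1 e2.
have -> : (a * f + b) * (c * g + d) =
  a * c * (f * g) + ((c * g + d) * b + (a * f) * d) by ring.
by apply: (QD); [exact: QM | apply: QD; exact: QM].
Qed.

End PrimeIdeals.

Section Terms.
Variables (C : comNzRingType) (X : finType).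

(* Formal polynomial expressions; they stand in for polynomials, as only their
   values in various C-algebras matter. *)
Inductive term :=
| TC of C
| TV of X
| TA of term & term
| TM of term & term.

Fixpoint teval (B : comNzRingType) (iota : C -> B) (b : X -> B) g : B :=
  match g with
  | TC c => iota c
  | TV x => b x
  | TA g h => teval iota b g + teval iota b h
  | TM g h => teval iota b g * teval iota b h
  end.

Fixpoint tin (E : {set X}) g : bool :=
  match g with
  | TC _ => true
  | TV x => x \in E
  | TA g h | TM g h => tin E g && tin E h
  end.

Lemma tinS (E E' : {set X}) g : E \subset E' -> tin E g -> tin E' g.
Proof.
move=> sE; elim: g => //= [x|g IHg h IHh|g IHg h IHh].
- exact: (fintype.subsetP sE).
- by move=> /andP[/IHg-> /IHh].
- by move=> /andP[/IHg-> /IHh].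
Qed.

Lemma eq_teval (B : comNzRingType) (i : C -> B) (b b' : X -> B) (E : {set X}) g :
  {in E, b =1 b'} -> tin E g -> teval i b g = teval i b' g.
Proof.
move=> bb; elim: g => //= g IHg h IHh.
  by move=> /andP[/IHg-> /IHh->].
by move=> /andP[/IHg-> /IHh->].
Qed.

Lemma teval_morph (B B' : comNzRingType) (f : {rmorphism B -> B'})
    (i : C -> B) (b : X -> B) g :
  f (teval i b g) = teval (f \o i) (f \o b) g.
Proof. by elim: g => //= g IHg h IHh; rewrite ?rmorphD ?rmorphM IHg IHh. Qed.

Definition tpow g n := iter n (TM g) (TC 1).

Lemma teval_pow (B : comNzRingType) (i : {rmorphism C -> B}) (b : X -> B) g n :
  teval i b (tpow g n) = teval i b g ^+ n.
Proof. by elim: n => [|n IHn] /=; rewrite ?rmorph1 // exprS IHn. Qed.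

Lemma tin_pow E g n : tin E g -> tin E (tpow g n).
Proof. by move=> Eg; elim: n => //= n ->; rewrite Eg. Qed.

(** Pseudo-division by the linear polynomial [m d - h]: each substitution of [h] for [d] costs a
    factor [m]. The identity is stated in all algebras at once, since terms have no normal form. *)
Lemma term_solve E d m h g : tin E m -> tin E h -> tin (d |: E) g ->
  exists n g' t, tin E g' /\ forall (B : comNzRingType) (i : {rmorphism C -> B}) b,
    teval i b g' = teval i b m ^+ n * teval i b g
                   + (teval i b m * b d - teval i b h) * teval i b t.
Proof.
move=> Em Eh; elim: g => [c|x|g IHg h' IHh|g IHg h' IHh] /=.
- exists 0%N, (TC c), (TC 0); split=> // B i b /=.
  by rewrite rmorph0; ring.
- rewrite !inE => /predU1P[->|xE].
    exists 1%N, h, (TC (-1)); split=> // B i b /=.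
    by rewrite rmorphN rmorph1; ring.
  exists 0%N, (TV x), (TC 0); split=> // B i b /=.
  by rewrite rmorph0; ring.
- move=> /andP[/IHg[n1 [g1 [t1 [E1 e1]]]] /IHh[n2 [g2 [t2 [E2 e2]]]]].
  exists (n1 + n2)%N, (TA (TM (tpow m n2) g1) (TM (tpow m n1) g2)).
  exists (TA (TM (tpow m n2) t1) (TM (tpow m n1) t2)).
  split=> [|B i b] /=; first by rewrite !tin_pow ?E1 ?E2.
  by rewrite !teval_pow e1 e2 exprD; ring.
- move=> /andP[/IHg[n1 [g1 [t1 [E1 e1]]]] /IHh[n2 [g2 [t2 [E2 e2]]]]].
  exists (n1 + n2)%N, (TM g1 g2).
  exists (TA (TM (TM (tpow m n1) g) t2) (TM t1 g2)).
  split=> [|B i b] /=; first by rewrite E1 E2.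
  by rewrite !teval_pow e1 e2 exprD; ring.
Qed.

Fixpoint thorner (s : seq term) (d : X) : term :=
  if s is t :: s' then TA t (TM (TV d) (thorner s' d)) else TC 0.

(** Collects the powers of [d], again as an identity in all algebras; the coefficients are terms
    free of [d] when [d] is not in [E]. *)
Lemma term_collect E d g : tin (d |: E) g ->
  exists s, all (tin E) s /\ forall (B : comNzRingType) (i : {rmorphism C -> B}) b,
    teval i b g = teval i b (thorner s d).
Proof.
pose eqt g h := forall (B : comNzRingType) (i : {rmorphism C -> B}) b,
  teval i b g = teval i b h.
have addP s1 s2 : all (tin E) s1 -> all (tin E) s2 -> exists s, all (tin E) s
    /\ eqt (TA (thorner s1 d) (thorner s2 d)) (thorner s d).
  elim: s1 s2 => [|t1 s1 IHs] s2 /=.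
    by move=> _ E2; exists s2; split=> // B i b /=; rewrite rmorph0 add0r.
  move=> /andP[E1 E1s]; case: s2 => [_|t2 s2 /= /andP[E2 E2s]].
    exists (t1 :: s1); split; first by rewrite /= E1 E1s.
    by move=> B i b /=; rewrite rmorph0 addr0.
  have [s [Es es]] := IHs _ E1s E2s.
  exists (TA t1 t2 :: s); split=> [|B i b] /=; first by rewrite E1 E2.
  by rewrite -es /=; ring.
have scaleP t s : eqt (thorner [seq TM t t' | t' <- s] d) (TM t (thorner s d)).
  move=> B i b; elim: s => [|t' s IHs] /=; first by rewrite rmorph0 mulr0.
  by rewrite IHs /=; ring.
elim: g => [c|x|g IHg h IHh|g IHg h IHh] /=.
- by exists [:: TC c]; split=> // B i b /=; rewrite rmorph0 mulr0 addr0.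
- rewrite !inE => /predU1P[->|xE].
    exists [:: TC 0; TC 1]; split=> // B i b /=.
    by rewrite rmorph0 rmorph1 mulr0 addr0 mulr1 add0r.
  exists [:: TV x]; rewrite /= xE; split=> // B i b /=.
  by rewrite rmorph0 mulr0 addr0.
- move=> /andP[/IHg[s1 [E1 e1]] /IHh[s2 [E2 e2]]].
  have [s [Es es]] := addP _ _ E1 E2; exists s; split=> // B i b.
  by rewrite -es /= e1 e2.
- move=> /andP[/IHg[s1 [E1 e1]] /IHh[s2 [E2 e2]]].
  have [s [Es es]] : exists s, all (tin E) s
      /\ eqt (TM (thorner s1 d) (thorner s2 d)) (thorner s d).
    elim: s1 E1 {e1} => [|t1 s1 IHs] /=.
      by move=> _; exists [::]; split=> // B i b /=; rewrite rmorph0 mul0r.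
    move=> /andP[E1 /IHs[s [Es es]]].
    have E3 : all (tin E) [seq TM t1 t | t <- s2].
      by rewrite all_map; apply: sub_all E2 => t /= ->; rewrite E1.
    have E4 : all (tin E) (TC 0 :: s) by [].
    have [s' [Es' es']] := addP _ _ E3 E4; exists s'; split=> // B i b.
    rewrite -es' /= -es /= rmorph0 add0r mulrDl; congr (_ + _); last by ring.
    by rewrite scaleP.
  by exists s; split=> // B i b; rewrite -es /= e1 e2.
Qed.

Variables (A : comNzRingType) (iA : {rmorphism C -> A}) (q : X -> A).
Variable VJ : set (set A).
Hypothesis VJ_prime : forall Q, VJ Q -> prime_ideal Q.

(* Over the variables in [E], the point [q] modulo any [Q] in [VJ] is a
   specialization of the point [r]. *)
Definition spec (k : idomainType) (i : C -> k) (r : X -> k) (E : {set X}) : Prop :=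
  forall g, tin E g -> teval i r g = 0 -> forall Q, VJ Q -> Q (teval iA q g).

Lemma eq_spec (k : idomainType) (i : C -> k) (r r' : X -> k) (E : {set X}) :
  {in E, r =1 r'} -> spec i r E -> spec i r' E.
Proof. by move=> rr sr g Eg; rewrite -(eq_teval _ rr Eg); exact: sr. Qed.

(** Eliminating [d] turns a relation [g] of [r] into a relation [g'] over [E], to which the
    hypothesis applies. Modulo [Q] the value of [g'] is a power of [m] times that of [g], and [m] is
    not in the prime [Q]. *)
Lemma spec_solve (k : idomainType) (i : {rmorphism C -> k}) (r : X -> k) (E : {set X}) d m h :
  spec i r E -> tin E m -> tin E h ->
  teval i r m * r d = teval i r h -> teval i r m != 0 ->
  (forall Q, VJ Q -> Q (teval iA q m * q d - teval iA q h)) ->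
  (forall Q, VJ Q -> ~ Q (teval iA q m)) ->
  spec i r (d |: E).
Proof.
move=> sE Em Eh rd rm qd qm g Eg g0 Q VQ.
have [n [g' [t [Eg' eg]]]] := term_solve Em Eh Eg.
have : Q (teval iA q g').
  by apply: sE => //; rewrite eg g0 mulr0 rd subrr mul0r addr0.
have [iQ Q1 QP] := VJ_prime VQ; case: (iQ) => _ QD QM.
rewrite eg => Qs.
have : Q (teval iA q m ^+ n * teval iA q g).
  rewrite -(addrK ((teval iA q m * q d - teval iA q h) * teval iA q t) (_ * _)).
  by apply: idealB => //; rewrite mulrC; apply: QM; exact: qd.
elim: n {eg Qs} => [|n IHn]; first by rewrite mul1r.
by rewrite exprS -mulrA => /QP[/(qm _ VQ)//|/IHn].
Qed.

(** The new coordinate is a nonzero multiple of a transcendental, so a relation of [r'] is a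
    relation of [r] in each power of [d] separately. *)
Lemma spec_free (k : idomainType) (i : {rmorphism C -> k}) (r : X -> k) (E : {set X}) d
    (r' : X -> {poly k}) (c : k) :
  spec i r E -> {in E, forall x, r' x = (r x)%:P} -> r' d = c%:P * 'X -> c != 0 ->
  spec (polyC \o i) r' (d |: E).
Proof.
move=> sE rE rd c0 g Eg g0 Q VQ.
have [iQ Q1 QP] := VJ_prime VQ; case: (iQ) => Q0 QD QM.
have [s [Es es]] := term_collect Eg.
rewrite es; rewrite (es _ (polyC \o i)) in g0.
elim: s Es g0 {es} => [|t s IHs] /=; first by move=> _ _; rewrite rmorph0.
move=> /andP[Et Es].
rewrite (@eq_teval _ _ r' (polyC \o r) E) // -teval_morph rd => /polyP e0.
have t0 : teval i r t = 0.
  by have := e0 0%N; rewrite coefD coefC -mulrA coefCM coefXM mulr0 addr0 coef0.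
apply: QD; first exact: sE.
apply: QM; apply: IHs => //; apply/polyP => n; have := e0 n.+1.
rewrite t0 rmorph0 add0r -mulrA coefCM coefXM coef0 /= => /eqP.
by rewrite mulf_eq0 (negPf c0) coef0 => /eqP.
Qed.

End Terms.

(** * Brackets *)

Section Triples.
Implicit Types (i j k l m : 'I_8) (t : triple).

Lemma card_set012 : #|([set 0; 1; 2] : {set 'I_8})| == 3%N.
Proof. by rewrite -finset.setUA !cardsU1 !inE cards1. Qed.

(** Serves as the default value of [tri] and as the reference coordinate by which [chi]
    dehomogenizes. *)
Definition tri0 : triple := exist (fun l : {set 'I_8} => #|l| == 3%N) _ card_set012.

Definition tri i j k : triple := insubd tri0 [set i; j; k].

Lemma val_tri i j k : uniq [:: i; j; k] -> val (tri i j k) = [set i; j; k].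
Proof.
rewrite /= !inE negb_or andbT => /andP[/andP[ij ik] jk].
apply: insubdK; rewrite unfold_in -finset.setUA !cardsU1 !inE cards1.
by rewrite negb_or ij ik jk.
Qed.

Lemma triP i j k : tri i j k = tri j i k.
Proof. by rewrite /tri (finset.setUC [set i]). Qed.

Lemma triR i j k : tri i j k = tri i k j.
Proof. by rewrite /tri -!finset.setUA (finset.setUC [set j]). Qed.

Definition tnth3 t (m : 'I_3) : 'I_8 := nth ord0 (enum (val t)) m.

Lemma size_enum_triple t : size (enum (val t)) = 3.
Proof. by rewrite -cardE; apply/eqP/(valP t). Qed.

Lemma enum_triple t :
  enum (val t) = [:: tnth3 t 0; tnth3 t 1; tnth3 t 2].
Proof.
rewrite /tnth3; have := size_enum_triple t.
by case: (enum _) => [|a [|b [|c [|]]]].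
Qed.

Lemma sorted_triple t : (tnth3 t 0%R < tnth3 t 1%R < tnth3 t 2%R)%N.
Proof.
have : sorted (relpre val ltn) (enum (val t)).
  rewrite {1}/enum_mem; apply: sorted_filter => [x y z|]; first exact: ltn_trans.
  by rewrite -enumT -sorted_map val_enum_ord iota_ltn_sorted.
by rewrite enum_triple /= andbT.
Qed.

Lemma uniq_triple t : uniq [:: tnth3 t 0; tnth3 t 1; tnth3 t 2].
Proof. by rewrite -enum_triple enum_uniq. Qed.

Lemma tri_tnth3 t : tri (tnth3 t 0) (tnth3 t 1) (tnth3 t 2) = t.
Proof.
apply: val_inj; rewrite val_tri ?uniq_triple //.
apply/setP => x; rewrite -[x \in val t]mem_enum enum_triple !inE.
by rewrite orbA.
Qed.

Lemma triple_ind (P : triple -> Prop) :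
  (forall i j k, (i < j < k)%N -> P (tri i j k)) -> forall t, P t.
Proof. by move=> Pt t; rewrite -[t]tri_tnth3; apply: Pt; exact: sorted_triple. Qed.

Lemma tnth3_tri i j k : (i < j < k)%N ->
  [/\ tnth3 (tri i j k) 0 = i, tnth3 (tri i j k) 1 = j & tnth3 (tri i j k) 2 = k].
Proof.
move=> /andP[ij jk]; have ik := ltn_trans ij jk.
have u : uniq [:: i; j; k].
  by rewrite /= !inE negb_or -!val_eqE /= !ltn_eqF.
have : enum (val (tri i j k)) = [:: i; j; k].
  apply: (inj_map val_inj); apply: (irr_sorted_eq ltn_trans ltnn).
  - by rewrite enum_triple /= andbT; exact: sorted_triple.
  - by rewrite /= ij jk.
  move=> x; apply/mapP/mapP => -[y yi ->]; exists y => //; move: yi.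
    by rewrite mem_enum val_tri // !inE orbA.
  by rewrite mem_enum val_tri // !inE orbA.
by rewrite enum_triple => -[-> -> ->].
Qed.

(** Parity of the number of inversions of [(i, j, k)]. *)
Definition sb i j k : bool := (j < i)%N (+) (k < i)%N (+) (k < j)%N.

Definition vbr (B : comNzRingType) (x y z : 'I_3 -> B) : B :=
  x 0 * (y 1 * z 2 - y 2 * z 1) - y 0 * (x 1 * z 2 - x 2 * z 1)
  + z 0 * (x 1 * y 2 - x 2 * y 1).

Definition pl (B : comNzRingType) (v : 'I_8 -> 'I_3 -> B) t : B :=
  vbr (v (tnth3 t 0)) (v (tnth3 t 1)) (v (tnth3 t 2)).

(* Triples are unordered; [bx x i j k] is the alternating extension of [x]. *)
Definition bx (B : comNzRingType) (x : triple -> B) i j k : B :=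
  (-1) ^+ sb i j k * x (tri i j k).

Lemma vbr_pl (B : comNzRingType) (v : 'I_8 -> 'I_3 -> B) i j k :
  uniq [:: i; j; k] -> vbr (v i) (v j) (v k) = bx (pl v) i j k.
Proof.
have srt (a b c : 'I_8) : (a < b < c)%N -> pl v (tri a b c) = vbr (v a) (v b) (v c).
  by rewrite /pl => /tnth3_tri[-> -> ->].
rewrite /= !inE negb_or andbT -!val_eqE /= => /andP[/andP[ij ik] jk].
rewrite /bx /sb.
case: (ltngtP i j) ij => // ij _; case: (ltngtP j k) jk => // jk _;
  case: (ltngtP i k) ik => // ik _ /=;
  try by [move: (ltn_trans ij jk); rewrite ltnNge (ltnW ik)].
- by rewrite srt ?ij // expr0 mul1r.
- by rewrite triR srt ?ik // expr1 /vbr; ring.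
- by rewrite triR triP srt ?ik // /vbr; ring.
- by rewrite triP srt ?ij // expr1 /vbr; ring.
- by rewrite triP triR srt ?jk // /vbr; ring.
- by move: (ltn_trans jk ij); rewrite ltnNge (ltnW ik).
- by rewrite triP triR triP srt ?jk // expr1 /vbr; ring.
Qed.

Definition plrel (B : comNzRingType) (x : triple -> B) i j k l m : B :=
  bx x i j k * bx x i l m - bx x i j l * bx x i k m + bx x i j m * bx x i k l.

Lemma plrel_pl (B : comNzRingType) (v : 'I_8 -> 'I_3 -> B) i j k l m :
  uniq [:: i; j; k; l; m] -> plrel (pl v) i j k l m = 0.
Proof.
rewrite /= !inE !negb_or !andbT => /and4P[/and4P[ij ik il im] /and3P[jk jl jm] /andP[kl km] lm].
rewrite /plrel -!vbr_pl /= ?inE ?negb_or ?ij ?ik ?il ?im ?jk ?jl ?jm ?kl ?km ?lm //.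
by rewrite /vbr; ring.
Qed.

End Triples.

Lemma pluecker_pl (R : realType) (A : 'M[R[i]%C]_(3, 8)) (t : triple) :
  pluecker A t = pl (fun i m => A m i) t.
Proof.
rewrite /pluecker (expand_det_col _ 0) !big_ord_recl big_ord0 /cofactor.
Abort.

(** * Initial forms *)

Lemma det3 (B : comNzRingType) (M : 'M[B]_3) :
  \det M = vbr (fun m => M m 0) (fun m => M m 1) (fun m => M m 2).
Proof.
(* Indexing by natural numbers lets [ring] identify entries whose ordinals were built in different
   ways. *)
pose f (a b : nat) := M (inord a) (inord b).
have e i j : M i j = f i j by rewrite /f !inord_val.
rewrite (expand_det_row _ 0) !big_ord_recl big_ord0 /cofactor.
rewrite !(expand_det_row _ 0) !big_ord_recl !big_ord0 /cofactor !det_mx11 !mxE.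
by rewrite /vbr !e /= /bump /=; ring.
Qed.

Lemma pluecker_pl (R : realType) (A : 'M[R[i]%C]_(3, 8)) (t : triple) :
  pluecker A t = pl (fun i m => A m i) t.
Proof.
by rewrite /pluecker det3 /pl /tnth3; congr vbr; apply: funext => m; rewrite mxE.
Qed.

Section Evaluation.
Variable R : realType.
Local Notation C := R[i]%C.
Local Notation L := (grpalg C character).
Variables (Phi : fieldType) (iota : {rmorphism C -> Phi}) (p : triple -> Phi).
Hypothesis p0 : forall t, p t != 0.

Definition lmon (u : character) : Phi := \prod_t p t ^ (val u t).

Lemma lmon0 : lmon 0 = 1.
Proof. by rewrite /lmon big1 // => t _; rewrite ffunE expr0z. Qed.

Lemma lmonD u v : lmon (u + v) = lmon u * lmon v.
Proof.
rewrite /lmon -big_split /=; apply: eq_bigr => t _.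
by rewrite ffunE expfzDr.
Qed.

Definition lev (f : L) : Phi := grpalg_eval iota lmon f.

End Evaluation.

Lemma laurent_evalE (R : realType) (f : laurent R) (p : triple -> R[i]%C) :
  laurent_eval f p = lev (@idfun R[i]%C) p f.
Proof. by []. Qed.

Section InitialForms.
Variable R : realType.
Local Notation C := R[i]%C.
Local Notation L := (grpalg C character).
Variable w : cochar R.
Local Notation I := (@Gr0_ideal R).
Local Notation J := (initial_ideal w I).

Lemma pairingD u v : pairing (u + v) w = pairing u w + pairing v w.
Proof.
rewrite /pairing -big_split /=; apply: eq_bigr => t _.
by rewrite ffunE rmorphD mulrDl.
Qed.

Definition trunc (m : R) (f : L) : L :=
  grpalg_filter (fun u => pairing u w == m) f.

Lemma initial_trunc m f : (forall u, u \in msupp f -> m <= pairing u w) ->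
  (exists2 u, u \in msupp f & pairing u w = m) -> initial_form w f = trunc m f.
Proof.
move=> fm [u uf um]; rewrite /trunc /grpalg_filter /initial_form.
rewrite big_seq_cond [RHS]big_seq_cond.
apply: eq_bigl => v; case: (boolP (v \in _)) => //= vf.
apply/allP/eqP => [/(_ _ uf)|-> x xf]; last exact: fm.
by rewrite um => vm; apply/eqP; rewrite eq_le vm fm.
Qed.

Lemma trunc_eq0 m f : (forall u, u \in msupp f -> pairing u w <> m) ->
  trunc m f = 0.
Proof.
move=> no; rewrite /trunc /grpalg_filter big1_seq // => u /andP[/eqP um uf].
by case: (no _ uf).
Qed.

(** The bound [m] need not be attained: the truncation is then zero. This avoids asking which terms
    of a relation have least weight. *)
Lemma J_trunc m f : I f -> (forall u, u \in msupp f -> m <= pairing u w) ->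
  J (trunc m f).
Proof.
move=> If fm; have [no|/existsNP[u /not_implyP[uf /contrapT um]]] :=
  pselect (forall u, u \in msupp f -> pairing u w <> m).
  by rewrite trunc_eq0 //; case: (ideal_gen_ideal (initial_form w @` I)%classic).
rewrite -initial_trunc //; last by exists u.
by apply: sub_ideal_gen; exists f.
Qed.

(** A single coordinate is not a character, as exponents must sum to zero; its quotient by the
    coordinate [tri0] is. *)
Definition chi_val (t : triple) : {ffun triple -> int} :=
  [ffun s => (s == t)%:R - (s == tri0)%:R].

Lemma chi_sum_zero t : chi_val t \in sum_zero.
Proof.
rewrite inE; apply/eqP; under eq_bigr do rewrite ffunE.
have e x : \sum_(s : triple) (s == x)%:R = 1 :> int.
  by rewrite (bigD1 x) //= eqxx big1 ?addr0 // => s /negPf ->.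
by rewrite sumrB !e subrr.
Qed.

Definition chi t : character := exist _ (chi_val t) (chi_sum_zero t).

(** The tautological point of [T] with values in its own coordinate ring, scaled so that the
    coordinate [tri0] is 1. *)
Definition qpt (t : triple) : L := (<< 1 *g chi t >> : grpalg C character).

Lemma pairing_chi t : pairing (chi t) w = w t - w tri0.
Proof.
have e s : \sum_l (l == s)%:R%:~R * w l = w s.
  rewrite (bigD1 s) //= eqxx mul1r big1 ?addr0 // => l /negPf ->.
  by rewrite mul0r.
rewrite /pairing -(e t) -(e tri0) -sumrB; apply: eq_bigr => l _.
by rewrite ffunE rmorphB mulrBl.
Qed.

Lemma lmon_chi (Phi : fieldType) (p : triple -> Phi) t :
  (forall t, p t != 0) -> lmon p (chi t) = p t / p tri0.
Proof.
move=> p0.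
have e s : \prod_l p l ^ (l == s)%:R = p s.
  rewrite (bigD1 s) //= eqxx expr1z big1 ?mulr1 // => l /negPf ->.
  by rewrite expr0z.
rewrite /lmon -(e t) -(e tri0) -prodfV -big_split; apply: eq_bigr => l _.
by rewrite ffunE expfzDr // invr_expz.
Qed.
End InitialForms.

(** * Polynomial identities from complex points *)

Section Vanishing.
Variables (C : numFieldType) (X : finType).

(** [B] may have zero divisors. Dividing by [X - N] still keeps the later roots [n], because [n - N]
    is invertible in [B], being the image of a nonzero element of [C]. *)
Lemma poly_nat_roots (B : comNzRingType) (iB : {rmorphism C -> B}) (h : {poly B}) N :
  (forall n, (N <= n)%N -> h.[n%:R] = 0) -> h = 0.
Proof.
have [d] := ubnP (size h); elim: d h N => // d IHd h N szh hN.
have /factor_theorem[q hq] : root h N%:R by apply/rootP/hN.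
have [qe|q0] := eqVneq q 0; first by rewrite hq qe mul0r.
rewrite hq (IHd q N.+1) ?mul0r //.
  have := szh; rewrite hq size_Mmonic ?monicXsubC // size_XsubC addn2 /=.
  by rewrite ltnS.
move=> n Nn; have := hN n (ltnW Nn).
rewrite hq hornerM hornerXsubC -natrB ?(ltnW Nn) // => /(congr1 ( *%R^~ (iB (n - N)%:R^-1))).
by rewrite mul0r -mulrA -[(n - N)%:R](rmorph_nat iB) -rmorphM mulfV ?rmorph1 ?mulr1
  ?pnatr_eq0 -?lt0n ?subn_gt0.
Qed.

Lemma term_vanish (B : comNzRingType) (iB : {rmorphism C -> B}) (g : term C X) :
  (forall x : X -> C, teval idfun x g = 0) -> forall b, teval iB b g = 0.
Proof.
move=> g0 b.
(* [s] lists the variables whose values may be nonconstant. The first of them is replaced by an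
   indeterminate, and the resulting polynomial vanishes at all natural numbers by induction. *)
suff main (s : seq X) : forall b : X -> B,
    (forall x, x \notin s -> exists c, b x = iB c) -> teval iB b g = 0.
  by apply: (main (enum X)) => x; rewrite mem_enum.
elim: s => [|a s IHs] {}b bC.
  have /choice[c bc] : forall x, exists c, b x = iB c by move=> x; apply: bC.
  have := teval_morph iB idfun c g; rewrite g0 rmorph0.
  by rewrite -(_ : b = iB \o c) //; apply: funext.
pose h := teval (polyC \o iB) (fun x => if x == a then 'X else (b x)%:P) g.
have hE y : h.[y] = teval iB (fun x => if x == a then y else b x) g.
  rewrite -[h.[y]]/(horner_eval y h) teval_morph; congr (teval _ _ _).
    by apply: funext => c; rewrite /= /horner_eval hornerC.
  by apply: funext => x /=; case: eqP; rewrite /horner_eval ?hornerX ?hornerC.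
suff h0 : h = 0.
  have := hE (b a); rewrite h0 horner0 (_ : (fun x => _) = b) => [<- //|].
  by apply: funext => x; case: eqP => // ->.
apply: (@poly_nat_roots B iB h 0) => n _; rewrite hE; apply: IHs => x xs.
case: eqP => [_|/eqP xa]; first by exists n%:R; rewrite rmorph_nat.
by apply: bC; rewrite inE negb_or xa.
Qed.

End Vanishing.

Section BigTerms.
Variables (C : comNzRingType) (X : finType) (T : Type).
Implicit Types (s : seq T) (F : T -> term C X).

Definition tsum s F := foldr (fun t acc => TA (F t) acc) (TC X 0) s.
Definition tprod s F := foldr (fun t acc => TM (F t) acc) (TC X 1) s.

Variables (B : comNzRingType) (i : {rmorphism C -> B}) (b : X -> B).

Lemma teval_sum s F : teval i b (tsum s F) = \sum_(t <- s) teval i b (F t).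
Proof.
elim: s => [|t s IHs] /=; first by rewrite rmorph0 big_nil.
by rewrite big_cons IHs.
Qed.

Lemma teval_prod s F : teval i b (tprod s F) = \prod_(t <- s) teval i b (F t).
Proof.
elim: s => [|t s IHs] /=; first by rewrite rmorph1 big_nil.
by rewrite big_cons IHs.
Qed.

End BigTerms.

Lemma tin_setT (C : comNzRingType) (X : finType) (g : term C X) : tin [set: X]%SET g.
Proof. by elim: g => //= g -> h ->. Qed.

Section LowestTerms.
Variables (k : idomainType) (R : realType).

Lemma lo1 : lo (1 : grpalg k R) 0.
Proof. exact: loU. Qed.

Lemma lo_exp (f : grpalg k R) a n :
  lo f a -> lo (f ^+ n) (a *+ n) /\ (f ^+ n)@_(a *+ n) = f@_a ^+ n.
Proof.
move=> fa; elim: n => [|n [IH1 IH2]].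
  by rewrite mulr0n !expr0; split; [exact: lo1 | rewrite grpalg1E mcoeffUU].
by rewrite mulrS !exprS; split; [exact: loM | rewrite mcoeff_loM // IH2].
Qed.

Lemma lo_prod (T : Type) (s : seq T) (F : T -> grpalg k R) (a : T -> R) :
  (forall t, lo (F t) (a t)) ->
  lo (\prod_(t <- s) F t) (\sum_(t <- s) a t) /\
  (\prod_(t <- s) F t)@_(\sum_(t <- s) a t) = \prod_(t <- s) (F t)@_(a t).
Proof.
move=> Fa; elim: s => [|t s [IH1 IH2]].
  by rewrite !big_nil; split; [exact: lo1 | rewrite grpalg1E mcoeffUU].
by rewrite !big_cons; split; [exact: loM | rewrite mcoeff_loM // IH2].
Qed.

End LowestTerms.

(** * Irreducibility from a generic point *)

Section GenericPoint.
Variables (R : realType) (w : cochar R).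
Local Notation C := R[i]%C.
Local Notation L := (laurent R).
Local Notation I := (@Gr0_ideal R).
Local Notation J := (initial_ideal w I).
Local Notation VJ := (initial_degeneration w).

Definition iL : {rmorphism C -> L} := @grpalgC C character.

Lemma VJ_prime Q : VJ Q -> prime_ideal Q.
Proof. by case. Qed.

Variables (k : idomainType) (iota : {rmorphism C -> k}).
Variable v : 'I_8 -> 'I_3 -> grpalg k R.
Local Notation r := (fun t => (pl v t)@_(w t)).
Hypothesis v_lo : forall t, lo (pl v t) (w t).
Hypothesis r0 : forall t, r t != 0.
Hypothesis r_spec : spec iL (@qpt R) VJ iota r [set: triple]%SET.

Local Notation Phi := {fraction k}.
(** Characters have negative exponents, so they are evaluated in the fraction field of [k]. *)
Let rP t : Phi := tofrac (r t).
Let iP : {rmorphism C -> Phi} := @tofrac k \o iota.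

Let rP0 t : rP t != 0.
Proof. by rewrite tofrac_eq0. Qed.

Let ev (f : L) : Phi := lev iP rP f.

Let evM f g : ev (f * g) = ev f * ev g.
Proof. exact: (grpalg_evalM _ (lmonD rP0)). Qed.

Let evD f g : ev (f + g) = ev f + ev g.
Proof. exact: grpalg_evalD. Qed.

(* [N] is chosen below so that the argument of [absz] is nonnegative. *)
Definition shift_exp (N : nat) (u : character) (t : triple) : nat :=
  absz (N%:Z + val u t)%R.

Definition shift_bound (f : L) : nat :=
  (\sum_(u <- msupp f) \sum_t `|val u t|%N).+1.

Lemma shift_expE f u t : u \in msupp f ->
  (0 < shift_exp (shift_bound f) u t)%N /\
  (shift_exp (shift_bound f) u t)%:Z = (shift_bound f)%:Z + val u t.
Proof.
move=> uf; have le : (`|val u t| < shift_bound f)%N.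
  rewrite ltnS (bigD1_seq u) ?fset_uniq //= (bigD1 t) //= -addnA.
  exact: leq_addr.
have pos : 0 < (shift_bound f)%:Z + val u t.
  by move: le; rewrite -ltz_nat abszE ltr_norml => /andP[]; rewrite -subr_gt0 opprK addrC.
by rewrite /shift_exp absz_gt0 gt_eqF // gtz0_abs.
Qed.

Lemma row_free_minor (F : fieldType) (A : 'M[F]_(3, 8)) (g : 'I_3 -> 'I_8) :
  \det (colsub g A) != 0 -> row_free A.
Proof.
move=> dA; rewrite /row_free eqn_leq rank_leq_row /=.
have /mxrank_unit e : colsub g A \in unitmx by rewrite unitmxE unitfE.
rewrite -{1}e -[A in colsub g A]mulmx1 -mulmx_colsub.
exact: mxrankM_maxl.
Qed.

Definition pl_term (t : triple) : term C ('I_8 * 'I_3)%type :=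
  let x m n := TV C (tnth3 t m, n) in
  let sub a b := TA a (TM (TC _ (-1)) b) in
  TA (sub (TM (x 0 0) (sub (TM (x 1 1) (x 2 2)) (TM (x 1 2) (x 2 1))))
          (TM (x 1 0) (sub (TM (x 0 1) (x 2 2)) (TM (x 0 2) (x 2 1)))))
     (TM (x 2 0) (sub (TM (x 0 1) (x 1 2)) (TM (x 0 2) (x 1 1)))).

Lemma teval_pl_term (B : comNzRingType) (i : {rmorphism C -> B}) x t :
  teval i x (pl_term t) = pl (fun a m => x (a, m)) t.
Proof. by rewrite /pl_term /= rmorphN rmorph1 /pl /vbr !mulN1r. Qed.

(** Once all brackets are multiplied in to the power [shift_bound f], membership in the ideal is a
    polynomial identity in the matrix entries; it is checked on complex matrices and carried to
    every algebra by [term_vanish]. *)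
Lemma Gr0_ideal_pl f (B : comNzRingType) (i : {rmorphism C -> B})
    (x : 'I_8 -> 'I_3 -> B) : I f ->
  \sum_(u <- msupp f) i f@_u *
     \prod_(t <- enum triple) pl x t ^+ shift_exp (shift_bound f) u t = 0.
Proof.
move=> If; set N := shift_bound f.
pose g := tsum (msupp f) (fun u => TM (TC _ f@_u)
   (tprod (enum triple) (fun t => tpow (pl_term t) (shift_exp N u t)))).
have gE (B' : comNzRingType) (i' : {rmorphism C -> B'}) y : teval i' y g =
    \sum_(u <- msupp f) i' f@_u *
     \prod_(t <- enum triple) pl (fun a m => y (a, m)) t ^+ shift_exp N u t.
  rewrite teval_sum; apply: eq_bigr => u _ /=; congr (_ * _).
  rewrite teval_prod; apply: eq_bigr => t _.
  by rewrite teval_pow teval_pl_term.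
suff g0 : forall y, teval idfun y g = 0.
  by have := term_vanish i g0 (fun z => x z.1 z.2); rewrite gE.
move=> y; rewrite gE.
pose A : 'M[C]_(3, 8) := \matrix_(m, a) y (a, m).
have plA t : pluecker A t = pl (fun a m => y (a, m)) t.
  rewrite pluecker_pl; congr (pl _ t).
  by apply: funext => a; apply: funext => m; rewrite mxE.
(* If some bracket vanishes, the matrix gives no point of [Gr0]. Every monomial then vanishes, since
   the successor in [shift_bound] makes all exponents positive. *)
have [nz|] := pselect (forall t, pl (fun a m => y (a, m)) t != 0); last first.
  move=> /existsNP[t /negP]; rewrite negbK => /eqP t0.
  rewrite big1_seq // => u /andP[_ uf].
  rewrite (bigD1_seq t) ?enum_uniq ?mem_enum //= t0 expr0n.
  have [pos _] := shift_expE t uf.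
  by rewrite (gtn_eqF pos) mul0r mulr0.
have GA : Gr0 A.
  split; last by move=> t; rewrite plA.
  by apply: row_free_minor (_ : pluecker A tri0 != 0); rewrite plA.
have := If A GA; rewrite laurent_evalE /lev /grpalg_eval mmapE /= => e0.
transitivity ((\prod_(t <- enum triple) pl (fun a m => y (a, m)) t ^+ N) *
  \sum_(u <- msupp f) f@_u * lmon (pluecker A) u); last by rewrite e0 mulr0.
rewrite mulr_sumr big_seq_cond [RHS]big_seq_cond.
apply: eq_bigr => u; rewrite andbT => uf /=; rewrite mulrCA; congr (_ * _).
rewrite /lmon -big_enum -big_split /=; apply: eq_bigr => t _.
by rewrite plA !exprnP (shift_expE t uf).2 expfzDr.
Qed.

(** Compares coefficients of [t] at [M + m] in the identity for the matrix [v]. The factor that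
    clears denominators has weight [M], so exactly the terms of [f] of weight [m] contribute, each
    through its leading coefficient. *)
Lemma ev_trunc m f : I f -> (forall u, u \in msupp f -> m <= pairing u w) ->
  ev (trunc w m f) = 0.
Proof.
move=> If fm; have e0 := Gr0_ideal_pl (@grpalgC k R \o iota) v If.
pose N := shift_bound f.
pose M := N%:R * \sum_(t <- enum triple) w t.
pose wt u := \sum_(t <- enum triple) w t *+ shift_exp N u t.
have wtE u : u \in msupp f -> wt u = M + pairing u w.
  move=> uf; rewrite /wt /M /pairing -[in RHS]big_enum /= mulr_sumr -big_split /=.
  apply: eq_bigr => t _; rewrite -mulrDl -[LHS](mulr_natl (w t : R)); congr (_ * _).
  by rewrite [LHS]pmulrn (shift_expE t uf).2 rmorphD.
have co u : u \in msupp f ->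
    (grpalgC R (iota f@_u) *
     \prod_(t <- enum triple) pl v t ^+ shift_exp N u t)@_(M + m) =
    if pairing u w == m then
      iota f@_u * \prod_(t <- enum triple) r t ^+ shift_exp N u t else 0.
  move=> uf; rewrite mcoeff_grpalgCM.
  have [lo_u co_u] := lo_prod (enum triple)
    (fun t => (lo_exp (shift_exp N u t) (@v_lo t)).1).
  rewrite -/(wt u) wtE // in lo_u co_u.
  case: eqP => [um|/eqP um].
    rewrite -um co_u; congr (_ * _); apply: eq_bigr => t _.
    exact: (lo_exp _ (@v_lo t)).2.
  by rewrite lo_u ?mulr0 // ltrD2l lt_neqAle eq_sym um fm.
have {e0} : \sum_(u <- msupp f | pairing u w == m)
    iota f@_u * \prod_(t <- enum triple) r t ^+ shift_exp N u t = 0.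
  have := congr1 (mcoeff (M + m)) e0; rewrite mcoeff0 raddf_sum /= => eM; rewrite -[RHS]eM.
  by rewrite big_mkcond; apply: eq_big_seq => u uf; rewrite -co.
move=> /(congr1 (@tofrac k)); rewrite rmorph0 rmorph_sum /= => e0.
have nz : \prod_(t <- enum triple) rP t ^+ N != 0.
  by rewrite prodf_seq_neq0; apply/allP => t _ /=; rewrite expf_neq0.
apply: (mulfI nz); rewrite mulr0 -[RHS]e0 /ev /lev /trunc /grpalg_filter.
rewrite grpalg_eval_sum mulr_sumr big_seq_cond [RHS]big_seq_cond.
apply: eq_bigr => u /andP[uf _]; rewrite grpalg_evalU mulrCA rmorphM /=.
congr (_ * _); rewrite rmorph_prod /lmon -big_enum -big_split /=.
apply: eq_bigr => t _.
by rewrite rmorphXn /= -/(rP t) !exprnP (shift_expE t uf).2 expfzDr.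
Qed.

Lemma sum_chi (u : character) : \sum_(t <- enum triple) chi t *~ val u t = u.
Proof.
apply: val_inj; rewrite big_enum raddf_sum /=; apply/ffunP => s.
rewrite sum_ffunE; transitivity (\sum_t ((s == t)%:R * val u t - (s == tri0)%:R * val u t)).
  apply: eq_bigr => t _; rewrite -mulrBl.
  have -> : sval (chi t *~ sval u t) = val (chi t) *~ val u t.
    exact: (raddfMz (\val : {additive character -> {ffun triple -> int}})).
 
 by rewrite ffunMzE mulrzz /= ffunE.
rewrite sumrB -mulr_sumr (eqP (valP u)) mulr0 subr0 (bigD1 s) //= eqxx mul1r.
by rewrite big1 ?addr0 // => t /negPf ts; rewrite eq_sym ts mul0r.
Qed.

Lemma grpalg_expU (K : comNzRingType) (G : zmodType) (a : G) n :
  (<< 1 *g a >> : grpalg K G) ^+ n = << 1 *g a *+ n >>.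
Proof. by elim: n => // n IHn; rewrite exprS IHn grpalgUU mulr1 mulrS. Qed.

Lemma grpalg_prodU (K : comNzRingType) (G : zmodType) (T : Type) (s : seq T)
    (a : T -> G) :
  \prod_(t <- s) (<< 1 *g a t >> : grpalg K G) = << 1 *g \sum_(t <- s) a t >>.
Proof.
elim: s => [|t s IHs]; first by rewrite !big_nil.
by rewrite !big_cons IHs grpalgUU mulr1.
Qed.

(** Clearing denominators makes [g] a term that vanishes at [r]. Specialization puts a monomial
    times [g] into [Q], and the monomial is a unit. *)
Lemma ev_mem g Q : ev g = 0 -> VJ Q -> Q g.
Proof.
move=> g0 VQ; have [[_ _ QM] _ _] := VJ_prime VQ.
set N := shift_bound g.
pose G := tsum (msupp g) (fun u => TM (TC _ g@_u)
   (tprod (enum triple) (fun t => tpow (TV C t) (shift_exp N u t)))).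
have GE (B' : comNzRingType) (i' : {rmorphism C -> B'}) y : teval i' y G =
    \sum_(u <- msupp g) i' g@_u * \prod_(t <- enum triple) y t ^+ shift_exp N u t.
  rewrite teval_sum; apply: eq_bigr => u _ /=; congr (_ * _).
  by rewrite teval_prod; apply: eq_bigr => t _; rewrite teval_pow.
have G0 : teval iota r G = 0.
  apply/eqP; rewrite -tofrac_eq0 GE rmorph_sum; apply/eqP.
  transitivity ((\prod_(t <- enum triple) rP t ^+ N) * ev g); last by rewrite g0 mulr0.
  rewrite /ev /lev /grpalg_eval mmapE mulr_sumr; apply: eq_big_seq => u ug.
  rewrite rmorphM mulrCA /=; congr (_ * _).
  rewrite rmorph_prod /lmon -big_enum -big_split /=; apply: eq_bigr => t _.
  by rewrite rmorphXn /= -/(rP t) !exprnP (shift_expE t ug).2 expfzDr.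
have := r_spec (tin_setT G) G0 VQ; rewrite GE.
pose c0 : character := \sum_(t <- enum triple) chi t *+ N.
have -> : \sum_(u <- msupp g) iL g@_u *
    \prod_(t <- enum triple) (@qpt R t) ^+ shift_exp N u t =
    (<< 1 *g c0 >> : grpalg C character) * g.
  transitivity (\sum_(u <- msupp g) (<< 1 *g c0 >> : grpalg C character)
                 * (<< g@_u *g u >> : grpalg C character)); last first.
    by rewrite -mulr_sumr -monalgE.
  apply: eq_big_seq => u ug.
  under eq_bigr do rewrite /qpt grpalg_expU.
  rewrite grpalg_prodU -[iL _]/(<< g@_u *g 0 >> : grpalg C character) !grpalgUU.
  rewrite mul1r mulr1 add0r; congr (<< _ *g _ >>).
  rewrite /c0 -{2}(sum_chi u) -big_split /=; apply: eq_bigr => t _.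
  by rewrite pmulrn (shift_expE t ug).2 mulrzDr.
move=> /(QM (<< 1 *g - c0 >> : grpalg C character)).
have -> // : (<< 1 *g - c0 >> : grpalg C character) *
         ((<< 1 *g c0 >> : grpalg C character) * g) = g.
by rewrite mulrA grpalgUU addNr mulr1 mul1r.
Qed.

(** The kernel [P] of [ev] lies in [VJ] by [ev_trunc] and below all its members by [ev_mem]. It is
    thus a generic point: a closed set that contains [P] contains [VJ]. *)
Lemma irreducible_generic : irreducible VJ.
Proof.
pose P : set L := fun f => ev f = 0.
have iP_ideal : ideal P.
  split=> [|f g f0 g0|a f f0].
  - exact: grpalg_eval0.
  - by rewrite /P evD f0 g0 addr0.
  - by rewrite /P evM f0 mulr0.
have VP : VJ P.
  split; first split=> //.
  - by move=> /eqP; rewrite /ev /lev grpalg_eval1 ?oner_eq0 //; exact: lmon0.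
  - by move=> f g /eqP; rewrite evM mulf_eq0 => /orP[/eqP|/eqP]; [left|right].
  apply: ideal_gen_sub => // _ [f If <-].
  have [f0|fn0] := eqVneq (enum_fset (msupp f)) [::].
    rewrite /initial_form.
    have -> : \sum_(u <- msupp f | all (fun x => pairing u w <= pairing x w) (msupp f))
      (<< f@_u *g u >> : grpalg C character) = 0 by rewrite f0 big_nil.
    exact: grpalg_eval0.
  have [u uf um] := seq_min (fun u => pairing u w) fn0.
  rewrite (initial_trunc um); last by exists u.
  exact: ev_trunc.
split; first by exists P.
move=> Z1 Z2 [E1 ->] [E2 ->] sub.
by case: (sub _ VP) => -[_ EP]; [left|right] => Q VQ; split;
  [exact: VJ_prime | move=> f /EP Pf; exact: ev_mem
  |exact: VJ_prime | move=> f /EP Pf; exact: ev_mem].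
Qed.

End GenericPoint.

(** * Initial Pluecker relations *)

Lemma grpalg_sgnU (K : comNzRingType) (G : zmodType) (b : bool) (u : G) :
  (-1) ^+ b * (<< 1 *g u >> : grpalg K G) = << (-1) ^+ b *g u >>.
Proof. by case: b; rewrite ?expr1 ?expr0 ?mul1r // mulN1r -monalgUN. Qed.

Lemma grpalg_eval3 (K B : comNzRingType) (G : zmodType) (i : {rmorphism K -> B})
    (h : G -> B) a b c u v x :
  grpalg_eval i h (<< a *g u >> + << b *g v >> + << c *g x >>) =
  i a * h u + i b * h v + i c * h x.
Proof. by rewrite !grpalg_evalD !grpalg_evalU. Qed.

Lemma grpalg_filter3 (K : comNzRingType) (G : zmodType) (P : pred G)
    (a b c : K) u v x :
  grpalg_filter P (<< a *g u >> + << b *g v >> + << c *g x >>) =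
  (if P u then << a *g u >> else 0) + (if P v then << b *g v >> else 0)
  + (if P x then << c *g x >> else 0).
Proof. by rewrite !grpalg_filterD !grpalg_filterU. Qed.

Section InitialRelations.
Variables (R : realType) (w : cochar R).
Local Notation C := R[i]%C.
Local Notation L := (laurent R).
Local Notation VJ := (initial_degeneration w).

Definition W (i j k : 'I_8) : R := w (tri i j k).

(* The part of weight [mu] of a three-term Pluecker relation. *)
Definition inrel (B : comNzRingType) (x : triple -> B) i j k l m (mu : R) : B :=
  (if W i j k + W i l m == mu then bx x i j k * bx x i l m else 0)
  - (if W i j l + W i k m == mu then bx x i j l * bx x i k m else 0)
  + (if W i j m + W i k l == mu then bx x i j m * bx x i k l else 0).

Lemma qptN Q t : VJ Q -> ~ Q (@qpt R t).
Proof.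
move=> VQ; have [[_ _ QM] Q1 _] := VJ_prime VQ.
move=> /(QM (<< 1 *g - chi t >> : grpalg C character)); rewrite /qpt.
by rewrite grpalgUU addNr mulr1.
Qed.

Lemma bx_qptN Q i j k : VJ Q -> ~ Q (bx (@qpt R) i j k).
Proof.
by move=> VQ; have [iQ _ _] := VJ_prime VQ; move=> /(ideal_sign iQ); exact: qptN.
Qed.

(** The Pluecker relation is rewritten in dehomogenized coordinates, so that it lies in the Laurent
    ideal, and truncated at [mu], which need only be a lower bound of the three weights. *)
Lemma inrel_VJ Q i j k l m mu : uniq [:: i; j; k; l; m] ->
  mu <= W i j k + W i l m -> mu <= W i j l + W i k m ->
  mu <= W i j m + W i k l ->
  VJ Q -> Q (inrel (@qpt R) i j k l m mu).
Proof.
move=> u5 m1 m2 m3 [_ JQ].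
pose c a b c a' b' c' : C := (-1) ^+ sb a b c * (-1) ^+ sb a' b' c'.
pose u a b c a' b' c' := chi (tri a b c) + chi (tri a' b' c').
have bxM a b d a' b' d' : bx (@qpt R) a b d * bx (@qpt R) a' b' d' =
    << c a b d a' b' d' *g u a b d a' b' d' >>.
  rewrite /bx /qpt; apply: etrans (grpalgUU _ _ _ _).
  by rewrite -!grpalg_sgnU.
have pu a b d a' b' d' : pairing (u a b d a' b' d') w =
    W a b d + W a' b' d' - w tri0 *+ 2.
  by rewrite pairingD !pairing_chi /W mulr2n; ring.
pose F : grpalg C character := << c i j k i l m *g u i j k i l m >>
  + << - c i j l i k m *g u i j l i k m >> + << c i j m i k l *g u i j m i k l >>.
(* Each of the two brackets in a product loses the weight of [tri0] by dehomogenization. *)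
pose mm : R := mu - w tri0 *+ 2.
have Fsupp v : v \in msupp F -> mm <= pairing v w.
  move=> /(fsubsetP (msuppD_le _ _)); rewrite in_fsetU => /orP[].
    move=> /(fsubsetP (msuppD_le _ _)); rewrite in_fsetU => /orP[].
      by move=> /(fsubsetP msuppU_le); rewrite in_fset1 => /eqP->; rewrite pu lerD2r.
    by move=> /(fsubsetP msuppU_le); rewrite in_fset1 => /eqP->; rewrite pu lerD2r.
  by move=> /(fsubsetP msuppU_le); rewrite in_fset1 => /eqP->; rewrite pu lerD2r.
have FI : Gr0_ideal F.
  move=> A [_ A0]; apply: etrans (grpalg_eval3 idfun (lmon (pluecker A)) _ _ _ _ _ _) _.
  rewrite !(lmonD A0) !(lmon_chi _ A0).
  have := plrel_pl (fun a b => A b a) u5.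
  have -> : pl (fun a b => A b a) = pluecker A.
    by apply: funext => t; rewrite pluecker_pl.
  rewrite /plrel /bx /c => e0.
  have -> : forall a1 a2 a3 a4 a5 a6 b1 b2 b3 b4 b5 b6 d : C,
     a1 * a2 * (b1 / d * (b2 / d)) + - (a3 * a4) * (b3 / d * (b4 / d))
     + a5 * a6 * (b5 / d * (b6 / d)) =
     (a1 * b1 * (a2 * b2) - a3 * b3 * (a4 * b4) + a5 * b5 * (a6 * b6)) / d / d.
    by move=> *; ring.
  by rewrite e0 !mul0r.
have := J_trunc FI Fsupp; rewrite /trunc /F grpalg_filter3 !pu.
rewrite !(inj_eq (addIr _)) monalgUN => JF.
apply: eq_ind (JQ _ JF) _ _; rewrite /inrel; congr (_ + _ + _).
- by case: ifP => _ //; rewrite bxM.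
- by case: ifP => _; rewrite ?oppr0 // bxM.
- by case: ifP => _ //; rewrite bxM.
Qed.

(* The initial forms of the Pluecker relations contain no monomial. *)
Definition dressian : Prop := forall i j k l m : 'I_8, uniq [:: i; j; k; l; m] ->
  W i j l + W i k m <= W i j k + W i l m \/ W i j m + W i k l <= W i j k + W i l m.

Lemma TGr0_VJ : TGr0 w -> exists Q, VJ Q.
Proof.
move=> wT; have iJ := ideal_gen_ideal (initial_form w @` @Gr0_ideal R)%classic.
have [|Q [PQ JQ]] := ideal_prime_sup iJ; last by exists Q.
move=> J1; apply: wT; apply/seteqP; split.
  have [_ _ M] := ideal_gen_ideal ([set 1 : L])%classic.
  move=> f _; rewrite -[f]mulr1; apply: M; exact: sub_ideal_gen.
apply: ideal_gen_sub => // _ ->; exact: J1.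
Qed.

(** A product of weight strictly below the other two would be, up to sign, a monomial in [Q]; but
    monomials are units. *)
Lemma VJ_dressian Q : VJ Q -> dressian.
Proof.
move=> VQ i j k l m u5; have [_ _ QP] := VJ_prime VQ.
case: leP => [|h1]; first by left.
case: leP => [|h2]; first by right.
have := inrel_VJ u5 (lexx _) (ltW h1) (ltW h2) VQ.
rewrite /inrel eqxx !gt_eqF // subr0 addr0 => /QP[].
  by move/(bx_qptN VQ).
by move/(bx_qptN VQ).
Qed.

End InitialRelations.

Section StrictOrder.
Variables (k : idomainType) (R : realType).
Implicit Types (f g : grpalg k R) (a b : R).

(** The order exceeds [a]. This strict form measures progress in the descent on the largest
    defect. *)
Definition los f a : Prop := forall u : R, u <= a -> f@_u = 0.

Lemma losD f g a : los f a -> los g a -> los (f + g) a.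
Proof. by move=> fa ga u ua; rewrite mcoeffD fa // ga // addr0. Qed.

Lemma losN f a : los f a -> los (- f) a.
Proof. by move=> fa u ua; rewrite mcoeffN fa // oppr0. Qed.

Lemma lo_los f a b : b < a -> lo f a -> los f b.
Proof. by move=> ba fa u ub; apply/fa/(le_lt_trans ub). Qed.

Lemma los_lo f a : los f a -> lo f a.
Proof. by move=> fa u ua; rewrite fa // ltW. Qed.

Lemma losM f g a b : los f a -> lo g b -> los (f * g) (a + b).
Proof.
move=> fa gb u; rewrite le_eqVlt => /predU1P[->|uab].
  by rewrite mcoeff_loM ?fa ?mul0r //; exact: los_lo.
exact: (loM (los_lo fa) gb).
Qed.

Lemma los_mulKr f g a b : lo g b -> g@_b != 0 -> los (f * g) (a + b) -> los f a.
Proof.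
move=> gb gb0 fgab; have fa := lo_mulKr gb gb0 (los_lo fgab).
move=> u; rewrite le_eqVlt => /predU1P[->|/fa //].
have := fgab _ (lexx _); rewrite mcoeff_loM // => /eqP.
by rewrite mulf_eq0 (negPf gb0) orbF => /eqP.
Qed.

Lemma mcoeff_sign (n : nat) f a : ((-1) ^+ n * f)@_a = (-1) ^+ n * f@_a.
Proof.
rewrite -signr_odd -[in RHS]signr_odd.
by case: (odd n); rewrite ?expr1 ?expr0 ?mulN1r ?mul1r ?mcoeffN.
Qed.

Lemma lo_sign (n : nat) f a : lo ((-1) ^+ n * f) a <-> lo f a.
Proof.
split=> fa u ua; last by rewrite mcoeff_sign fa ?mulr0.
by have /eqP := fa u ua; rewrite mcoeff_sign mulf_eq0 signr_eq0 => /eqP.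
Qed.

Lemma los_sign (n : nat) f a : los ((-1) ^+ n * f) a <-> los f a.
Proof.
split=> fa u ua; last by rewrite mcoeff_sign fa ?mulr0.
by have /eqP := fa u ua; rewrite mcoeff_sign mulf_eq0 signr_eq0 => /eqP.
Qed.

End StrictOrder.

Definition cross (B : comNzRingType) (x y : 'I_3 -> B) (m : 'I_3) : B :=
  if m == 0 then x 1 * y 2 - x 2 * y 1
  else if m == 1 then x 2 * y 0 - x 0 * y 2 else x 0 * y 1 - x 1 * y 0.

Section Cross.
Variable B : comNzRingType.
Implicit Types x y z t : 'I_3 -> B.

Definition dot x y : B := x 0 * y 0 + x 1 * y 1 + x 2 * y 2.

Lemma vbr_dot x y z : vbr x y z = dot (cross x y) z.
Proof. by rewrite /vbr /dot /cross /=; ring. Qed.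

Lemma dot_solve x y z a b c :
  let v m := a * cross y z m + b * cross z x m + c * cross x y m in
  [/\ dot x v = a * vbr x y z, dot y v = b * vbr x y z & dot z v = c * vbr x y z].
Proof. by rewrite /dot /vbr /cross /=; split; ring. Qed.

(** The determinant of the three linear conditions imposed on a new column factors into two old
    brackets, so its order and leading coefficient are known. *)
Lemma vbr_cross x y z t :
  vbr (cross x y) (cross x z) (cross y t) = vbr x y z * vbr x y t.
Proof. by rewrite /vbr /cross /=; ring. Qed.

End Cross.

(** * Realizing one more point *)

Section Extension.
Variables (R : realType) (w : cochar R).
Local Notation C := R[i]%C.
Local Notation L := (laurent R).
Local Notation VJ := (initial_degeneration w).
Local Notation W := (W w).
Local Notation inside S := [set t : triple | val t \subset S]%SET.
Implicit Types (S : {set 'I_8}) (i j k l e a b : 'I_8).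

Lemma WP i j k : W i j k = W j i k. Proof. by rewrite /W triP. Qed.
Lemma WR i j k : W i j k = W i k j. Proof. by rewrite /W triR. Qed.

Definition realized S : Prop :=
  exists (k : idomainType) (iota : {rmorphism C -> k}) (v : 'I_8 -> 'I_3 -> grpalg k R),
    (forall t, t \in inside S -> lo (pl v t) (w t) /\ (pl v t)@_(w t) != 0) /\
    spec (@iL R) (@qpt R) VJ iota (fun t => (pl v t)@_(w t)) (inside S).

(* In the three-term relation between [i j e], [i l e] and [i k e], the last
   bracket is determined modulo higher order terms by those of the first two
   that contribute to the initial form. *)
Definition solvable S e (kn : 'I_8 -> 'I_8 -> Prop) : Prop :=
  forall i j l k, i \in S -> j \in S -> l \in S -> k \in S ->
    uniq [:: i; j; l; k] ->
    W i k e + W i j l <= W i j e + W i k l ->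
    W i k e + W i j l <= W i l e + W i j k ->
    (W i k e + W i j l = W i j e + W i k l -> kn i j) ->
    (W i k e + W i j l = W i l e + W i j k -> kn i l) -> kn i k.

(** The seed pairs form a path [k i j l], or a triangle when [k = l]; they name the free brackets.
    Quantifying over all [kn] says that the closure of the seeds under solving contains every
    pair. *)
Definition good S e : Prop := exists i j k l,
  [/\ [/\ i \in S, j \in S, k \in S & l \in S], uniq [:: i; j; k], uniq [:: i; j; l] &
   forall kn : 'I_8 -> 'I_8 -> Prop, (forall a b, kn a b -> kn b a) ->
     kn i j -> kn i k -> kn j l -> solvable S e kn ->
     forall a b, a \in S -> b \in S -> a != b -> kn a b].

Lemma inside_tri S i j k : uniq [:: i; j; k] ->
  (tri i j k \in inside S) = [&& i \in S, j \in S & k \in S].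
Proof.
move=> u; rewrite inE val_tri //; apply/fintype.subsetP/and3P.
  by move=> sub; split; apply: sub; rewrite !inE eqxx ?orbT.
by move=> [iS jS kS] x; rewrite !inE => /orP[/orP[]|] /eqP->.
Qed.

Lemma inside_setU1 S e t : t \in inside (e |: S)%SET ->
  t \in inside S \/ exists a b, [/\ a \in S, b \in S, uniq [:: a; b; e] & t = tri a b e].
Proof.
elim/triple_ind: t => i j k /andP[ij jk].
have u : uniq [:: i; j; k].
  by rewrite /= !inE negb_or -!val_eqE /= !ltn_eqF // (ltn_trans ij).
rewrite !inside_tri //; move: u; rewrite /= !inE !negb_or !andbT.
move=> /andP[/andP[nij nik] njk].
have [ie|ie] := eqVneq i e; have [je|je] := eqVneq j e; have [ke|ke] := eqVneq k e => /=;
  do ?by move: nij nik njk; subst; rewrite ?eqxx.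
- move=> /andP[jS kS]; right; exists j, k; rewrite jS kS -ie; split=> //.
    by rewrite /= !inE !negb_or njk ![_ == i]eq_sym nij nik.
  by rewrite triP triR.
- move=> /andP[iS kS]; right; exists i, k; rewrite iS kS -je; split=> //.
    by rewrite /= !inE !negb_or nik [k == _]eq_sym nij njk.
  by rewrite triR.
- move=> /and3P[iS jS _]; right; exists i, j; rewrite iS jS -ke; split=> //.
  by rewrite /= !inE !negb_or nij nik njk.
- by left.
Qed.

Lemma mcoeff_bx (k : idomainType) (v : 'I_8 -> 'I_3 -> grpalg k R) a b c :
  (bx (pl v) a b c)@_(W a b c) = bx (fun t => (pl v t)@_(w t)) a b c.
Proof. by rewrite /bx mcoeff_sign. Qed.

(** Taking the coefficient at [mu] in the Pluecker relation of the matrix keeps the products of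
    weight [mu]. *)
Lemma inrel_point (k : idomainType) (v : 'I_8 -> 'I_3 -> grpalg k R) a b c d f mu :
  uniq [:: a; b; c; d; f] ->
  (forall x y z, uniq [:: x; y; z] -> {subset [:: x; y; z] <= [:: a; b; c; d; f]} ->
    lo (pl v (tri x y z)) (W x y z)) ->
  mu <= W a b c + W a d f -> mu <= W a b d + W a c f -> mu <= W a b f + W a c d ->
  inrel w (fun t => (pl v t)@_(w t)) a b c d f mu = 0.
Proof.
move=> u5 lov m1 m2 m3.
have term x y z x' y' z' : mu <= W x y z + W x' y' z' ->
    lo (pl v (tri x y z)) (W x y z) -> lo (pl v (tri x' y' z')) (W x' y' z') ->
    (bx (pl v) x y z * bx (pl v) x' y' z')@_mu =
    if W x y z + W x' y' z' == mu then
      bx (fun t => (pl v t)@_(w t)) x y z * bx (fun t => (pl v t)@_(w t)) x' y' z'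
    else 0.
  move=> mle lo1 lo2.
  have lo1' : lo (bx (pl v) x y z) (W x y z) by apply/lo_sign.
  have lo2' : lo (bx (pl v) x' y' z') (W x' y' z') by apply/lo_sign.
  case: eqP => [<-|/eqP ne]; first by rewrite mcoeff_loM // !mcoeff_bx.
  by apply: (loM lo1' lo2'); rewrite lt_neqAle eq_sym ne.
have := congr1 (mcoeff mu) (plrel_pl v u5); rewrite mcoeff0 => <-.
rewrite /plrel /inrel mcoeffD mcoeffB.
move: u5; rewrite /= !inE !negb_or !andbT.
move=> /and4P[/and4P[ab ac ad af] /and3P[bc bd bf] /andP[cd cf] df].
have sub x y z : x \in [:: a; b; c; d; f] -> y \in [:: a; b; c; d; f] ->
    z \in [:: a; b; c; d; f] -> {subset [:: x; y; z] <= [:: a; b; c; d; f]}.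
  move=> hx hy hz t; rewrite inE => /predU1P[->//|].
  by rewrite inE => /predU1P[->//|]; rewrite inE => /eqP->.
have lo5 x y z : uniq [:: x; y; z] -> x \in [:: a; b; c; d; f] ->
    y \in [:: a; b; c; d; f] -> z \in [:: a; b; c; d; f] ->
    lo (pl v (tri x y z)) (W x y z).
  by move=> u hx hy hz; apply: lov => //; exact: sub.
have in5 : [/\ a \in [:: a; b; c; d; f], b \in [:: a; b; c; d; f],
  c \in [:: a; b; c; d; f], d \in [:: a; b; c; d; f] & f \in [:: a; b; c; d; f]].
  by rewrite !inE !eqxx !orbT.
have [ia ib ic id jf] := in5.
congr (_ - _ + _); apply/esym/term; do ?[exact: m1|exact: m2|exact: m3];
  apply: lo5; do ?[exact: ia|exact: ib|exact: ic|exact: id|exact: jf];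
  by rewrite /= !inE ?negb_or ?ab ?ac ?ad ?af ?bc ?bd ?bf ?cd ?cf ?df.
Qed.

End Extension.

Lemma vbr_rmorph (B B' : comNzRingType) (f : {rmorphism B -> B'}) x y z :
  f (vbr x y z) = vbr (f \o x) (f \o y) (f \o z).
Proof. by rewrite /vbr /= !(rmorphD, rmorphN, rmorphM). Qed.

Lemma eq_of_alt_sum0 (V : zmodType) (x y z : V) : x - y + z = 0 -> x = y - z.
Proof. by move=> e0; apply/eqP; rewrite -subr_eq0 opprB addrA addrAC e0. Qed.

Section Extension.
Variables (R : realType) (w : cochar R).
Local Notation C := R[i]%C.
Local Notation L := (laurent R).
Local Notation VJ := (initial_degeneration w).
Local Notation W := (W w).
Local Notation inside S := [set t : triple | val t \subset S]%SET.
Implicit Types (S : {set 'I_8}) (i j k l e a b : 'I_8).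

Variables (S : {set 'I_8}) (e : 'I_8).
Hypothesis eS : e \notin S.

Let neS a : a \in S -> a != e.
Proof. by move=> aS; apply: contraNneq eS => <-. Qed.

Let uniqe a b : a \in S -> b \in S -> a != b -> uniq [:: a; b; e].
Proof. by move=> aS bS ab; rewrite /= !inE negb_or ab !neS. Qed.

Section Supports.
Variables (k : idomainType) (v : 'I_8 -> 'I_3 -> grpalg k R).
Hypothesis vS : forall t, t \in inside S -> lo (pl v t) (w t) /\ (pl v t)@_(w t) != 0.
Variables (i j p l : 'I_8).
Hypothesis gen : forall kn : 'I_8 -> 'I_8 -> Prop, (forall a b, kn a b -> kn b a) ->
     kn i j -> kn i p -> kn j l -> solvable w S e kn ->
     forall a b, a \in S -> b \in S -> a != b -> kn a b.
Hypothesis lo_ij : lo (pl v (tri i j e)) (W i j e).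
Hypothesis lo_ip : lo (pl v (tri i p e)) (W i p e).
Hypothesis lo_jl : lo (pl v (tri j l e)) (W j l e).

Lemma inside_bx a b c : uniq [:: a; b; c] -> a \in S -> b \in S -> c \in S ->
  lo (bx (pl v) a b c) (W a b c) /\ (bx (pl v) a b c)@_(W a b c) != 0.
Proof.
move=> u aS bS cS; have [|lo1 co1] := vS (t := tri a b c).
  by rewrite inside_tri ?aS ?bS.
split; first by apply/lo_sign.
by rewrite mcoeff_bx /bx mulf_neq0 ?signr_eq0.
Qed.

(* Otherwise consider the largest defect; the pairs with a smaller defect are
   closed under solving, hence there are no others. *)
Lemma supports_lo a b : a \in S -> b \in S -> a != b ->
  lo (pl v (tri a b e)) (W a b e).
Proof.
pose T := [set t | (t \in inside (e |: S)%SET) && (t \notin inside S)]%SET.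
pose s := [seq (t, u) | t <- enum T, u <- enum_fset (msupp (pl v t))].
have Ttri x y : x \in S -> y \in S -> x != y -> tri x y e \in T.
  move=> xS yS xy; rewrite inE !inside_tri ?uniqe // !inE xS yS eqxx (negPf eS).
  by rewrite !orbT.
have sP t (u : R) : t \in T -> (pl v t)@_u != 0 -> (t, u) \in s.
  move=> tT; rewrite mcoeff_neq0 => ut; apply/allpairsPdep; exists t, u.
  by rewrite mem_enum.
have [s0 aS bS ab u _|sn0] := eqVneq s [::].
  apply/eqP; apply: contraT => /(sP _ _ (Ttri _ _ aS bS ab)).
  by rewrite s0.
have [[t0 u0] tus mmin] := seq_min (fun x : triple * R => x.2 - w x.1) sn0.
set m : R := u0 - w t0 in mmin.
have mlo t : t \in T -> lo (pl v t) (w t + m).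
  move=> tT u um; apply/eqP; apply: contraTT um => /(sP _ _ tT)/mmin /= mu.
  by rewrite -leNgt; move: mu; lra.
suff m0 : 0 <= m.
  move=> aS bS ab; apply: loW (mlo _ (Ttri _ _ aS bS ab)).
  by rewrite /W lerDl.
rewrite leNgt; apply/negP => mneg.
pose kn x y := los (pl v (tri x y e)) (W x y e + m).
have base x y : lo (pl v (tri x y e)) (W x y e) -> kn x y.
  by apply: lo_los; rewrite gtrDl.
have knall : forall x y, x \in S -> y \in S -> x != y -> kn x y.
  apply: gen; [|exact: base|exact: base|exact: base|].
    by move=> x y; rewrite /kn WP (triP x).
  move=> x y z t xS yS zS tS /=; rewrite !inE !negb_or !andbT.
  move=> /and3P[/and3P[xy xz xt] /andP[yz yt] zt] le1 le2 k1 k2.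
  have [lo_b nz_b] : lo (bx (pl v) x y z) (W x y z) /\
      (bx (pl v) x y z)@_(W x y z) != 0.
    by apply: inside_bx; rewrite // /= !inE negb_or xy xz yz.
  suff : los (bx (pl v) x t e) (W x t e + m) by move/los_sign.
  apply: (los_mulKr lo_b nz_b).
  have u5 : uniq [:: x; t; e; y; z].
    rewrite /= !inE !negb_or xt xy xz (neS xS) (neS tS) ![e == _]eq_sym.
    by rewrite (neS yS) (neS zS) yz ![t == _]eq_sym yt zt.
  have -> : bx (pl v) x t e * bx (pl v) x y z =
      bx (pl v) x t y * bx (pl v) x e z - bx (pl v) x t z * bx (pl v) x e y.
    exact: eq_of_alt_sum0 (plrel_pl v u5).
  have part q q' : q \in S -> q' \in S -> x != q -> x != q' -> t != q -> q != q' ->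
     W x t e + W x y z <= W x q' e + W x q t ->
     (W x t e + W x y z = W x q' e + W x q t -> kn x q') ->
     los (bx (pl v) x t q * bx (pl v) x e q') (W x t e + m + W x y z).
    move=> qS q'S xq xq' tq qq' le k'.
    have [lo_q _] : lo (bx (pl v) x t q) (W x t q) /\
        (bx (pl v) x t q)@_(W x t q) != 0.
      by apply: inside_bx; rewrite // /= !inE negb_or xt xq tq.
    have eqm : W x t e + m + W x y z <= W x q' e + m + W x t q.
      by rewrite (WR w x t q); lra.
    (* In a tie the strict gain comes from the known pair [x q']; otherwise the gap between the
       weights supplies it and the bound [m] suffices. *)
    have [eqw|ltw] := eqVneq (W x t e + W x y z) (W x q' e + W x q t).
      have -> : W x t e + m + W x y z = W x q' e + m + W x t q.
        by rewrite (WR w x t q); lra.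
      rewrite mulrC; apply: losM lo_q; apply/los_sign.
      by rewrite triR; exact: k'.
    apply: (@lo_los _ _ _ (W x q' e + m + W x t q)).
      have : W x t e + W x y z < W x q' e + W x q t by rewrite lt_neqAle ltw.
      by rewrite (WR w x t q); lra.
    rewrite mulrC; apply: loM lo_q; apply/lo_sign; rewrite triR.
    exact: mlo (Ttri _ _ xS q'S xq').
  apply: losD.
    by apply: part => //; rewrite 1?eq_sym.
  apply: losN; apply: part => //; rewrite 1?eq_sym // (WR w x z t) //.
have /allpairsPdep[t1 [u1 [t1T u1M [et eu]]]] := tus.
move: t1T u1M; rewrite mem_enum -et -eu inE -mcoeff_neq0 => /andP[tin tout] nz.
have [tS|[a1 [b1 [aS1 bS1 uab tE]]]] := inside_setU1 tin; first by rewrite tS in tout.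
have ab1 : a1 != b1 by move: uab; rewrite /= !inE negb_or => /andP[/andP[]].
move: nz; rewrite tE (knall _ _ aS1 bS1 ab1) ?eqxx //.
by rewrite /m tE /W addrC subrK.
Qed.

End Supports.
End Extension.

Lemma tnth3_in (t : triple) (m : 'I_3) : tnth3 t m \in val t.
Proof.
by rewrite -mem_enum /tnth3 mem_nth // size_enum_triple.
Qed.

Lemma eq_pl (B : comNzRingType) (x y : 'I_8 -> 'I_3 -> B) (t : triple) :
  {in val t, x =1 y} -> pl x t = pl y t.
Proof. by move=> xy; rewrite /pl !xy ?tnth3_in. Qed.

Section Extension.
Variables (R : realType) (w : cochar R).
Local Notation C := R[i]%C.
Local Notation L := (laurent R).
Local Notation VJ := (initial_degeneration w).
Local Notation W := (W w).
Local Notation inside S := [set t : triple | val t \subset S]%SET.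
Implicit Types (S : {set 'I_8}) (i j k l e a b : 'I_8).

Definition bxt a b c : term C triple := TM (TC _ ((-1) ^+ sb a b c)) (TV C (tri a b c)).

(* Once all the supports are bounded below, every bracket with [e] specializes,
   by induction along the solvable relations. *)
Lemma spec_extend (k : idomainType) (iota : {rmorphism C -> k})
    (v : 'I_8 -> 'I_3 -> grpalg k R) S e (E : {set triple}) kn0 :
  e \notin S ->
  (forall t, t \in inside (e |: S)%SET -> lo (pl v t) (w t)) ->
  (forall t, t \in inside S -> (pl v t)@_(w t) != 0) ->
  inside S \subset E ->
  (forall kn : 'I_8 -> 'I_8 -> Prop, (forall a b, kn a b -> kn b a) ->
    (forall a b, kn0 a b -> kn a b) -> solvable w S e kn ->
     forall a b, a \in S -> b \in S -> a != b -> kn a b) ->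
  (forall a b, kn0 a b -> tri a b e \in E) ->
  spec (@iL R) (@qpt R) VJ iota (fun t => (pl v t)@_(w t)) E ->
  spec (@iL R) (@qpt R) VJ iota (fun t => (pl v t)@_(w t)) (inside (e |: S)%SET).
Proof.
set r := (fun t => (pl v t)@_(w t)); move=> eS vlo rnz SE gen kn0E sE.
(* Instead of following derivations, a maximal set of brackets over which specialization holds is
   taken; maximality closes it under solving. *)
pose P (X : {set triple}) := `[< E \subset X /\ spec (@iL R) (@qpt R) VJ iota r X >].
have [|X /maxsetP[/asboolP[EX sX] Xmax]] := @ex_maxset _ P.
  by exists E; apply/asboolP.
have neS a : a \in S -> a != e by move=> aS; apply: contraNneq eS => <-.
suff knall : forall a b, a \in S -> b \in S -> a != b -> tri a b e \in X.
  move=> g gin; apply: sX; apply: tinS gin; apply/fintype.subsetP => t.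
  move=> /inside_setU1[tS|[a [b [aS bS uab ->]]]].
    by apply: (fintype.subsetP EX); exact: (fintype.subsetP SE).
  by apply: knall => //; move: uab; rewrite /= !inE negb_or => /andP[/andP[]].
apply: gen => [a b|a b /kn0E /(fintype.subsetP EX) //|]; first by rewrite triP.
move=> a b d c aS bS dS cS; rewrite /= !inE !negb_or !andbT.
move=> /and3P[/and3P[ab ad ac] /andP[bd bc] dc] le1 le2 k1 k2.
apply: contraT => cX.
have u5 : uniq [:: a; c; e; b; d].
  rewrite /= !inE !negb_or ac ab ad (neS _ aS) (neS _ cS) ![e == _]eq_sym.
  by rewrite (neS _ bS) (neS _ dS) bd ![c == _]eq_sym bc dc.
set mu := W a c e + W a b d.
have mu1 : mu <= W a c b + W a e d by rewrite (WR w a c b) (WR w a e d) addrC.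
have mu2 : mu <= W a c d + W a e b.
  by move: le1; rewrite /mu (WR w a c d) (WR w a e b); lra.
have lov x y z : uniq [:: x; y; z] -> {subset [:: x; y; z] <= [:: a; c; e; b; d]} ->
    lo (pl v (tri x y z)) (W x y z).
  move=> u sub; apply: vlo; rewrite inside_tri //.
  have in5 t : t \in [:: a; c; e; b; d] -> t \in (e |: S)%SET.
    rewrite !inE => /or4P[/eqP->|/eqP->|/eqP->|/orP[/eqP->|/eqP->]];
      by rewrite ?aS ?bS ?cS ?dS ?eqxx ?orbT.
  by apply/and3P; split; apply/in5/sub; rewrite !inE eqxx ?orbT.
have rrel : inrel w r a c e b d mu = 0 by apply: inrel_point.
(* The initial relation is read as an equation [m * x (tri a c e) = h], whence the sign of [a c e]
   inside [m]. Products above weight [mu] are dropped from [h], so only the tied brackets must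
   already be in [X]. *)
pose m : term C triple := TM (TC _ ((-1) ^+ sb a c e)) (bxt a b d).
pose h2 : term C triple := if W a c b + W a e d == mu
  then TM (bxt a c b) (bxt a e d) else TC _ 0.
pose h3 : term C triple := if W a c d + W a e b == mu
  then TM (bxt a c d) (bxt a e b) else TC _ 0.
pose h := TA h2 (TM (TC _ (-1)) h3).
have inX x y z : uniq [:: x; y; z] -> x \in S -> y \in S -> z \in S -> tri x y z \in X.
  move=> u xS yS zS; apply: (fintype.subsetP EX); apply: (fintype.subsetP SE).
  by rewrite inside_tri // xS yS.
have uabd : uniq [:: a; b; d] by rewrite /= !inE negb_or ab ad bd.
have mE (B : comNzRingType) (i : {rmorphism C -> B}) x :
    teval i x m * x (tri a c e) = bx x a c e * bx x a b d.
  by rewrite /m /bxt /= !rmorph_sign /bx; ring.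
have hE (B : comNzRingType) (i : {rmorphism C -> B}) x : teval i x h =
    (if W a c b + W a e d == mu then bx x a c b * bx x a e d else 0)
    - (if W a c d + W a e b == mu then bx x a c d * bx x a e b else 0).
  rewrite /h /= rmorphN rmorph1 mulN1r /h2 /h3; congr (_ - _).
    by case: ifP => _ /=; rewrite ?rmorph0 // !rmorph_sign.
  by case: ifP => _ /=; rewrite ?rmorph0 // !rmorph_sign.
have relE (B : comNzRingType) (i : {rmorphism C -> B}) x :
    inrel w x a c e b d mu = teval i x m * x (tri a c e) - teval i x h.
  by rewrite mE hE /inrel eqxx opprB [RHS]addrA addrAC.
have Xm : tin X m by rewrite /= inX.
have Xh : tin X h.
  rewrite /= /h2 /h3; apply/andP; split; case: ifP => //= /eqP e0.
    rewrite inX // ?[tri a e d]triR ?k2 //.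
      by rewrite /mu in e0; move: e0; rewrite (WR w a c b) (WR w a e d); lra.
    by rewrite /= !inE negb_or ac ab [c == b]eq_sym bc.
  rewrite inX // ?[tri a e b]triR ?k1 //.
    by rewrite /mu in e0; move: e0; rewrite (WR w a c d) (WR w a e b); lra.
  by rewrite /= !inE negb_or ac ad [c == d]eq_sym dc.
have sX' : spec (@iL R) (@qpt R) VJ iota r (tri a c e |: X).
  apply: (spec_solve (@VJ_prime R w) sX Xm Xh).
  - by apply/eqP; rewrite -subr_eq0 -relE rrel.
  - rewrite /= !rmorph_sign mulf_neq0 ?signr_eq0 // mulf_neq0 ?signr_eq0 //.
    by apply: rnz; rewrite inside_tri // aS bS.
  - move=> Q VQ; rewrite -(relE _ (@iL R) (@qpt R)).
    exact: inrel_VJ.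
  - move=> Q VQ; have [iQ _ _] := VJ_prime VQ.
    have -> : teval (@iL R) (@qpt R) m = (-1) ^+ sb a c e * bx (@qpt R) a b d.
      by rewrite /m /bxt /= !rmorph_sign.
    by move=> /(ideal_sign iQ) /(bx_qptN VQ).
have PX : P (tri a c e |: X)%SET.
  by apply/asboolP; split=> //; apply: fintype.subset_trans EX (finset.subsetUr _ _).
by move: cX; rewrite -(Xmax _ PX (finset.subsetUr _ _)) finset.setU11.
Qed.

End Extension.

Section Extension.
Variables (R : realType) (w : cochar R).
Local Notation C := R[i]%C.
Local Notation L := (laurent R).
Local Notation VJ := (initial_degeneration w).
Local Notation W := (W w).
Local Notation inside S := [set t : triple | val t \subset S]%SET.
Implicit Types (S : {set 'I_8}) (i j k l e a b : 'I_8).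

Lemma realized_extend S e : (exists Q, VJ Q) -> e \notin S -> good w S e ->
  realized w S -> realized w (e |: S)%SET.
Proof.
move=> [Q0 VQ0] eS [i [j [p [l [[iS jS pS lS] uijp uijl gen]]]]] [k [iota [v [vS sp]]]].
(* One indeterminate for the leading coefficient of each free bracket. *)
pose k1 : idomainType := {poly k}; pose k2 : idomainType := {poly k1}.
pose k3 : idomainType := {poly k2}.
pose phi : {rmorphism k -> k3} := @polyC k2 \o (@polyC k1 \o @polyC k).
pose i3 : {rmorphism C -> k3} := @polyC k2 \o (@polyC k1 \o (@polyC k \o iota)).
have phi0 x : (phi x == 0) = (x == 0) by rewrite /phi /= !polyC_eq0.
pose f : {rmorphism grpalg k R -> grpalg k3 R} := @grpalg_map k k3 phi R.
have fE x u : (f x)@_u = phi x@_u by exact: mcoeff_grpalg_map.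
pose v0 a m : grpalg k3 R := f (v a m).
pose La := cross (v0 i) (v0 j); pose Lb := cross (v0 i) (v0 p).
pose Lc := cross (v0 j) (v0 l).
(* [tau] is the order of [vbr La Lb Lc]. By [dot_solve] the free brackets of [ve] are [al], [be] and
   [ga] times this determinant, so their exponents are lowered by [tau]. *)
pose tau : R := W i j p + W i j l.
pose al : grpalg k3 R := << ('X%:P%:P : k3) *g W i j e - tau >>.
pose be : grpalg k3 R := << ('X%:P : k3) *g W i p e - tau >>.
pose ga : grpalg k3 R := << ('X : k3) *g W j l e - tau >>.
pose ve m := al * cross Lb Lc m + be * cross Lc La m + ga * cross La Lb m.
pose v' a := if a == e then ve else v0 a.
have neS a : a \in S -> a != e by move=> aS; apply: contraNneq eS => <-.
have v'S a : a \in S -> v' a = v0 a by move=> /neS /negPf ae; rewrite /v' ae.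
have v'e : v' e = ve by rewrite /v' eqxx.
pose r (t : triple) := (pl v t)@_(w t).
pose r' (t : triple) := (pl v' t)@_(w t).
have plS t : t \in inside S -> pl v' t = f (pl v t).
  rewrite inE => /fintype.subsetP tS; rewrite (@eq_pl _ v' v0) => [|a /tS /v'S //].
  by rewrite /pl -vbr_rmorph.
have rS t : t \in inside S -> r' t = phi (r t).
  by move=> tS; rewrite /r' plS // fE.
have v'lo t : t \in inside S -> lo (pl v' t) (w t).
  move=> tS u ut; rewrite plS // fE.
  by have [lo1 _] := vS t tS; rewrite (lo1 _ ut) rmorph0.
have r'0 t : t \in inside S -> r' t != 0.
  by move=> tS; rewrite rS // phi0; case: (vS t tS).
pose d0 := bx r i j p * bx r i j l.
have d00 : d0 != 0.
  rewrite /d0 /bx !mulf_neq0 ?signr_eq0 //.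
    by case: (vS (tri i j p)) => //; rewrite inside_tri ?iS ?jS ?pS.
  by case: (vS (tri i j l)) => //; rewrite inside_tri ?iS ?jS ?lS.
have coS a b c : uniq [:: a; b; c] -> a \in S -> b \in S -> c \in S ->
    (bx (pl v') a b c)@_(W a b c) = phi (bx r a b c).
  move=> u aS bS cS; rewrite mcoeff_bx /bx [RHS]rmorphM; congr (_ * _).
    exact/esym/rmorph_sign.
  by apply: rS; rewrite inside_tri ?aS ?bS.
have [lo_d co_d] : lo (vbr La Lb Lc) tau /\ (vbr La Lb Lc)@_tau = phi d0.
  rewrite vbr_cross -(v'S i iS) -(v'S j jS) -(v'S p pS) -(v'S l lS) !vbr_pl //.
  have lo1 : lo (bx (pl v') i j p) (W i j p).
    by apply/lo_sign/v'lo; rewrite inside_tri ?iS ?jS ?pS.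
  have lo2 : lo (bx (pl v') i j l) (W i j l).
    by apply/lo_sign/v'lo; rewrite inside_tri ?iS ?jS ?lS.
  split; first exact: loM.
  apply: (etrans (mcoeff_loM lo1 lo2)); rewrite /d0 [RHS]rmorphM.
  by congr (_ * _); apply: coS.
have solve a b (y : k3) : uniq [:: a; b; e] -> a \in S -> b \in S ->
    vbr (v' a) (v' b) (v' e) = (<< y *g W a b e - tau >> : grpalg k3 R) * vbr La Lb Lc ->
    lo (pl v' (tri a b e)) (W a b e) /\
    r' (tri a b e) = (-1) ^+ sb a b e * (y * phi d0).
  move=> u aS bS; rewrite (vbr_pl _ u) => E.
  have lo1 : lo (<< y *g W a b e - tau >> : grpalg k3 R) (W a b e - tau).
    exact: loU.
  have wE : W a b e = W a b e - tau + tau by rewrite subrK.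
  have lo2 : lo (bx (pl v') a b e) (W a b e).
    by rewrite E [X in lo _ X]wE; apply: loM.
  split; first by apply/lo_sign; exact: lo2.
  have : (bx (pl v') a b e)@_(W a b e) = y * phi d0.
    rewrite E [X in _@_X]wE; apply: (etrans (mcoeff_loM lo1 lo_d)).
    by rewrite mcoeffUU co_d.
  by rewrite mcoeff_bx -/r' /bx => <-; rewrite mulrA -expr2 sqrr_sign mul1r.
have ue a b : a \in S -> b \in S -> a != b -> uniq [:: a; b; e].
  by move=> aS bS ab; rewrite /= !inE negb_or ab !neS.
move: (uijp) (uijl); rewrite /= !inE !negb_or !andbT.
move=> /andP[/andP[ij ip] jp] /andP[/andP[_ il] jl].
have [sa sb' sc] := dot_solve La Lb Lc al be ga.
have vbrE a b : a \in S -> b \in S ->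
    vbr (v' a) (v' b) (v' e) = dot (cross (v0 a) (v0 b)) ve.
  by move=> aS bS; rewrite v'e (v'S a aS) (v'S b bS); exact: vbr_dot.
have [lo_a r_a] := solve i j 'X%:P%:P (ue _ _ iS jS ij) iS jS
  (etrans (vbrE _ _ iS jS) sa).
have [lo_b r_b] := solve i p 'X%:P (ue _ _ iS pS ip) iS pS
  (etrans (vbrE _ _ iS pS) sb').
have [lo_c r_c] := solve j l 'X (ue _ _ jS lS jl) jS lS
  (etrans (vbrE _ _ jS lS) sc).
have outS a b : a \in S -> b \in S -> a != b -> tri a b e \notin inside S.
  by move=> aS bS ab; rewrite inside_tri ?ue // (negPf eS) !andbF.
have trineq (x a b c d : 'I_8) : uniq [:: a; b; e] -> uniq [:: c; d; e] ->
    x \in [:: a; b; e] -> x \notin [:: c; d; e] -> tri a b e != tri c d e.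
  move=> u1 u2 xin; apply: contraNneq => /(congr1 val); rewrite !val_tri //.
  move=> /setP/(_ x); rewrite !inE -!orbA => <-.
  by move: xin; rewrite !inE.
have nab : tri i j e != tri i p e.
  apply: (trineq j); rewrite ?ue // !inE ?eqxx ?orbT // !negb_or.
  by rewrite [j == i]eq_sym ij jp neS.
have nac : tri i j e != tri j l e.
  by apply: (trineq i); rewrite ?ue // !inE ?eqxx ?orbT // !negb_or ij il neS.
have nbc : tri i p e != tri j l e.
  by apply: (trineq i); rewrite ?ue // !inE ?eqxx ?orbT // !negb_or ij il neS.
(* [r1], [r2], [r3] add one transcendental each, to fit three uses of [spec_free]. The factor [c1]
   collects the sign and the leading coefficient [d0] of the determinant. *)
pose c1 a b : k := (-1) ^+ sb a b e * d0.
have c10 a b : c1 a b != 0 by rewrite /c1 mulf_neq0 ?signr_eq0.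
pose r1 (t : triple) : k1 := if t == tri i j e then (c1 i j)%:P * 'X else (r t)%:P.
pose r2 (t : triple) : k2 :=
  if t == tri i p e then (c1 i p)%:P%:P * 'X else (r1 t)%:P.
pose r3 (t : triple) : k3 :=
  if t == tri j l e then (c1 j l)%:P%:P%:P * 'X else (r2 t)%:P.
have sp1 : spec (@iL R) (@qpt R) VJ (@polyC k \o iota) r1 (tri i j e |: inside S)%SET.
  apply: (spec_free (@VJ_prime R w) sp _ _ (c10 i j)); last by rewrite /r1 eqxx.
  move=> t tS; rewrite /r1; case: eqP tS => // ->.
  by rewrite (negPf (outS _ _ iS jS ij)).
have sp2 : spec (@iL R) (@qpt R) VJ (@polyC k1 \o (@polyC k \o iota)) r2
    (tri i p e |: (tri i j e |: inside S))%SET.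
  apply: (spec_free (@VJ_prime R w) sp1 (c := (c1 i p)%:P)); last 2 first.
  - by rewrite /r2 eqxx.
  - by rewrite polyC_eq0.
  move=> t; rewrite finset.in_setU1 /r2; case: (t =P tri i p e) => // ->.
  by rewrite [_ == tri i j e]eq_sym (negPf nab) (negPf (outS _ _ iS pS ip)).
have sp3 : spec (@iL R) (@qpt R) VJ i3 r3
    (tri j l e |: (tri i p e |: (tri i j e |: inside S)))%SET.
  apply: (spec_free (@VJ_prime R w) sp2 (c := (c1 j l)%:P%:P)); last 2 first.
  - by rewrite /r3 eqxx.
  - by rewrite !polyC_eq0.
  move=> t; rewrite !finset.in_setU1 /r3; case: (t =P tri j l e) => // ->.
  rewrite ![tri j l e == _]eq_sym (negPf nbc) (negPf nac).
  by rewrite (negPf (outS _ _ jS lS jl)).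
have coE a b y : (-1) ^+ sb a b e * (y * phi d0) = phi (c1 a b) * y.
  have -> : phi (c1 a b) = (-1) ^+ sb a b e * phi d0.
    by rewrite /c1 (rmorphM phi) (rmorph_sign phi).
  by rewrite mulrCA mulrC.
have sp' : spec (@iL R) (@qpt R) VJ i3 r'
    (tri j l e |: (tri i p e |: (tri i j e |: inside S)))%SET.
  apply: eq_spec sp3 => t; rewrite !finset.in_setU1 /r3.
  case: (t =P tri j l e) => [-> _|_ /=]; first by rewrite r_c coE.
  rewrite /r2; case: (t =P tri i p e) => [-> _|_ /=]; first by rewrite r_b coE; exact: polyCM.
  rewrite /r1; case: (t =P tri i j e) => [-> _|_ /=]; last first.
    by move=> tS; rewrite (rS t tS).
  rewrite r_a coE; exact: (etrans (congr1 polyC (polyCM _ _)) (polyCM _ _)).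
have lo_all t : t \in inside (e |: S)%SET -> lo (pl v' t) (w t).
  move=> /inside_setU1[/v'lo //|[a [b [aS bS uab ->]]]].
  apply: (supports_lo eS _ gen lo_a lo_b lo_c) => //.
    by move=> s sS; split; [exact: v'lo | exact: r'0].
  by move: uab; rewrite /= !inE negb_or => /andP[/andP[]].
have sp_all : spec (@iL R) (@qpt R) VJ i3 r' (inside (e |: S)%SET).
  pose kn0 a b := [\/ (a = i) /\ (b = j), (a = i) /\ (b = p) | (a = j) /\ (b = l)].
  apply: (spec_extend (kn0 := kn0) eS lo_all r'0 _ _ _ sp').
  - by apply/fintype.subsetP => t tS; rewrite !finset.in_setU1 tS !orbT.
  - move=> kn symkn kn0kn; apply: gen => //; apply: kn0kn; rewrite /kn0.
    + by constructor 1.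
    + by constructor 2.
    + by constructor 3.
  - by move=> a b [] [-> ->]; rewrite !finset.in_setU1 eqxx ?orbT.
exists k3, i3, v'; split=> // t tin; split; first exact: lo_all.
(* A zero coefficient would be a relation given by the single variable [t], so [qpt t] would lie in
   [Q0], although it is a unit. *)
apply/eqP => t0.
exact: (qptN VQ0 (sp_all (TV _ t) tin t0 _ VQ0)).
Qed.

End Extension.

Lemma teval_closed (C A : comNzRingType) (X : finType) (i : {rmorphism C -> A})
    (q : X -> A) (r : X -> C) (g : term C X) :
  tin finset.set0 g -> teval i q g = i (teval idfun r g).
Proof.
elim: g => [c|x|g IHg h IHh|g IHg h IHh] //=; first by rewrite inE.
- by move=> /andP[/IHg-> /IHh->]; rewrite rmorphD.
- by move=> /andP[/IHg-> /IHh->]; rewrite rmorphM.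
Qed.

(** Over three points there is one bracket and no relation. A diagonal matrix gives it a
    transcendental leading coefficient, which specializes to anything. *)
Lemma realized_base (R : realType) (w : cochar R) (t : triple) : realized w (val t).
Proof.
pose x : grpalg {poly R[i]%C} R := << ('X : {poly R[i]%C}) *g w t >>.
pose v (a : 'I_8) (m : 'I_3) : grpalg {poly R[i]%C} R :=
  (if m == 0 then x else 1) *+ (a == tnth3 t m).
have insE s : (s \in [set s : triple | val s \subset val t]%SET) = (s == t).
  rewrite inE -val_eqE eqEcard; case: (_ \subset _) => //=.
  by rewrite (eqP (valP t)) (eqP (valP s)).
have plv : pl v t = x.
  have := uniq_triple t; rewrite /= !inE negb_or andbT.
  move=> /andP[/andP[/negPf h01 /negPf h02] /negPf h12].
  rewrite /pl /vbr /v !eqxx ![tnth3 t 1 == tnth3 t 0]eq_sym.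
  rewrite ![tnth3 t 2 == _]eq_sym h01 h02 h12 /= !mulr0n !mulr1n.
  by rewrite !(mulr0, mul0r, subr0, addr0, mulr1).
exists {poly R[i]%C}, (@polyC R[i]%C \o idfun), v; split=> [s|].
  rewrite insE => /eqP->; rewrite plv; split; first exact: loU.
  by rewrite mcoeffUU polyX_eq0.
have -> : [set s : triple | val s \subset val t]%SET = (t |: finset.set0)%SET.
  by apply/setP => s; rewrite insE !inE orbF.
apply: (@spec_free _ _ _ (@iL R) (@qpt R) (initial_degeneration w) (@VJ_prime R w) _ idfun (fun=> 0) _ _ _ 1).
- move=> g g0 gz Q VQ; have [[Q0 _ _] _ _] := VJ_prime VQ.
  suff -> : teval (@iL R) (@qpt R) g = iL R (teval idfun (fun=> 0) g).
    by rewrite gz rmorph0.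
  exact: teval_closed.
- by move=> s; rewrite inE.
- by rewrite plv mcoeffUU mul1r.
- exact: oner_neq0.
Qed.

(** * Points that cannot be added *)

(* [sim k] groups the other points according to the lines through [k]; the
   relation [N] consists of the pairs that are not generated by the stars of [i]
   and [j]. If no two stars generate everything, the stars behave like pairwise
   meeting lines that are not coplanar, hence all pass through one point. *)
Section Concurrency.
Variables (S : {set 'I_8}) (sim : 'I_8 -> rel 'I_8).
Implicit Types (N : 'I_8 -> 'I_8 -> Prop) (i j u a b x y z g : 'I_8).

(** At a point [a] of an ungenerated pair, the known pairs are those in the branch of [i]: one known
    pair gives its whole branch, and a second known branch would give the whole star. *)
Definition ungenerated i j N : Prop := (exists a b, N a b) /\
  forall a b, N a b -> [/\ a \in S, a != i, a != j, a != b & N b a] /\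
    forall x, x \in S -> x != a -> (N a x <-> ~~ sim a i x).

Hypothesis sim_refl : forall i, reflexive (sim i).
Hypothesis sim_sym : forall i, symmetric (sim i).
Hypothesis sim_trans : forall i, transitive (sim i).
Hypothesis unclosed : forall i j, i \in S -> j \in S -> i != j ->
  exists N, ungenerated i j N.

(** The star of such a [u] is fully generated, so [u] is in no pair of [N]. Hence the pair [a u] is
    known, which places [u] in the branch of [i] at [a]. *)
Lemma ungenerated_full i j N a b u : i \in S -> j \in S -> ungenerated i j N ->
  N a b -> u \in S -> u = i \/ u = j \/ ~~ sim u i j -> u != a /\ sim a i u.
Proof.
move=> iS jS [_ UN] Nab uS uij; have [[aS ai aj ab Nba] Na] := UN _ _ Nab.
have fu z : ~ N u z.
  move=> Nuz; have [[_ ui uj _ _] Nu] := UN _ _ Nuz.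
  case: uij => [|[|uij]]; [exact/eqP|exact/eqP|].
  have [_ /(_ uij) Nuj] := Nu j jS ltac:(by rewrite eq_sym).
  by have [[_ _ _ _ /UN[[_ _ /eqP]]]] := UN _ _ Nuj.
have ua : u != a by apply/eqP => ua; apply: (fu b); rewrite ua.
split=> //; apply: contraT => nau; have [_ /(_ nau) Nau] := Na u uS ua.
by case: (fu a); have [[]] := UN _ _ Nau.
Qed.

Lemma simN i x y z : sim i x y -> ~~ sim i z x -> ~~ sim i z y.
Proof. by move=> xy; apply: contra => zy; apply: sim_trans zy _; rewrite sim_sym. Qed.

Lemma ungenerated_step i j N a b x : ungenerated i j N -> N a b ->
  x \in S -> x != a -> ~~ sim a i x -> N a x /\ N x a /\ ~~ sim x i a.
Proof.
move=> [_ UN] Nab xS xa ns; have [[aS _ _ _ _] /(_ x xS xa)[_ /(_ ns) Nax]] := UN _ _ Nab.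
have [[_ _ _ ax Nxa] _] := UN _ _ Nax.
by split=> //; split=> //; have [_ Nx] := UN _ _ Nxa; apply/(Nx a aS ax).
Qed.

Lemma ungenerated_sim i j N a b : ungenerated i j N -> N a b ->
  [/\ [/\ a \in S, a != i, a != j & N b a], [/\ b \in S, b != i & b != j],
      a != b, b != a & ~~ sim a i b /\ ~~ sim b i a].
Proof.
move=> U Nab; have [[aS ai aj ab Nba] Na] := U.2 _ _ Nab.
have [[bS bi bj ba _] Nb] := U.2 _ _ Nba.
by split=> //; split; [apply/(Na b bS ba) | apply/(Nb a aS ab)].
Qed.

Definition line_pair a a' (s : seq 'I_8) : Prop :=
  {in s &, forall x y, sim a x y && sim a' x y} /\
  {in s, forall x, ~~ sim a x a' && ~~ sim a' x a}.

(** The pairs are ungenerated for the stars of [i, j], then of [i, x], then of [y, x]. Each choice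
    of stars makes the earlier points full, so that they lie in one branch as seen from the next
    pair. *)
Lemma three_pairs i j : i \in S -> j \in S -> i != j ->
  exists x x' y y' z z', [/\ uniq [:: x; x'; y; y'; z; z'],
    {subset [:: x; x'; y; y'; z; z'] <= S},
    line_pair z z' [:: y; x; x'; y'], ~~ sim x y x' /\ ~~ sim x' y x &
    [/\ ~~ sim y' x y, ~~ sim y x y', ~~ sim y' y z & ~~ sim y y' z]].
Proof.
move=> iS jS ij.
have [N1 U1] := unclosed iS jS ij; have [[x [x' N1x]] _] := U1.
have [[xS xi xj N1x'] [x'S x'i x'j] xx' x'x [sxx' sx'x]] := ungenerated_sim U1 N1x.
have ix : i != x by rewrite eq_sym.
have [N2 U2] := unclosed iS xS ix; have [[y [y' N2y]] _] := U2.
have [[yS yi yx N2y'] [y'S y'i y'x] yy' y'y [syy' sy'y]] := ungenerated_sim U2 N2y.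
have fx' : x' = i \/ x' = x \/ ~~ sim x' i x by right; right.
have fx : x = i \/ x = x \/ ~~ sim x i x by right; left.
have [x'y syx'] := ungenerated_full iS xS U2 N2y x'S fx'.
have [x'y' sy'x'] := ungenerated_full iS xS U2 N2y' x'S fx'.
have [xy syx] := ungenerated_full iS xS U2 N2y xS fx.
have [xy' sy'x] := ungenerated_full iS xS U2 N2y' xS fx.
have C1 t : t \in S -> t != x -> t != x' -> sim t i x -> sim t i x' ->
    ~~ sim x' x t /\ ~~ sim x x' t.
  move=> tS tx tx' s1 s2; split; apply/negP => st.
    have [_ [_ /negP[]//]] := ungenerated_step U1 N1x' tS tx' (simN st sx'x).
  have [_ [_ /negP[]//]] := ungenerated_step U1 N1x tS tx (simN st sxx').
have yx' : y != x' by rewrite eq_sym.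
have [C1y C1y'] := C1 y yS yx yx' syx syx'.
have [N3 U3] := unclosed yS xS yx; have [[z [z' N3z]] _] := U3.
have [[zS zy zx N3z'] [z'S z'y z'x] zz' z'z [szz' sz'z]] := ungenerated_sim U3 N3z.
have sy'yx : ~~ sim y' y x by rewrite sim_sym; apply: contra sy'y => /(sim_trans sy'x).
have gy' : y' = y \/ y' = x \/ ~~ sim y' y x by right; right.
have gx' : x' = y \/ x' = x \/ ~~ sim x' y x by right; right; rewrite sim_sym.
have gx : x = y \/ x = x \/ ~~ sim x y x by right; left.
have [y'z szy'] := ungenerated_full yS xS U3 N3z y'S gy'.
have [y'z' sz'y'] := ungenerated_full yS xS U3 N3z' y'S gy'.
have [x'z szx'] := ungenerated_full yS xS U3 N3z x'S gx'.
have [x'z' sz'x'] := ungenerated_full yS xS U3 N3z' x'S gx'.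
have [_ szx] := ungenerated_full yS xS U3 N3z xS gx.
have [_ sz'x] := ungenerated_full yS xS U3 N3z' xS gx.
have C3 t : t \in S -> t != y -> t != y' -> sim t y x -> sim t y y' ->
    ~~ sim y' y t /\ ~~ sim y y' t.
  move=> tS ty ty' s1 s2; split; apply/negP => st.
    have [_ [Nt /negP[]]] := ungenerated_step U2 N2y' tS ty' (simN st sy'y).
    have [_ /sim_trans] := ungenerated_full iS xS U2 Nt xS fx; apply.
    by apply: sim_trans s2; rewrite sim_sym.
  have [_ [Nt /negP[]]] := ungenerated_step U2 N2y tS ty (simN st syy').
  have [_ /sim_trans] := ungenerated_full iS xS U2 Nt xS fx; apply.
  by rewrite sim_sym.
have zy' : z != y' by rewrite eq_sym.
have [C3z C3z'] := C3 z zS zy zy' szx szy'.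
exists x, x', y, y', z, z'; split.
- rewrite /= !inE !negb_or xx' xy xy' x'y x'y' yy' x'z x'z' y'z y'z' zz' !andbT.
  by rewrite ![_ == z]eq_sym ![_ == z']eq_sym zx z'x zy z'y.
- by move=> t; rewrite !inE => /or4P[/eqP->|/eqP->|/eqP->|/or3P[/eqP->|/eqP->|/eqP->]].
- have zall t : t \in [:: y; x; x'; y'] -> sim z y t /\ sim z' y t.
    by rewrite !inE => /or4P[]/eqP->; rewrite ?sim_refl.
  split=> [s t /zall[s1 s2] /zall[t1 t2]|t /zall[t1 t2]].
    by rewrite (sim_trans _ t1) ?(sim_trans _ t2) // sim_sym.
  by rewrite (contra (sim_trans t1) szz') (contra (sim_trans t2) sz'z).
- by rewrite ![sim _ y _]sim_sym.
- split=> //; first by rewrite sim_sym.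
  by rewrite sim_sym; apply: contra syy' => s; apply: (sim_trans syx); rewrite sim_sym.
Qed.

(** For the stars of [y] and [z] the points [y, y', z, z'] are full, so ungenerated pairs involve
    only [x, x', g]. Any of them has an end in the first pair and forces [x x'] to be
    ungenerated. *)
Lemma third_pair x x' y y' z z' g : uniq [:: x; x'; y; y'; z; z'] ->
  {subset [:: x; x'; y; y'; z; z'] <= S} ->
  {subset S <= [:: x; x'; y; y'; z; z'; g]} ->
  ~~ sim y' y z -> ~~ sim z' y z -> ~~ sim x y x' -> ~~ sim x' y x ->
  (exists N, ungenerated y z N /\ N x x') /\ line_pair x x' [:: y; y'; z; z'].
Proof.
rewrite /= !inE !negb_or !andbT.
move=> /and5P[/and5P[xx' xy xy' xz xz'] /and4P[x'y x'y' x'z x'z']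
  /and3P[yy' yz yz'] /andP[y'z y'z'] zz'] sub cov sy' sz' sx sx'.
have [xS x'S yS] : [/\ x \in S, x' \in S & y \in S].
  by split; apply: sub; rewrite !inE eqxx ?orbT.
have [y'S zS z'S] : [/\ y' \in S, z \in S & z' \in S].
  by split; apply: sub; rewrite !inE eqxx ?orbT.
have x'x : x' != x by rewrite eq_sym.
have [N U] := unclosed yS zS yz; have [[a [b Nab]] _] := U.
have fy : y = y \/ y = z \/ ~~ sim y y z by left.
have fz : z = y \/ z = z \/ ~~ sim z y z by right; left.
have fy' : y' = y \/ y' = z \/ ~~ sim y' y z by right; right.
have fz' : z' = y \/ z' = z \/ ~~ sim z' y z by right; right.
have inN c d : N c d -> [|| c == x, c == x' | c == g].
  move=> Ncd; have [[cS _ _ _] _ _ _ _] := ungenerated_sim U Ncd.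
  have := cov c cS; rewrite !inE => /or4P[->//|->|/eqP e|/or4P[/eqP e|/eqP e|/eqP e|->]];
    rewrite ?orbT //.
  - by have [] := ungenerated_full yS zS U Ncd yS fy; rewrite e eqxx.
  - by have [] := ungenerated_full yS zS U Ncd y'S fy'; rewrite e eqxx.
  - by have [] := ungenerated_full yS zS U Ncd zS fz; rewrite e eqxx.
  - by have [] := ungenerated_full yS zS U Ncd z'S fz'; rewrite e eqxx.
have Nx c : N x c -> N x x' by move=> Nc; have [] := ungenerated_step U Nc x'S x'x sx.
have Nx' c : N x' c -> N x x'.
  by move=> Nc; have [_ []] := ungenerated_step U Nc xS xx' sx'.
have Nxx' : N x x'.
  have [[_ _ _ Nba] _ ab _ _] := ungenerated_sim U Nab.
  have /or3P[/eqP e|/eqP e|/eqP e] := inN _ _ Nab.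
  - by apply: (Nx b); rewrite -e.
  - by apply: (Nx' b); rewrite -e.
  have /or3P[/eqP e'|/eqP e'|/eqP e'] := inN _ _ Nba.
  - by apply: (Nx a); rewrite -e'.
  - by apply: (Nx' a); rewrite -e'.
  by move: ab; rewrite e e' eqxx.
have [[_ _ _ Nx'x] _ _ _ _] := ungenerated_sim U Nxx'.
split; first by exists N.
have all t : t \in [:: y; y'; z; z'] -> sim x y t /\ sim x' y t.
  have full u : u \in S -> u = y \/ u = z \/ ~~ sim u y z -> sim x y u /\ sim x' y u.
    move=> uS fu; have [_ ->] := ungenerated_full yS zS U Nxx' uS fu.
    by have [_ ->] := ungenerated_full yS zS U Nx'x uS fu.
  by rewrite !inE => /or4P[]/eqP->; apply: full.
split=> [s t /all[s1 s2] /all[t1 t2]|t /all[t1 t2]].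
  by rewrite (sim_trans _ t1) ?(sim_trans _ t2) // sim_sym.
by rewrite (contra (sim_trans t1) sx) (contra (sim_trans t2) sx').
Qed.

Lemma line_pair_sub a a' s s' : {subset s' <= s} -> line_pair a a' s -> line_pair a a' s'.
Proof. by move=> ss [h1 h2]; split=> [x y /ss xs /ss|x /ss]; [exact: h1 | exact: h2]. Qed.

Definition concurrent x x' y y' z z' : Prop :=
  [/\ line_pair x x' [:: y; y'; z; z'], line_pair y y' [:: x; x'; z; z']
    & line_pair z z' [:: x; x'; y; y']].

Lemma concurrency i j : i \in S -> j \in S -> i != j ->
  (forall x x' y y' z z', uniq [:: x; x'; y; y'; z; z'] ->
    {subset [:: x; x'; y; y'; z; z'] <= S} ->
    exists g, g \in S /\ {subset S <= [:: x; x'; y; y'; z; z'; g]}) ->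
  exists x x' y y' z z', [/\ uniq [:: x; x'; y; y'; z; z'],
    {subset [:: x; x'; y; y'; z; z'] <= S} & concurrent x x' y y' z z'].
Proof.
move=> iS jS ij cov.
have [x [x' [y [y' [z [z' [u sub Lz [sx sx'] [sy' sy sy'z syz]]]]]]]] := three_pairs iS jS ij.
have [g [gS cg]] := cov _ _ _ _ _ _ u sub.
exists x, x', y, y', z, z'; split=> //.
have Lz' : line_pair z z' [:: x; x'; y; y'].
  by apply: line_pair_sub Lz => t; rewrite !inE => /or4P[]->; rewrite ?orbT.
have sz'y : ~~ sim z' y z by case: Lz => _ /(_ y); rewrite inE eqxx => /(_ isT)/andP[].
have sz'x : ~~ sim z' x z.
  by case: Lz' => _ /(_ x); rewrite inE eqxx => /(_ isT)/andP[].
have [_ Lx] := third_pair u sub cg sy'z sz'y sx sx'.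
have sx'z : ~~ sim x' x z.
  rewrite sim_sym; apply: contra sx' => /(sim_trans _); apply.
  by case: Lx => /(_ y z); rewrite !inE !eqxx !orbT => /(_ isT isT)/andP[].
have u2 : uniq [:: y; y'; x; x'; z; z'].
  by rewrite -(@perm_uniq _ [:: x; x'; y; y'; z; z']) // (perm_catCA [:: x; x'] [:: y; y'] [:: z; z']).
have mem2 : [:: y; y'; x; x'; z; z'] =i [:: x; x'; y; y'; z; z'].
  by apply: perm_mem; rewrite (perm_catCA [:: y; y'] [:: x; x'] [:: z; z']).
have [_ Ly] : (exists N, ungenerated x z N /\ N y y') /\ line_pair y y' [:: x; x'; z; z'].
  apply: (@third_pair _ _ _ _ _ _ g) => //; first by move=> t; rewrite mem2; exact: sub.
    move=> t /cg; rewrite (perm_mem (_ : perm_eq _ [:: y; y'; x; x'; z; z'; g])) //.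
    by rewrite (perm_catCA [:: x; x'] [:: y; y'] [:: z; z'; g]).
by split.
Qed.

Lemma line_pairC a a' s : line_pair a a' s -> line_pair a' a s.
Proof.
by move=> [h1 h2]; split=> [x y xs ys|x xs]; rewrite andbC; [exact: h1 | exact: h2].
Qed.

Lemma line_pair_rcons a a' b s g : b \in s -> sim a b g -> sim a' b g ->
  line_pair a a' s -> line_pair a a' (rcons s g).
Proof.
move=> bs ag a'g [h1 h2].
have all t : t \in rcons s g -> sim a b t && sim a' b t.
  by rewrite mem_rcons inE => /predU1P[->|/(h1 _ _ bs) //]; rewrite ag.
split=> [x y /all/andP[x1 x2] /all/andP[y1 y2]|x /all/andP[x1 x2]].
  by rewrite (sim_trans _ y1) ?(sim_trans _ y2) // sim_sym.
have /andP[b1 b2] := h2 _ bs.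
by rewrite (contra (sim_trans x1) b1) (contra (sim_trans x2) b2).
Qed.

(** Since [g] is outside the branch of [y] at [x], the ungenerated pair [x x'] brings along [x g]:
    the seventh point joins the line of [x]. *)
Lemma offset x x' y y' z z' g : uniq [:: x; x'; y; y'; z; z'; g] ->
  {subset [:: x; x'; y; y'; z; z'; g] <= S} ->
  {subset S <= [:: x; x'; y; y'; z; z'; g]} ->
  concurrent x x' y y' z z' -> ~~ sim x y g ->
  [/\ line_pair y y' [:: x; x'; z; z'; g], line_pair z z' [:: x; x'; y; y'; g],
      line_pair x x' [:: y; y'; z; z'] & line_pair x g [:: y; y'; z; z']].
Proof.
move=> u7 sub cov [Lx Ly Lz] sxg.
have /and3P[u6 + _] : [&& uniq [:: x; x'; y; y'; z; z'],
    ~~ has (mem [:: x; x'; y; y'; z; z']) [:: g] & uniq [:: g]] by rewrite -cat_uniq.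
rewrite /= orbF => gn.
have sub6 : {subset [:: x; x'; y; y'; z; z'] <= S}.
  move=> t t6; apply: sub.
  by rewrite -[[:: x; _; _; _; _; _; _]]/([:: x; x'; y; y'; z; z'] ++ [:: g]) mem_cat t6.
have gS : g \in S by apply: sub; rewrite !inE eqxx !orbT.
have [xS x'S yS] : [/\ x \in S, x' \in S & y \in S].
  by split; apply: sub6; rewrite !inE eqxx ?orbT.
have [y'S zS z'S] : [/\ y' \in S, z \in S & z' \in S].
  by split; apply: sub6; rewrite !inE eqxx ?orbT.
move: gn; rewrite !inE !negb_or => /and5P[gx gx' gy gy' /andP[gz gz']].
have get a a' s t : line_pair a a' s -> t \in s -> ~~ sim a t a' /\ ~~ sim a' t a.
  by move=> [_ h] /h/andP[].
have get2 a a' s t t' : line_pair a a' s -> t \in s -> t' \in s -> sim a t t' /\ sim a' t t'.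
  by move=> [h _] ts t's; have /andP[] := h _ _ ts t's.
have [sxx' sx'x] : ~~ sim x y x' /\ ~~ sim x' y x by apply: (get _ _ _ _ Lx); rewrite !inE eqxx.
have [sxx'z sx'xz] : ~~ sim x z x' /\ ~~ sim x' z x.
  by apply: (get _ _ _ _ Lx); rewrite !inE eqxx ?orbT.
have [syy' sy'y] : ~~ sim y x y' /\ ~~ sim y' x y by apply: (get _ _ _ _ Ly); rewrite !inE eqxx.
have [syy'z sy'yz] : ~~ sim y z y' /\ ~~ sim y' z y.
  by apply: (get _ _ _ _ Ly); rewrite !inE eqxx ?orbT.
have [szz' sz'z] : ~~ sim z x z' /\ ~~ sim z' x z by apply: (get _ _ _ _ Lz); rewrite !inE eqxx.
have [szz'y sz'zy] : ~~ sim z y z' /\ ~~ sim z' y z.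
  by apply: (get _ _ _ _ Lz); rewrite !inE eqxx ?orbT.
have yz : y != z by move: u6; rewrite /= !inE !negb_or; case/and4P => _ _ /and3P[].
have xz : x != z by move: u6; rewrite /= !inE !negb_or; case/andP=> /and5P[].
have xy : x != y by move: u6; rewrite /= !inE !negb_or; case/andP=> /and5P[].
have [[N [U Nx]] _] : (exists N, ungenerated y z N /\ N x x') /\ line_pair x x' [:: y; y'; z; z'].
  by apply: (third_pair u6 sub6 cov); rewrite // sim_sym.
have [Ngx [_ sgx]] : N g x /\ N x g /\ ~~ sim g y x.
  have [Nxg [Ngx sgx]] := ungenerated_step U Nx gS gx sxg.
  by [].
have gfull u : u \in S -> u = y \/ u = z \/ ~~ sim u y z -> sim g y u.
  by move=> uS fu; have [] := ungenerated_full yS zS U Ngx uS fu.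
have sgy' : sim g y y' by apply: gfull => //; right; right; rewrite sim_sym.
have sgz : sim g y z by apply: gfull => //; right; left.
have sgz' : sim g y z' by apply: gfull => //; right; right.
have gall t : t \in [:: y; y'; z; z'] -> sim g y t.
  by rewrite !inE => /or4P[]/eqP->; rewrite ?sim_refl.
have sgxz : ~~ sim g x z by rewrite sim_sym; apply: contra sgx => /(sim_trans sgz).
have sgxy : ~~ sim g x y by rewrite sim_sym.
have mem2 : [:: y; y'; x; x'; z; z'] =i [:: x; x'; y; y'; z; z'].
  by apply: perm_mem; rewrite (perm_catCA [:: y; y'] [:: x; x'] [:: z; z']).
have mem2g : [:: y; y'; x; x'; z; z'; g] =i [:: x; x'; y; y'; z; z'; g].
  by apply: perm_mem; rewrite (perm_catCA [:: y; y'] [:: x; x'] [:: z; z'; g]).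
have mem3 : [:: z; z'; x; x'; y; y'] =i [:: x; x'; y; y'; z; z'].
  by apply: perm_mem; rewrite (perm_catC [:: z; z'] [:: x; x'; y; y']).
have mem3g : [:: z; z'; x; x'; y; y'; g] =i [:: x; x'; y; y'; z; z'; g].
  by apply: perm_mem; rewrite (perm_catCA [:: z; z'] [:: x; x'; y; y'] [:: g]).
have u2 : uniq [:: y; y'; x; x'; z; z'].
  rewrite (@perm_uniq _ _ [:: x; x'; y; y'; z; z']) //.
  by rewrite (perm_catCA [:: y; y'] [:: x; x'] [:: z; z']).
have u3 : uniq [:: z; z'; x; x'; y; y'].
  rewrite (@perm_uniq _ _ [:: x; x'; y; y'; z; z']) //.
  by rewrite (perm_catC [:: z; z'] [:: x; x'; y; y']).
have [[N2 [U2 Ny]] _] : (exists N, ungenerated x z N /\ N y y') /\ line_pair y y' [:: x; x'; z; z'].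
  apply: (third_pair u2 (g := g)) => //; last by rewrite sim_sym.
    by move=> t; rewrite mem2; exact: sub6.
  by move=> t /cov; rewrite mem2g.
have [[N3 [U3 Nz]] _] : (exists N, ungenerated x y N /\ N z z') /\ line_pair z z' [:: x; x'; y; y'].
  apply: (third_pair u3 (g := g)) => //; last by rewrite sim_sym.
    by move=> t; rewrite mem3; exact: sub6.
  by move=> t /cov; rewrite mem3g.
have [_ _ _ _ _] := ungenerated_sim U2 Ny.
have [[_ _ _ Ny'] _ _ _ _] := ungenerated_sim U2 Ny.
have [[_ _ _ Nz'] _ _ _ _] := ungenerated_sim U3 Nz.
have fg2 : g = x \/ g = z \/ ~~ sim g x z by right; right.
have fg3 : g = x \/ g = y \/ ~~ sim g x y by right; right.
have [_ syg] := ungenerated_full xS zS U2 Ny gS fg2.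
have [_ sy'g] := ungenerated_full xS zS U2 Ny' gS fg2.
have [_ szg] := ungenerated_full xS yS U3 Nz gS fg3.
have [_ sz'g] := ungenerated_full xS yS U3 Nz' gS fg3.
split=> //.
- by apply: (line_pair_rcons (b := x)) Ly; rewrite ?inE ?eqxx.
- by apply: (line_pair_rcons (b := x)) Lz; rewrite ?inE ?eqxx.
split=> [s t hs ht|t ht].
  have [-> _] := get2 _ _ _ _ _ Lx hs ht.
  by rewrite (sim_trans _ (gall t ht)) // sim_sym; exact: gall.
have [xt _] := get2 _ _ _ _ _ Lx (mem_head y [:: y'; z; z']) ht.
by rewrite (contra (sim_trans xt) sxg) (contra (sim_trans (gall t ht)) sgx).
Qed.

End Concurrency.

(** * From failure to lines through the new point *)

Section Failure.
Variables (R : realType) (w : cochar R).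
Local Notation W := (W w).
Implicit Types (S : {set 'I_8}) (i j k l a b u s t e x y z g : 'I_8).

(* In the tree of lines through [u], the pair [s t] is separated from [v e]. *)
Definition quartet u s t v e : Prop :=
  W u s v + W u t e < W u s t + W u v e /\ W u t v + W u s e < W u s t + W u v e.

(** The form of [line_pair] in inequalities on [w]: at [a] and at [a'], the other end and [e] are
    split off from any two points of [r], as if [e] were on the line [a a'] and [r] off it. *)
Definition tight_pair e a a' (r : seq 'I_8) : Prop :=
  {in r &, forall x y, x != y -> quartet a x y a' e /\ quartet a' x y a e}.

Definition three_lines e x x' y y' z z' gs : Prop :=
  [/\ tight_pair e x x' ([:: y; y'; z; z'] ++ gs),
      tight_pair e y y' ([:: x; x'; z; z'] ++ gs) &
      tight_pair e z z' ([:: x; x'; y; y'] ++ gs)].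

(** The long line is [e x x' g]; it is recorded through its pairs at [x]. *)
Definition four_point_line e x x' y y' z z' g : Prop :=
  [/\ tight_pair e y y' [:: x; x'; z; z'; g], tight_pair e z z' [:: x; x'; y; y'; g],
      tight_pair e x x' [:: y; y'; z; z'] & tight_pair e x g [:: y; y'; z; z']].

Hypothesis Dw : dressian w.
Variables (S : {set 'I_8}) (e : 'I_8).
Hypothesis eS : e \notin S.
Hypothesis S3 : (3 <= #|S|)%N.

(** The Gromov product of [j] and [l] based at the leaf [e] in the tree of [i]. The three-term
    condition is its ultrametric inequality. *)
Definition gromov i j l : R := W i j l - W i j e - W i l e.

Let neS a : a \in S -> a != e.
Proof. by move=> aS; apply: contraNneq eS => <-. Qed.

Lemma gromovC i j l : gromov i j l = gromov i l j.
Proof. by rewrite /gromov (WR w i j l); lra. Qed.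

Lemma gromov_ultra i j k l : [/\ i \in S, j \in S, k \in S & l \in S] ->
  uniq [:: i; j; k; l] -> gromov i j l <= gromov i j k \/ gromov i k l <= gromov i j k.
Proof.
move=> [iS jS kS lS] u.
have u5 : uniq [:: i; j; k; l; e].
  by rewrite -[[:: i; j; k; l; e]]/(rcons [:: i; j; k; l] e) rcons_uniq u andbT !inE
    !negb_or ![e == _]eq_sym !neS.
by have [h|h] := Dw u5; [left|right]; move: h; rewrite /gromov; lra.
Qed.

Lemma gromov_min : exists m : 'I_8 -> R, forall i, i \in S ->
  (forall j l, j \in S -> l \in S -> uniq [:: i; j; l] -> m i <= gromov i j l) /\
  exists j l, [/\ j \in S, l \in S, uniq [:: i; j; l] & gromov i j l = m i].
Proof.
suff /choice[m mP] : forall i, exists m : R, i \in S ->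
  (forall j l, j \in S -> l \in S -> uniq [:: i; j; l] -> m <= gromov i j l) /\
  exists j l, [/\ j \in S, l \in S, uniq [:: i; j; l] & gromov i j l = m].
  by exists m.
move=> i.
have [iS|iS] := boolP (i \in S); last by exists 0.
pose s := [seq p <- enum (@predT ('I_8 * 'I_8)%type) |
  [&& p.1 \in S, p.2 \in S & uniq [:: i; p.1; p.2]]].
have sP j l : ((j, l) \in s) = [&& j \in S, l \in S & uniq [:: i; j; l]].
  by rewrite mem_filter mem_enum andbT.
have [s0|sn0] := eqVneq s [::]; last first.
  have [[j l] jls smin] := seq_min (fun p : 'I_8 * 'I_8 => gromov i p.1 p.2) sn0.
  exists (gromov i j l) => _; split.
    by move=> a b aS bS u; apply: (smin (a, b)); rewrite sP aS bS.
  by exists j, l; move: jls; rewrite sP => /and3P[].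
exfalso; have : (1 < #|S :\ i|)%N by rewrite -ltnS (leq_trans S3) // [X in (X <= _)%N](cardsD1 i) iS.
move=> /card_gt1P[j [l []]]; rewrite !inE => /andP[ji jS] /andP[li lS] jl.
have : (j, l) \in s by rewrite sP jS lS /= !inE negb_or ![i == _]eq_sym ji li jl.
by rewrite s0.
Qed.

(** [sim i] joins points whose Gromov product exceeds the minimum: its classes are the branches
    where the leaf [e] is attached. The bound seven leaves at most one point besides the three
    pairs. *)
Theorem failure : ~ good w S e -> (#|S| <= 7)%N ->
  exists x x' y y' z z', [/\ uniq [:: x; x'; y; y'; z; z'],
    {subset [:: x; x'; y; y'; z; z'] <= S} &
    (#|S| = 6%N /\ three_lines e x x' y y' z z' [::]) \/
    (exists g, [/\ g \in S, g \notin [:: x; x'; y; y'; z; z'] &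
       three_lines e x x' y y' z z' [:: g] \/ four_point_line e x x' y y' z z' g])].
Proof.
move=> ngood S7; have [m mP] := gromov_min.
pose sim i : rel 'I_8 := fun j l => (j == l) ||
  [&& i \in S, j \in S, l \in S, uniq [:: i; j; l] & m i < gromov i j l].
have sim_refl i : reflexive (sim i) by move=> j; rewrite /sim eqxx.
have sim_sym i : symmetric (sim i).
  move=> j l; rewrite /sim eq_sym (gromovC i j l); congr orb.
  rewrite /= !inE !negb_or [l == j]eq_sym; case: (i \in S) => //=.
  by case: (j \in S); case: (l \in S) => //=; rewrite (andbC (i != j)).
have sim_trans i : transitive (sim i).
  move=> k j l; rewrite /sim => /predU1P[-> //|/and5P[iS jS kS ujk mjk]].
  move=> /predU1P[<-|/and5P[_ _ lS ukl mkl]]; first by rewrite iS jS kS ujk mjk orbT.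
  have [//|jl] := eqVneq j l; move: ujk ukl; rewrite /= iS jS lS !inE !negb_or !andbT.
  move=> /andP[/andP[ij ik] jk] /andP[/andP[_ il] kl].
  rewrite ij il jl /=.
  have [] := @gromov_ultra i j l k; rewrite ?iS //.
  - by rewrite /= !inE !negb_or ij il ik jl jk [l == k]eq_sym kl.
  - exact: lt_le_trans.
  by rewrite (gromovC i l k); exact: lt_le_trans.
have simP i j l : i \in S -> j \in S -> l \in S -> uniq [:: i; j; l] ->
    sim i j l = (m i < gromov i j l).
  move=> iS jS lS u; rewrite /sim iS jS lS u /=.
  by move: u; rewrite /= !inE => /andP[_ /andP[/negPf->]].
have nsimP i j l : i \in S -> j \in S -> l \in S -> uniq [:: i; j; l] ->
    ~~ sim i j l -> gromov i j l = m i.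
  move=> iS jS lS u; rewrite simP // -leNgt => le.
  by apply/eqP; rewrite eq_le le (mP i iS).1.
have far i j : i \in S -> j \in S -> i != j ->
    exists l, [/\ l \in S, uniq [:: i; j; l] & ~~ sim i j l].
  move=> iS jS ij; have [a [b [aS bS uab mab]]] := (mP i iS).2.
  have nab : ~~ sim i a b by rewrite simP // mab ltxx.
  move: uab; rewrite /= !inE !negb_or !andbT => /andP[/andP[ia ib] ab].
  have [sja|nja] := boolP (sim i j a); last first.
    exists a; rewrite aS nja /= !inE negb_or ij ia; split=> //.
    by rewrite /= andbT; apply: contraNneq nja => ->; exact: sim_refl.
  have njb : ~~ sim i j b.
    by apply: contra nab => sjb; apply: sim_trans sjb; rewrite sim_sym.
  exists b; rewrite bS njb /= !inE negb_or ij ib; split=> //.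
  by rewrite /= andbT; apply: contraNneq njb => ->; exact: sim_refl.
have unclosed i j : i \in S -> j \in S -> i != j -> exists N, ungenerated S sim i j N.
  move=> iS jS ij; have ji : j != i by rewrite eq_sym.
  (* The seeds [i j], [i p], [j l] meet two branches at [i] and two at [j], so both stars are
     generated. *)
  have [p [pS up nsp]] := far _ _ iS jS ij; have [l [lS ul nsl]] := far _ _ jS iS ji.
  have ul' : uniq [:: i; j; l].
    move: ul; rewrite /= !inE !negb_or !andbT => /andP[/andP[_ jl] il].
    by rewrite ij il jl.
  have [kn [skn kij kip kjl [solv [a [b [aS bS ab nab]]]]]] : exists kn : 'I_8 -> 'I_8 -> Prop,
      [/\ forall a b, kn a b -> kn b a, kn i j, kn i p, kn j l & solvable w S e kn /\
      exists a b, [/\ a \in S, b \in S, a != b & ~ kn a b]].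
    apply: contrapT => nex; apply: ngood; exists i, j, p, l; split=> // kn s1 k1 k2 k3 sol.
    move=> a b aS bS ab; apply: contrapT => nab; apply: nex; exists kn; split=> //.
    by split=> //; exists a, b.
  (* Two known pairs in different branches: the product with [c z e] has least weight, as the Gromov
     product of [x] and [y] is minimal. *)
  have closeL c x y z : c \in S -> x \in S -> y \in S -> z \in S -> uniq [:: c; x; y] ->
      ~~ sim c x y -> kn c x -> kn c y -> c != z -> kn c z.
    move=> cS xS yS zS u ns kx ky cz.
    have [<-//|xz] := eqVneq x z; have [<-//|yz] := eqVneq y z.
    have mxy := nsimP _ _ _ cS xS yS u ns.
    move: u; rewrite /= !inE !negb_or !andbT => /andP[/andP[cx cy] xy].
    have mle a' b' : a' \in S -> b' \in S -> c != a' -> c != b' -> a' != b' ->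
        gromov c x y <= gromov c a' b'.
      move=> a'S b'S ca' cb' ab'; rewrite mxy; apply: (mP c cS).1 => //.
      by rewrite /= !inE negb_or ca' cb' ab'.
    apply: (solv c x y z) => //.
    - by rewrite /= !inE !negb_or cx cy cz xy xz yz.
    - have := mle z y zS yS cz cy ltac:(by rewrite eq_sym).
      by rewrite /gromov; lra.
    - have := mle x z xS zS cx cz xz.
      by rewrite /gromov; lra.
  have closeP c x z : c \in S -> x \in S -> z \in S -> c != x -> c != z ->
      sim c x z -> kn c x -> kn c z.
    move=> cS xS zS cx cz sxz kx; have [<-//|xz] := eqVneq x z.
    have [y [yS uy ny]] := far _ _ cS xS cx.
    have mxy := nsimP _ _ _ cS xS yS uy ny.
    move: (uy); rewrite /= !inE !negb_or !andbT => /andP[/andP[_ cy] xy].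
    have yz : y != z by apply: contraNneq ny => ->.
    have mxz : m c < gromov c x z by rewrite -simP // /= !inE negb_or cx cz xz.
    have nzy : ~~ sim c z y by apply: contra ny; apply: sim_trans.
    have mzy : gromov c z y = m c.
      by apply: nsimP nzy => //; rewrite /= !inE negb_or cz cy eq_sym yz.
    apply: (solv c x y z) => //.
    - by rewrite /= !inE !negb_or cx cy cz xy xz yz.
    - by move: mxy mzy; rewrite /gromov; lra.
    - by move: mxy mxz; rewrite /gromov; lra.
    - by move=> E; exfalso; move: mxy mxz E; rewrite /gromov; lra.
  have full_i x : x \in S -> i != x -> kn i x.
    by move=> xS ix; apply: (closeL i j p x).
  have full_j x : x \in S -> j != x -> kn j x.
    by move=> xS jx; apply: (closeL j i l x) => //; exact: skn.
  exists (fun x y => [/\ x \in S, y \in S, x != y & ~ kn x y]); split; first by exists a, b.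
  move=> x y [xS yS xy nxy].
  have xi : x != i.
    by apply: contra_not_neq nxy => xi; rewrite xi in xy *; exact: full_i.
  have xj : x != j.
    by apply: contra_not_neq nxy => xj; rewrite xj in xy *; exact: full_j.
  have kxi : kn x i by apply/skn/full_i; rewrite // eq_sym.
  split; first by split=> //; split; rewrite // 1?eq_sym // => /skn.
  move=> t tS tx; split=> [[_ _ xt nxt]|nst].
    apply: contra_notN nxt => sit; exact: (closeP x i t).
  split=> //; first by rewrite eq_sym.
  move=> kxt; apply: nxy; apply: (closeL x i t y) => //.
  rewrite /= !inE negb_or xi [x == t]eq_sym tx /= andbT.
  by apply: contraNneq nst => ->; exact: sim_refl.
have tightP a a' r : {subset r <= S} -> a \in S -> a' \in S -> a != a' ->
    a \notin r -> a' \notin r -> line_pair sim a a' r -> tight_pair e a a' r.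
  move=> rS aS a'S aa' ar a'r [L1 L2] x y xr yr xy.
  have half b b' : b \in S -> b' \in S -> b != b' -> b \notin r -> b' \notin r ->
      sim b x y -> ~~ sim b x b' -> ~~ sim b y b' -> quartet b x y b' e.
    move=> bS b'S bb' br b'r s1 s2 s3.
    have [bx by'] : b != x /\ b != y by split; apply: contraNneq br => ->.
    have [b'x b'y] : b' != x /\ b' != y by split; apply: contraNneq b'r => ->.
    have [xS yS] := (rS _ xr, rS _ yr).
    move: s1; rewrite simP //; last by rewrite /= !inE negb_or bx by' xy.
    have := nsimP b x b' bS xS b'S _ s2; rewrite /= !inE negb_or bx bb' eq_sym b'x => /(_ isT).
    have := nsimP b y b' bS yS b'S _ s3; rewrite /= !inE negb_or by' bb' eq_sym b'y => /(_ isT).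
    by rewrite /gromov /quartet; lra.
  have /andP[x1 x2] := L2 _ xr; have /andP[y1 y2] := L2 _ yr.
  have /andP[xy1 xy2] := L1 _ _ xr yr.
  by split; apply: half => //; rewrite eq_sym.
have cov x x' y y' z z' : uniq [:: x; x'; y; y'; z; z'] ->
    {subset [:: x; x'; y; y'; z; z'] <= S} ->
    exists g, g \in S /\ {subset S <= [:: x; x'; y; y'; z; z'; g]}.
  set s6 := [:: x; x'; y; y'; z; z'] => u sub.
  have [/fintype.subsetP Ss|/fintype.subsetPn[g gS gs]] := boolP (S \subset s6).
    exists x; split=> [|t /Ss]; first by apply: sub; rewrite mem_head.
    by rewrite -[[:: x; x'; y; y'; z; z'; x]]/(s6 ++ [:: x]) mem_cat => ->.
  exists g; split=> // t tS.
  rewrite -[[:: x; x'; y; y'; z; z'; g]]/(s6 ++ [:: g]) mem_cat; apply: contraT.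
  rewrite negb_or mem_seq1 => /andP[ts tg].
  have u8 : uniq [:: t, g & s6] by rewrite 2!cons_uniq in_cons negb_or tg ts gs u.
  have /(uniq_leq_size u8) : {subset [:: t, g & s6] <= enum S}.
    by move=> r; rewrite in_cons in_cons mem_enum => /predU1P[->//|/predU1P[->//|/sub]].
  by rewrite -cardE leqNgt ltnS S7.
have /card_gt1P[i [j [iS jS ij]]] : (1 < #|S|)%N by apply: leq_trans S3.
have [x [x' [y [y' [z [z' [u sub conc]]]]]]] :=
  concurrency sim_refl sim_sym sim_trans unclosed iS jS ij cov.
have conc_sub a a' b b' c c' : concurrent sim a a' b b' c c' ->
    [/\ concurrent sim a' a b b' c c', concurrent sim b b' a a' c c' &
        concurrent sim c c' a a' b b'].
  move=> [L1 L2 L3]; split; split=> //; do ?exact: line_pairC.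
  - by apply: line_pair_sub L2 => t; rewrite !inE orbCA.
  - by apply: line_pair_sub L3 => t; rewrite !inE orbCA.
  - by apply: line_pair_sub L3 => t; rewrite !inE => /or4P[]->; rewrite ?orbT.
  - by apply: line_pair_sub L1 => t; rewrite !inE => /or4P[]->; rewrite ?orbT.
  - by apply: line_pair_sub L2 => t; rewrite !inE => /or4P[]->; rewrite ?orbT.
have tight7 a a' (r q : seq 'I_8) : uniq q -> {subset q <= S} ->
    perm_eq q [:: a, a' & r] -> line_pair sim a a' r -> tight_pair e a a' r.
  move=> uq qS pq L; have memq := perm_mem pq.
  move: uq; rewrite (perm_uniq pq) /= in_cons negb_or => /andP[/andP[aa' ar] /andP[a'r _]].
  apply: tightP => //.
  - by move=> t tr; apply: qS; rewrite memq !in_cons tr !orbT.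
  - by apply: qS; rewrite memq mem_head.
  - by apply: qS; rewrite memq !in_cons eqxx orbT.
have p2 a a' b b' (r : seq 'I_8) : perm_eq [:: a, a', b, b' & r] [:: b, b', a, a' & r].
  exact: (permEl (perm_catCA [:: a; a'] [:: b; b'] r)).
have p3 a a' b b' c c' (r : seq 'I_8) :
    perm_eq [:: a, a', b, b', c, c' & r] [:: c, c', a, a', b, b' & r].
  exact: (permEl (perm_catCA [:: a; a'; b; b'] [:: c; c'] r)).
have [g [gS cg]] := cov _ _ _ _ _ _ u sub.
have [g6|g6] := boolP (g \in [:: x; x'; y; y'; z; z']).
  exists x, x', y, y', z, z'; split=> //; left; split.
    apply/eqP; rewrite eqn_leq; apply/andP; split.
      rewrite cardE -[6%N]/(size [:: x; x'; y; y'; z; z']).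
      apply: uniq_leq_size => [|t]; first exact: enum_uniq.
      rewrite mem_enum => /cg.
      rewrite -[[:: x; x'; y; y'; z; z'; g]]/([:: x; x'; y; y'; z; z'] ++ [:: g]).
      by rewrite mem_cat => /orP[//|]; rewrite mem_seq1 => /eqP->.
    rewrite cardE -[6%N]/(size [:: x; x'; y; y'; z; z']).
    by apply: uniq_leq_size u _ => t /sub; rewrite mem_enum.
  have [L1 L2 L3] := conc.
  split; apply: (tight7 _ _ _ _ u sub) => //.
pose good7 a a' b b' c c' := [/\ uniq [:: a; a'; b; b'; c; c'; g],
  {subset [:: a; a'; b; b'; c; c'; g] <= S},
  {subset S <= [:: a; a'; b; b'; c; c'; g]} & concurrent sim a a' b b' c c'].
have base7 : good7 x x' y y' z z'.
  split=> //.
    rewrite -[[:: x; x'; y; y'; z; z'; g]]/(rcons [:: x; x'; y; y'; z; z'] g).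
    by rewrite rcons_uniq g6 u.
  move=> t; rewrite -[[:: x; x'; y; y'; z; z'; g]]/([:: x; x'; y; y'; z; z'] ++ [:: g]).
  by rewrite mem_cat => /orP[/sub//|]; rewrite mem_seq1 => /eqP->.
have perm7 a a' b b' c c' d d' f f' h h' : good7 a a' b b' c c' ->
    perm_eq [:: a; a'; b; b'; c; c'; g] [:: d; d'; f; f'; h; h'; g] ->
    concurrent sim d d' f f' h h' -> good7 d d' f f' h h'.
  move=> [u7 s7 c7 _] pq cc; have memq := perm_mem pq; split=> //.
  - by rewrite -(perm_uniq pq).
  - by move=> t; rewrite -memq; exact: s7.
  - by move=> t /c7; rewrite memq.
have finish a a' b b' c c' : good7 a a' b b' c c' -> ~~ sim a b g ->
    exists x x' y y' z z', [/\ uniq [:: x; x'; y; y'; z; z'],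
    {subset [:: x; x'; y; y'; z; z'] <= S} &
    (#|S| = 6%N /\ three_lines e x x' y y' z z' [::]) \/
    (exists g, [/\ g \in S, g \notin [:: x; x'; y; y'; z; z'] &
       three_lines e x x' y y' z z' [:: g] \/ four_point_line e x x' y y' z z' g])].
  move=> [u7 s7 c7 cc] ns.
  have [L1 L2 L3 L4] := offset sim_refl sim_sym sim_trans unclosed u7 s7 c7 cc ns.
  exists a, a', b, b', c, c'.
  have /andP[g6' u6] : (g \notin [:: a; a'; b; b'; c; c']) && uniq [:: a; a'; b; b'; c; c'].
    by rewrite -rcons_uniq.
  have s6 : {subset [:: a; a'; b; b'; c; c'] <= S}.
    move=> t t6; apply: s7.
    by rewrite -[[:: a; a'; b; b'; c; c'; g]]/([:: a; a'; b; b'; c; c'] ++ [:: g]) mem_cat t6.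
  split=> //; right; exists g; split=> //; right; split.
  - by apply: (tight7 _ _ _ _ u7 s7) => //; exact: (p2 a a' b b' [:: c; c'; g]).
  - by apply: (tight7 _ _ _ _ u7 s7) => //; exact: (p3 a a' b b' c c' [:: g]).
  - by apply: (tight7 _ _ _ _ u6 s6).
  - have p : perm_eq [:: a; a'; b; b'; c; c'; g] (a' :: [:: a, g & [:: b; b'; c; c']]).
      by apply/seq.permP => P /=; ring.
    have uq : uniq [:: a, g & [:: b; b'; c; c']].
      by move: u7; rewrite (perm_uniq p) cons_uniq => /andP[].
    apply: (tight7 _ _ _ [:: a, g & [:: b; b'; c; c']]) => // t tq.
    by apply: s7; rewrite (perm_mem p) in_cons tq orbT.
have [C1 C2 C3] := conc_sub _ _ _ _ _ _ conc.
have swap a a' b b' c c' (r : seq 'I_8) :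
    perm_eq [:: a, a', b, b', c, c' & r] [:: a', a, b, b', c, c' & r].
  exact: (permEl (perm_catCA [:: a] [:: a'] _)).
(* Either all six points see [g] in the branch of the other lines, and [g] is off the three lines,
   or one of them does not. Symmetries of [concurrent] move that one to the front. *)
have [sx|] := boolP (sim x y g); last exact: (finish _ _ _ _ _ _ base7).
have [sx'|] := boolP (sim x' y g); last first.
  exact: (finish _ _ _ _ _ _ (perm7 _ _ _ _ _ _ _ _ _ _ _ _ base7 (swap _ _ _ _ _ _ _) C1)).
have G2 := perm7 _ _ _ _ _ _ _ _ _ _ _ _ base7 (p2 _ _ _ _ _) C2.
have [C2' _ _] := conc_sub _ _ _ _ _ _ C2.
have [sy|] := boolP (sim y x g); last exact: (finish _ _ _ _ _ _ G2).
have [sy'|] := boolP (sim y' x g); last first.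
  exact: (finish _ _ _ _ _ _ (perm7 _ _ _ _ _ _ _ _ _ _ _ _ G2 (swap _ _ _ _ _ _ _) C2')).
have G3 := perm7 _ _ _ _ _ _ _ _ _ _ _ _ base7 (p3 _ _ _ _ _ _ _) C3.
have [C3' _ _] := conc_sub _ _ _ _ _ _ C3.
have [sz|] := boolP (sim z x g); last exact: (finish _ _ _ _ _ _ G3).
have [sz'|] := boolP (sim z' x g); last first.
  exact: (finish _ _ _ _ _ _ (perm7 _ _ _ _ _ _ _ _ _ _ _ _ G3 (swap _ _ _ _ _ _ _) C3')).
exists x, x', y, y', z, z'; split=> //; right; exists g; split=> //; left.
have [u7 s7 _ [L1 L2 L3]] := base7.
split.
- apply: (tight7 _ _ _ _ u7 s7) => //.
  by apply: (line_pair_rcons sim_sym sim_trans (b := y)) L1; rewrite ?inE ?eqxx.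
- apply: (tight7 _ _ _ _ u7 s7 (p2 x x' y y' [:: z; z'; g])).
  by apply: (line_pair_rcons sim_sym sim_trans (b := x)) L2; rewrite ?inE ?eqxx.
- apply: (tight7 _ _ _ _ u7 s7 (p3 x x' y y' z z' [:: g])).
  by apply: (line_pair_rcons sim_sym sim_trans (b := x)) L3; rewrite ?inE ?eqxx.
Qed.

End Failure.

(** * Search for local patterns *)

(* A fact [(u, s, t, v, e)] between labels stands for the quartet [st|ve] in the
   tree of lines through [u]. Facts are stored in tries: the key determines [u]
   and the four leaves, and the value [s t + v e] determines the pairing. *)
Definition fact := (nat * nat * nat * nat * nat)%type.

Definition fact_key (q : fact) : seq bool :=
  let: (u, s, t, v, e) := q in
  [seq j == u | j <- iota 0 8] ++
  [seq [|| j == s, j == t, j == v | j == e] | j <- iota 0 8].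

Definition fact_val (q : fact) : nat :=
  let: (u, s, t, v, e) := q in (s * t + v * e)%N.

Inductive trie := TrieE | TrieL of nat | TrieN of trie & trie.
HB.instance Definition _ := gen_eqMixin trie.

Fixpoint trie_add (k : seq bool) (a : nat) (t : trie) : trie :=
  if k is b :: k' then
    let: (l, r) := if t is TrieN l r then (l, r) else (TrieE, TrieE) in
    if b then TrieN l (trie_add k' a r) else TrieN (trie_add k' a l) r
  else TrieL a.

Fixpoint trie_get (t : trie) (k : seq bool) : option nat :=
  match t, k with
  | TrieL a, [::] => Some a
  | TrieN l r, b :: k' => trie_get (if b then r else l) k'
  | _, _ => None
  end.

Fixpoint clash (t1 t2 : trie) : bool :=
  match t1, t2 with
  | TrieL a, TrieL b => a != b
  | TrieN l r, TrieN l' r' => clash l l' || clash r r'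
  | _, _ => false
  end.

Lemma clashP t1 t2 : clash t1 t2 -> exists k a b,
  [/\ trie_get t1 k = Some a, trie_get t2 k = Some b & a != b].
Proof.
elim: t1 t2 => [|a|l IHl r IHr] [|b|l' r'] //= => [ab|/orP[/IHl|/IHr] [k [a [b [? ? ?]]]]].
- by exists [::], a, b.
- by exists (false :: k), a, b.
- by exists (true :: k), a, b.
Qed.

Lemma trie_getE k : trie_get TrieE k = None. Proof. by case: k. Qed.

Lemma trie_get_add k a t k' b : trie_get (trie_add k a t) k' = Some b ->
  (k' = k /\ b = a) \/ trie_get t k' = Some b.
Proof.
elim: k t k' => [|c k IHk] t k'; first by case: k' => //= -[<-]; left.
rewrite [trie_add _ _ _]/=.
case E : (if t is TrieN l r then (l, r) else (TrieE, TrieE)) => [l r].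
case: k' => [|c' k']; first by case: c.
have -> : trie_get t (c' :: k') = trie_get (if c' then r else l) k'.
  by case: t E => [|x|l1 r1] [<- <-] /=; case: c'; rewrite ?trie_getE.
case: c; case: c' => /=; do ?by right.
  by move=> /IHk[[-> ->]|]; [left | right].
by move=> /IHk[[-> ->]|]; [left | right].
Qed.

Definition trie_of (F : seq fact) : trie :=
  foldr (fun q t => trie_add (fact_key q) (fact_val q) t) TrieE F.

Lemma trie_ofP F k b : trie_get (trie_of F) k = Some b ->
  exists2 q, q \in F & fact_key q = k /\ fact_val q = b.
Proof.
elim: F => [|q F IHF] /=; first by case: k.
move=> /trie_get_add[[-> ->]|/IHF[q' q'F h]]; first by exists q; rewrite ?mem_head.
by exists q' => //; rewrite in_cons q'F orbT.
Qed.

Section Search.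
Variables (T : Type) (key : T -> trie).

(** Backtracking with forward checking: each choice filters the remaining domains, and an emptied
    domain closes the branch successfully. [n] is fuel. *)
Fixpoint solve (n : nat) (leaf : seq T -> bool) (doms : seq (seq T)) (acc : seq T) : bool :=
  match doms, n with
  | [::], _ => leaf acc
  | d :: rest, n'.+1 =>
      all (fun o => let nd := [seq [seq o' <- d' | ~~ clash (key o) (key o')] | d' <- rest] in
        if has (@nilp T) nd then true else solve n' leaf nd (o :: acc)) d
  | _, _ => false
  end.

End Search.

(** Patterns that hold never clash, so in each domain one of them survives the filtering; the search
    path through them is never cut and ends at [leaf]. *)
Lemma solveP (T : eqType) (key : T -> trie) (ok : T -> Prop) n leaf (doms : seq (seq T)) acc :
  (forall o o', ok o -> ok o' -> ~~ clash (key o) (key o')) ->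
  solve key n leaf doms acc ->
  {in doms, forall d, exists2 o, o \in d & ok o} -> {in acc, forall o, ok o} ->
  exists2 acc', {in acc', forall o, ok o} & leaf acc'.
Proof.
move=> okc; elim: n doms acc => [|n IHn] [|d doms] acc //=.
- by move=> la _ oka; exists acc.
- by move=> la _ oka; exists acc.
move=> /allP sol okd oka.
have [o od oko] := okd d (mem_head _ _).
have rest d' : d' \in doms ->
    exists2 o', o' \in [seq o' <- d' | ~~ clash (key o) (key o')] & ok o'.
  move=> d'd; have [|o' o'd oko'] := okd d'; first by rewrite in_cons d'd orbT.
  by exists o' => //; rewrite mem_filter okc.
have := sol o od; case: ifPn => [/hasP[d1 /mapP[d' d'd ->]]|_].
  by have [o'] := rest d' d'd; case: (filter _ _).
move=> /IHn; apply; last first.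
  by move=> o'; rewrite in_cons => /predU1P[->|/oka].
by move=> d1 /mapP[d' d'd ->]; exact: rest.
Qed.

Fixpoint perms (n : nat) (L : seq nat) : seq (seq nat) :=
  if n is n'.+1 then flatten [seq [seq a :: p | p <- perms n' (rem a L)] | a <- L]
  else [:: [::]].

Lemma mem_perms p L : perm_eq p L -> p \in perms (size p) L.
Proof.
elim: p L => [|a p IHp] L pL //=.
have aL : a \in L by rewrite -(perm_mem pL) mem_head.
apply/flattenP; exists [seq a :: p' | p' <- perms (size p) (rem a L)].
  by apply/mapP; exists a.
apply: map_f; apply: IHp; rewrite -(perm_cons a) (perm_trans pL) //.
exact: perm_to_rem.
Qed.

Fixpoint pairs (r : seq nat) : seq (nat * nat) :=
  if r is x :: r' then [seq (x, y) | y <- r'] ++ pairs r' else [::].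

Lemma mem_pairs r x y : uniq r -> (x, y) \in pairs r -> [/\ x \in r, y \in r & x != y].
Proof.
elim: r => //= a r IHr /andP[ar ur]; rewrite mem_cat => /orP[/mapP[b br [-> ->]]|/(IHr ur)].
  by rewrite mem_head in_cons br orbT; split=> //; apply: contraNneq ar => ->.
by move=> [xr yr xy]; rewrite !in_cons xr yr !orbT.
Qed.

Definition pair_facts (e a a' : nat) (r : seq nat) : seq fact :=
  flatten [seq [:: (a, p.1, p.2, a', e); (a', p.1, p.2, a, e)] | p <- pairs r].

(* The two kinds of lines through a point: [(true, p)] for three lines,
   [(false, p)] for two lines and a line with four points. *)
Definition pattern := (nat * (bool * seq nat))%type.

Definition facts (o : pattern) : seq fact :=
  let: (e, (b, p)) := o in
  if p is [:: x, x', y, y', z, z' & gs] then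
    if b then pair_facts e x x' [:: y, y', z, z' & gs] ++
              pair_facts e y y' [:: x, x', z, z' & gs] ++
              pair_facts e z z' [:: x, x', y, y' & gs]
    else pair_facts e y y' [:: x, x', z, z' & gs] ++
         pair_facts e z z' [:: x, x', y, y' & gs] ++
         pair_facts e x x' [:: y; y'; z; z'] ++
         (if gs is g :: _ then pair_facts e x g [:: y; y'; z; z'] else [::])
  else [::].

(** One representative per symmetry class: of 7! orderings 105 remain for three lines with a point
    off them and 315 for a four-point line; with six other points 15 remain. *)
Definition canonical (b : bool) (p : seq nat) : bool :=
  if p is [:: x, x', y, y', z, z' & gs] then
    if b then [&& x < x', y < y', z < z', x < y & y < z]%N
    else [&& x' < head 0%N gs, y < y', z < z' & y < z]%N
  else false.

(** Every candidate carries its trie, built once and compared many times. *)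
Definition dom (n : nat) (bs : seq bool) (e : nat) : seq (pattern * trie) :=
  let P := perms n.-1 (rem e (iota 0 n)) in
  flatten [seq [seq ((e, (b, p)), trie_of (facts (e, (b, p)))) | p <- P & canonical b p] | b <- bs].

(* Up to relabelling, one of these patterns holds at the label 0. *)
Definition std8 : pattern := (0%N, (true, [:: 2; 3; 4; 5; 6; 7; 1]%N)).
Definition std8' : pattern := (0%N, (false, [:: 1; 2; 4; 5; 6; 7; 3]%N)).
Definition std7 : pattern := (0%N, (true, [:: 1; 2; 3; 4; 5; 6]%N)).

Definition with_trie (o : pattern) := (o, trie_of (facts o)).

Definition has_line (acc : seq (pattern * trie)) (a b c : nat) : bool :=
  has (fun o => let: (e, (t, p)) := o.1 in [&& t, e == a &
    if p is [:: x, x', y, y', z, z' & _] then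
      has (fun r => (r == (b, c)) || (r == (c, b))) [:: (x, x'); (y, y'); (z, z')]
    else false]) acc.

Definition has_lines (lines : seq (nat * nat * nat)) (s : seq nat) acc : bool :=
  all (fun l => let: (a, b, c) := l in let f := nth 0%N s in
    [&& has_line acc (f a) (f b) (f c), has_line acc (f b) (f c) (f a)
      & has_line acc (f c) (f a) (f b)]) lines.

(** The nonbases of the matroid, with labels lowered by one. *)
Definition MK_lines : seq (nat * nat * nat) :=
  [:: (0,1,5); (0,3,4); (0,6,7); (1,2,4); (1,3,7); (2,3,6); (2,5,7); (4,5,6)]%N.

(* The labellings of the eight solutions of the search. *)
Definition MK_labels : seq (seq nat) :=
  [:: [:: 0;2;1;7;6;3;4;5]; [:: 0;2;1;6;7;3;4;5]; [:: 0;2;1;7;6;3;5;4];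
      [:: 0;2;1;6;7;3;5;4]; [:: 0;2;1;5;4;3;6;7]; [:: 0;2;1;4;5;3;6;7];
      [:: 0;2;1;5;4;3;7;6]; [:: 0;2;1;4;5;3;7;6]]%N.

Definition Fano_lines : seq (nat * nat * nat) :=
  [:: (0,1,2); (0,3,4); (0,5,6); (1,3,5); (1,4,6); (2,3,6); (2,4,5)]%N.

Definition Fano_labels : seq (seq nat) :=
  [:: [:: 0;1;2;3;4;5;6]; [:: 0;1;2;3;4;6;5]]%N.

Lemma MK_search : solve snd 8 (fun acc => has (fun s => has_lines MK_lines s acc) MK_labels)
  ([:: with_trie std8] :: [seq dom 8 [:: true; false] e | e <- iota 1 7]) [::].
Proof. by vm_compute. Qed.

(** A four-point line at one point admits no compatible patterns at the other seven. *)
Lemma MK_search' : solve snd 8 (fun=> false)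
  ([:: with_trie std8'] :: [seq dom 8 [:: true; false] e | e <- iota 1 7]) [::].
Proof. by vm_compute. Qed.

Lemma Fano_search : solve snd 7 (fun acc => has (fun s => has_lines Fano_lines s acc) Fano_labels)
  ([:: with_trie std7] :: [seq dom 7 [:: true] e | e <- iota 1 6]) [::].
Proof. by vm_compute. Qed.

(** * Labelled points and soundness of the search *)

Section Labels.
Variables (R : realType) (w : cochar R) (labs : seq 'I_8).
Local Notation W := (W w).
Hypothesis ulabs : uniq labs.
Local Notation n := (size labs).
Local Notation lab := (nth ord0 labs).

Lemma n_le8 : (n <= 8)%N.
Proof.
by have := max_card (mem labs); rewrite (card_uniqP ulabs) card_ord.
Qed.

Definition fact_ok (q : fact) : Prop := let: (u, s, t, v, e) := q in
  [/\ all (fun i => i < 8)%N [:: u; s; t; v; e], uniq [:: u; s; t; v; e]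
    & quartet w (lab u) (lab s) (lab t) (lab v) (lab e)].

(** Equal keys mean the same centre and the same four leaves, and strict inequalities allow only one
    pairing of four leaves. *)
Lemma fact_valP q q' : fact_ok q -> fact_ok q' -> fact_key q = fact_key q' ->
  fact_val q = fact_val q'.
Proof.
case: q => [[[[u s] t] v] e]; case: q' => [[[[u' s'] t'] v'] e'].
move=> [/= b u5 Q] [/= b' u5' Q'].
have lift (P P' : pred nat) : [seq P j | j <- iota 0 8] = [seq P' j | j <- iota 0 8] ->
    forall j, (j < 8)%N -> P j = P' j.
  move=> eqm j j8; have := congr1 (fun r => nth false r j) eqm.
  by rewrite !(nth_map 0%N) ?size_iota // nth_iota.
move=> E.
have /lift ku : [seq j == u | j <- iota 0 8] = [seq j == u' | j <- iota 0 8].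
  exact: (congr1 (take 8) E).
have /lift km : [seq [|| j == s, j == t, j == v | j == e] | j <- iota 0 8] =
    [seq [|| j == s', j == t', j == v' | j == e'] | j <- iota 0 8].
  exact: (congr1 (drop 8) E).
move: b b'; rewrite !andbT => /and5P[u8 s8 t8 v8 e8] /and5P[u'8 s'8 t'8 v'8 e'8].
have eu : u = u' by apply/eqP; rewrite -ku // eqxx.
move: u5'; rewrite !inE !negb_or !andbT => /and4P[_ /and3P[st' sv' se'] /andP[tv' te'] ve'].
have := km s' s'8; have := km t' t'8; have := km v' v'8; have := km e' e'8.
rewrite !eqxx ?orbT /= => he hv ht hs.
have c1 : forall a b c d, quartet w (lab u) a b c d -> quartet w (lab u) a c b d -> False.
  by move=> a b c d; rewrite /quartet (WR w (lab u) c b); lra.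
have y1 a b c d : quartet w (lab u) a b c d -> quartet w (lab u) b a c d.
  by rewrite /quartet (WR w (lab u) b a); lra.
have y2 a b c d : quartet w (lab u) a b c d -> quartet w (lab u) a b d c.
  by rewrite /quartet (WR w (lab u) d c); lra.
have y3 a b c d : quartet w (lab u) a b c d -> quartet w (lab u) c d a b.
  rewrite /quartet (WR w (lab u) c b) (WR w (lab u) d a) (WR w (lab u) c a).
  by rewrite (WR w (lab u) d b); lra.
have c2 a b c d : quartet w (lab u) a b c d -> quartet w (lab u) a d b c -> False.
  by move=> /y2 q1 q2; exact: (c1 _ _ _ _ q1 q2).
rewrite -{}eu in Q'.
move: st' sv' se' tv' te' ve' Q' => + + + + + +.
(* Of the 24 ways to match the leaves, 8 keep the pairing and give equal values; the others
   contradict [c1] or [c2] after reordering. *)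
case/or4P: hs => /eqP->; case/or4P: ht => /eqP->; rewrite ?eqxx //;
  case/or4P: hv => /eqP->; rewrite ?eqxx //; case/or4P: he => /eqP->; rewrite ?eqxx //.
all: move=> _ _ _ _ _ _ Q'.
all: try by rewrite /fact_val; ring.
all: exfalso.
all: first [exact: (c1 _ _ _ _ Q Q') | exact: (c2 _ _ _ _ Q Q')
  | exact: (c1 _ _ _ _ Q (y1 _ _ _ _ Q')) | exact: (c2 _ _ _ _ Q (y1 _ _ _ _ Q'))
  | exact: (c1 _ _ _ _ Q (y2 _ _ _ _ Q')) | exact: (c2 _ _ _ _ Q (y2 _ _ _ _ Q'))
  | exact: (c1 _ _ _ _ Q (y1 _ _ _ _ (y2 _ _ _ _ Q')))
  | exact: (c2 _ _ _ _ Q (y1 _ _ _ _ (y2 _ _ _ _ Q')))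
  | exact: (c1 _ _ _ _ Q (y3 _ _ _ _ Q')) | exact: (c2 _ _ _ _ Q (y3 _ _ _ _ Q'))
  | exact: (c1 _ _ _ _ Q (y1 _ _ _ _ (y3 _ _ _ _ Q')))
  | exact: (c2 _ _ _ _ Q (y1 _ _ _ _ (y3 _ _ _ _ Q')))
  | exact: (c1 _ _ _ _ Q (y2 _ _ _ _ (y3 _ _ _ _ Q')))
  | exact: (c2 _ _ _ _ Q (y2 _ _ _ _ (y3 _ _ _ _ Q')))
  | exact: (c1 _ _ _ _ Q (y1 _ _ _ _ (y2 _ _ _ _ (y3 _ _ _ _ Q'))))
  | exact: (c2 _ _ _ _ Q (y1 _ _ _ _ (y2 _ _ _ _ (y3 _ _ _ _ Q'))))].
Qed.

Definition holds (o : pattern) : Prop := let: (e, (b, p)) := o in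
  perm_eq (e :: p) (iota 0 n) /\
  match p with
  | [:: x, x', y, y', z, z' & gs] =>
      if b then three_lines w (lab e) (lab x) (lab x') (lab y) (lab y') (lab z) (lab z')
                  (map (nth ord0 labs) gs)
      else exists2 g, gs = [:: g] & four_point_line w (lab e) (lab x) (lab x')
             (lab y) (lab y') (lab z) (lab z') (lab g)
  | _ => False
  end.

Lemma tight_pair_sub e a a' (r r' : seq 'I_8) : {subset r' <= r} ->
  tight_pair w e a a' r -> tight_pair w e a a' r'.
Proof. by move=> sr T x y /sr xr /sr yr; exact: T. Qed.

Lemma tight_pairC e a a' (r : seq 'I_8) : tight_pair w e a a' r -> tight_pair w e a' a r.
Proof. by move=> T x y xr yr xy; have [] := T _ _ xr yr xy. Qed.

Lemma pair_facts_ok e a a' r : uniq [:: e, a, a' & r] -> {subset [:: e, a, a' & r] <= iota 0 n} ->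
  tight_pair w (lab e) (lab a) (lab a') (map (nth ord0 labs) r) ->
  forall q, q \in pair_facts e a a' r -> fact_ok q.
Proof.
move=> u sub T q /flattenP[F /mapP[[x y] /= xyr ->]].
have [ur ue] : uniq r /\ [/\ e != a, e != a', a != a', e \notin r & a \notin r /\ a' \notin r].
  move: u; rewrite /= !inE !negb_or => /and4P[/and3P[ea ea' er] /andP[aa' ar] a'r ur].
  by split=> //; split.
case: ue => ea ea' aa' er [ar a'r].
have [xr yr xy] := mem_pairs ur xyr.
have lt i : i \in [:: e, a, a' & r] -> (i < n)%N by move=> /sub; rewrite mem_iota.
have [le la la'] : [/\ e < n, a < n & a' < n]%N.
  by split; apply: lt; rewrite !inE eqxx ?orbT.
have [lx ly] : (x < n)%N /\ (y < n)%N by split; apply: lt; rewrite !inE ?xr ?yr !orbT.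
have neq (i j : nat) : i \in r -> j \notin r -> ((i == j) = false) * ((j == i) = false).
  by move=> ir jr; rewrite [j == i]eq_sym; split; apply: contraNF jr => /eqP <-.
have nes (i j : nat) : i != j -> ((i == j) = false) * ((j == i) = false).
  by move=> /negPf ij; rewrite [j == i]eq_sym ij.
have rules := (neq _ _ xr er, neq _ _ xr ar, neq _ _ xr a'r, neq _ _ yr er,
  neq _ _ yr ar, neq _ _ yr a'r, nes _ _ ea, nes _ _ ea', nes _ _ aa', nes _ _ xy).
have lxy : lab x != lab y by rewrite nth_uniq.
have [] := T _ _ (map_f _ xr) (map_f _ yr) lxy => Q1 Q2.
have l8 i : (i < n)%N -> (i < 8)%N by move=> /leq_trans; apply; exact: n_le8.
rewrite !inE => /orP[/eqP->|/eqP->]; split=> //=; do ?by rewrite !l8.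
  by rewrite !inE !rules.
by rewrite !inE !rules.
Qed.

Lemma facts_ok o : holds o -> forall q, q \in facts o -> fact_ok q.
Proof.
case: o => e [b [|x [|x' [|y [|y' [|z [|z' gs]]]]]]]; do ?by case.
move=> [pe H] q.
have u : uniq [:: e, x, x', y, y', z, z' & gs] by rewrite (perm_uniq pe) iota_uniq.
have s : {subset [:: e, x, x', y, y', z, z' & gs] <= iota 0 n}.
  by move=> i; rewrite (perm_mem pe).
have pick a a' r : perm_eq [:: e, x, x', y, y', z, z' & gs] [:: e, a, a' & r] ->
    tight_pair w (lab e) (lab a) (lab a') (map (nth ord0 labs) r) ->
    q \in pair_facts e a a' r -> fact_ok q.
  move=> pq T; apply: (pair_facts_ok _ _ T); first by rewrite -(perm_uniq pq).
  by move=> i; rewrite -(perm_mem pq); exact: s.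
have py : perm_eq [:: e, x, x', y, y', z, z' & gs] [:: e, y, y', x, x', z, z' & gs].
  by apply/seq.permP => P /=; ring.
have pz : perm_eq [:: e, x, x', y, y', z, z' & gs] [:: e, z, z', x, x', y, y' & gs].
  by apply/seq.permP => P /=; ring.
case: b H => [[H1 H2 H3]|[g gsE [H1 H2 H3 H4]]].
  rewrite -[facts _]/(pair_facts e x x' [:: y, y', z, z' & gs] ++
      pair_facts e y y' [:: x, x', z, z' & gs] ++ pair_facts e z z' [:: x, x', y, y' & gs]).
  rewrite mem_cat => /orP[]; first exact: (pick x x' [:: y, y', z, z' & gs] (perm_refl _) H1).
  rewrite mem_cat => /orP[]; first exact: (pick _ _ [:: x, x', z, z' & gs] py H2).
  exact: (pick _ _ [:: x, x', y, y' & gs] pz H3).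
rewrite {}gsE in u s pick py pz *.
rewrite -[facts _]/(pair_facts e y y' [:: x; x'; z; z'; g] ++
  pair_facts e z z' [:: x; x'; y; y'; g] ++ pair_facts e x x' [:: y; y'; z; z'] ++
  pair_facts e x g [:: y; y'; z; z']).
rewrite mem_cat => /orP[]; first exact: (pick _ _ [:: x; x'; z; z'; g] py H1).
rewrite mem_cat => /orP[]; first exact: (pick _ _ [:: x; x'; y; y'; g] pz H2).
rewrite mem_cat => /orP[].
- have [u1 s1] : uniq [:: e; x; x'; y; y'; z; z'] /\
      {subset [:: e; x; x'; y; y'; z; z'] <= iota 0 n}.
    rewrite -[[:: e; x; x'; y; y'; z; z'; g]]/(rcons [:: e; x; x'; y; y'; z; z'] g) in u s.
    move: u; rewrite rcons_uniq => /andP[_ ->]; split=> // i hi.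
    by apply: s; rewrite mem_rcons in_cons hi orbT.
  exact: (@pair_facts_ok e x x' [:: y; y'; z; z']).
- have pg : perm_eq [:: e; x; x'; y; y'; z; z'; g] (x' :: [:: e; x; g; y; y'; z; z']).
    by apply/seq.permP => P /=; ring.
  have [u1 s1] : uniq [:: e; x; g; y; y'; z; z'] /\
      {subset [:: e; x; g; y; y'; z; z'] <= iota 0 n}.
    move: u; rewrite (perm_uniq pg) cons_uniq => /andP[_ ->]; split=> // i hi.
    by apply: s; rewrite (perm_mem pg) in_cons hi orbT.
  exact: (@pair_facts_ok e x g [:: y; y'; z; z']).
Qed.

Definition valid (o : pattern * trie) : Prop := o = with_trie o.1 /\ holds o.1.

Lemma valid_clash o o' : valid o -> valid o' -> ~~ clash o.2 o'.2.
Proof.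
move=> [-> ho] [-> ho']; apply/negP => /clashP[k [a [b [ka kb]]]].
have [q qo [kq <-]] := trie_ofP ka; have [q' qo' [kq' <-]] := trie_ofP kb.
rewrite -kq' in kq; by rewrite (fact_valP (facts_ok ho qo) (facts_ok ho' qo')) ?eqxx.
Qed.

Lemma mem_dom e b p bs : b \in bs -> canonical b p -> perm_eq (e :: p) (iota 0 n) ->
  with_trie (e, (b, p)) \in dom n bs e.
Proof.
move=> bbs cp pe; apply/flattenP; exists
  [seq ((e, (b, p)), trie_of (facts (e, (b, p)))) | p <- perms n.-1 (rem e (iota 0 n)) & canonical b p].
  by apply/mapP; exists b.
apply/mapP; exists p => //; rewrite mem_filter cp /=.
have -> : n.-1 = size p by rewrite -[n](size_iota 0) -(perm_size pe).
apply: mem_perms; rewrite -(perm_cons e) (perm_trans pe) //; apply: perm_to_rem.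
by rewrite -(perm_mem pe) mem_head.
Qed.

(** The conditions are symmetric in the ends of a pair and in the pairs; for a four-point line they
    are symmetric in [x'] and [g] and in the two other pairs. *)
Lemma canonical_holds e b p : holds (e, (b, p)) ->
  exists2 p', canonical b p' & holds (e, (b, p')).
Proof.
case: p => [|x [|x' [|y [|y' [|z [|z' gs]]]]]]; do ?by case.
case: b => [H|[pe [g gsE F]]].
  pose P x x' y y' z z' := holds (e, (true, [:: x, x', y, y', z, z' & gs])).
  have ne a a' b b' c c' : P a a' b b' c c' -> [/\ a != a', a != b, a != c & b != c].
    move=> [/perm_uniq + _]; rewrite iota_uniq /= !inE !negb_or.
    by case/and5P=> _ /and5P[-> -> _ -> _] _ /and4P[_ -> _ _] _.
  have S1 a a' b b' c c' : P a a' b b' c c' -> P a' a b b' c c'.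
    move=> [pe [H1 H2 H3]]; split.
      by rewrite -(permPr pe); apply/seq.permP => p /=; ring.
    split; first exact: tight_pairC.
      by apply: tight_pair_sub H2 => t; rewrite !inE; do !case: (_ == _).
    by apply: tight_pair_sub H3 => t; rewrite !inE; do !case: (_ == _).
  have S12 a a' b b' c c' : P a a' b b' c c' -> P b b' a a' c c'.
    move=> [pe [H1 H2 H3]]; split.
      by rewrite -(permPr pe); apply/seq.permP => p /=; ring.
    split=> //; apply: tight_pair_sub H3 => t.
    by rewrite !inE; do !case: (_ == _).
  have S23 a a' b b' c c' : P a a' b b' c c' -> P a a' c c' b b'.
    move=> [pe [H1 H2 H3]]; split.
      by rewrite -(permPr pe); apply/seq.permP => p /=; ring.
    split=> //; apply: tight_pair_sub H1 => t.
    by rewrite !inE; do !case: (_ == _).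
  have sort1 a a' b b' c c' : P a a' b b' c c' ->
      exists d d', P d d' b b' c c' /\ (d < d')%N.
    move=> Pa; have [aa' _ _ _] := ne _ _ _ _ _ _ Pa.
    case: (ltngtP a a') aa' => // lt _; first by exists a, a'.
    by exists a', a; split=> //; exact: S1.
  have [x1 [x1' [{}H lx]]] := sort1 _ _ _ _ _ _ H.
  have [y1 [y1' [{}H ly]]] := sort1 _ _ _ _ _ _ (S12 _ _ _ _ _ _ H).
  have [z1 [z1' [{}H lz]]] := sort1 _ _ _ _ _ _ (S12 _ _ _ _ _ _ (S23 _ _ _ _ _ _ H)).
  have done_ a a' b b' c c' : P a a' b b' c c' -> [/\ a < a', b < b' & c < c']%N ->
      (a < b < c)%N -> exists2 p', canonical true p' & holds (e, (true, p')).
    move=> Pa [l1 l2 l3] /andP[l4 l5]; exists [:: a, a', b, b', c, c' & gs] => //.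
    by rewrite /= l1 l2 l3 l4.
  have [_ nzy nzx nyx] := ne _ _ _ _ _ _ H.
  case: (ltngtP z1 y1) nzy => // lzy _; case: (ltngtP y1 x1) nyx => // lyx _;
    case: (ltngtP z1 x1) nzx => // lzx _.
  - by apply: (done_ _ _ _ _ _ _ H) => //; rewrite lzy.
  - by have := ltn_trans (ltn_trans lzy lyx) lzx; rewrite ltnn.
  - by apply: (done_ _ _ _ _ _ _ (S23 _ _ _ _ _ _ H)) => //; rewrite lzx.
  - by apply: (done_ _ _ _ _ _ _ (S12 _ _ _ _ _ _ (S23 _ _ _ _ _ _ H))) => //; rewrite lzx.
  - by apply: (done_ _ _ _ _ _ _ (S12 _ _ _ _ _ _ H)) => //; rewrite lzy.
  - apply: (done_ _ _ _ _ _ _ (S23 _ _ _ _ _ _ (S12 _ _ _ _ _ _ H))) => //.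
    by rewrite lyx.
  - by have := ltn_trans (ltn_trans lyx lzy) lzx; rewrite ltnn.
  - apply: (done_ _ _ _ _ _ _ (S12 _ _ _ _ _ _ (S23 _ _ _ _ _ _ (S12 _ _ _ _ _ _ H)))) => //.
    by rewrite lyx.
rewrite {}gsE in pe.
pose P x x' y y' z z' g := perm_eq [:: e; x; x'; y; y'; z; z'; g] (iota 0 n) /\
  four_point_line w (lab e) (lab x) (lab x') (lab y) (lab y') (lab z) (lab z') (lab g).
have H : P x x' y y' z z' g by [].
have ne x1 x1' y1 y1' z1 z1' g1 : P x1 x1' y1 y1' z1 z1' g1 ->
    [/\ x1' != g1, y1 != y1', y1 != z1 & z1 != z1'].
  move=> [/perm_uniq + _]; rewrite iota_uniq /= !inE !negb_or !andbT.
  by move=> /and5P[_ _ /and5P[_ _ _ _ ->] /and4P[-> -> _ _] /andP[_ /andP[/andP[-> _] _]]].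
have S1 x1 x1' y1 y1' z1 z1' g1 : P x1 x1' y1 y1' z1 z1' g1 -> P x1 g1 y1 y1' z1 z1' x1'.
  move=> [pe1 [H1 H2 H3 H4]]; split.
    by rewrite -(permPr pe1); apply/seq.permP => p /=; ring.
  split=> //.
    by apply: tight_pair_sub H1 => t; rewrite !inE; do !case: (_ == _).
  by apply: tight_pair_sub H2 => t; rewrite !inE; do !case: (_ == _).
have S2 x1 x1' y1 y1' z1 z1' g1 : P x1 x1' y1 y1' z1 z1' g1 -> P x1 x1' y1' y1 z1 z1' g1.
  move=> [pe1 [H1 H2 H3 H4]]; split.
    by rewrite -(permPr pe1); apply/seq.permP => p /=; ring.
  split; first exact: tight_pairC.
  - by apply: tight_pair_sub H2 => t; rewrite !inE; do !case: (_ == _).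
  - by apply: tight_pair_sub H3 => t; rewrite !inE; do !case: (_ == _).
  - by apply: tight_pair_sub H4 => t; rewrite !inE; do !case: (_ == _).
have S23 x1 x1' y1 y1' z1 z1' g1 : P x1 x1' y1 y1' z1 z1' g1 -> P x1 x1' z1 z1' y1 y1' g1.
  move=> [pe1 [H1 H2 H3 H4]]; split.
    by rewrite -(permPr pe1); apply/seq.permP => p /=; ring.
  split=> //.
  - by apply: tight_pair_sub H3 => t; rewrite !inE; do !case: (_ == _).
  - by apply: tight_pair_sub H4 => t; rewrite !inE; do !case: (_ == _).
have [x1' [g1 [{}H l1]]] : exists x1' g1, P x x1' y y' z z' g1 /\ (x1' < g1)%N.
  have [+ _ _ _] := ne _ _ _ _ _ _ _ H.
  case: (ltngtP x' g) => // lt _; first by exists x', g.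
  by exists g, x'; split=> //; exact: S1.
have sort2 b b' c c' : P x x1' b b' c c' g1 -> exists d d', P x x1' d d' c c' g1 /\ (d < d')%N.
  move=> Pb; have [_ + _ _] := ne _ _ _ _ _ _ _ Pb.
  case: (ltngtP b b') => // lt _; first by exists b, b'.
  by exists b', b; split=> //; exact: S2.
have [y1 [y1' [{}H l2]]] := sort2 _ _ _ _ H.
have [z1 [z1' [{}H l3]]] := sort2 _ _ _ _ (S23 _ _ _ _ _ _ _ H).
have fin b b' c c' : P x x1' b b' c c' g1 -> [/\ b < b', c < c' & b < c]%N ->
    exists2 p', canonical false p' & holds (e, (false, p')).
  move=> [peb Fb] [m1 m2 m3]; exists [:: x; x1'; b; b'; c; c'; g1].
    by rewrite /= l1 m1 m2.
  by split=> //; exists g1.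
have [_ _ + _] := ne _ _ _ _ _ _ _ H.
case: (ltngtP z1 y1) => // lt _; first exact: (fin _ _ _ _ H).
exact: (fin _ _ _ _ (S23 _ _ _ _ _ _ _ H)).
Qed.

Lemma has_line_tight acc a b c i j : {in acc, forall o, valid o} -> has_line acc a b c ->
  uniq [:: i; j; a; b; c] -> (i < n)%N -> (j < n)%N ->
  quartet w (lab b) (lab i) (lab j) (lab c) (lab a) /\
  quartet w (lab c) (lab i) (lab j) (lab b) (lab a).
Proof.
move=> va /hasP[[[e [b1 p]] t] /va[_ H] /= /and3P[b1T /eqP ea +]] u5 ilt jlt.
move: H; rewrite {}b1T {}ea {b1 e}.
case: p => [|x [|x' [|y [|y' [|z [|z' gs]]]]]] //= [pe [H1 H2 H3]].
have mem k : (k < n)%N -> k \in [:: a, x, x', y, y', z, z' & gs].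
  by rewrite (perm_mem pe) mem_iota.
have key d d' (r : seq nat) : perm_eq [:: a, x, x', y, y', z, z' & gs] [:: a, d, d' & r] ->
    tight_pair w (lab a) (lab d) (lab d') (map (nth ord0 labs) r) ->
    ((d, d') == (b, c)) || ((d, d') == (c, b)) ->
    quartet w (lab b) (lab i) (lab j) (lab c) (lab a) /\
    quartet w (lab c) (lab i) (lab j) (lab b) (lab a).
  move=> pq T dbc.
  have inr k : (k < n)%N -> k \notin [:: a; b; c] -> k \in r.
    move=> /mem; rewrite (perm_mem pq) !inE !negb_or => /or4P[/eqP->|/eqP->|/eqP->|//].
    - by rewrite eqxx.
    - by case/orP: dbc => /eqP[E E']; rewrite ?E ?E' eqxx ?andbF.
    - by case/orP: dbc => /eqP[E E']; rewrite ?E ?E' eqxx ?andbF.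
  move: u5; rewrite /= !inE !negb_or => /and3P[/and4P[ij ia ib ic] /and3P[ja jb jc] _].
  have ir : i \in r by apply: inr => //; rewrite !inE !negb_or ia ib.
  have jr : j \in r by apply: inr => //; rewrite !inE !negb_or ja jb.
  have lij : lab i != lab j by rewrite nth_uniq.
  have [T1 T2] := T _ _ (map_f _ ir) (map_f _ jr) lij.
  by case/orP: dbc => /eqP[<- <-].
rewrite orbF => /or3P[]; first exact: (key x x' [:: y, y', z, z' & gs] (perm_refl _) H1).
  by apply: (key y y' [:: x, x', z, z' & gs] _ H2); apply/seq.permP => P /=; ring.
by apply: (key z z' [:: x, x', y, y' & gs] _ H3); apply/seq.permP => P /=; ring.
Qed.

End Labels.

Section Stuck.
Variables (R : realType) (w : cochar R).
Hypothesis Dw : dressian w.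
Implicit Types (labs l : seq 'I_8) (a b c : 'I_8).

Definition stuck labs : Prop :=
  forall a, a \in labs -> ~ good w ([set x in labs] :\ a)%SET a.

Lemma stuck_failure labs a : uniq labs -> (7 <= size labs)%N -> stuck labs -> a \in labs ->
  exists x x' y y' z z' gs, perm_eq [:: a, x, x', y, y', z, z' & gs] labs /\
    (three_lines w a x x' y y' z z' gs \/
     exists2 g, gs = [:: g] & four_point_line w a x x' y y' z z' g).
Proof.
move=> ul l7 st al; have l8 := n_le8 ul.
pose S : {set 'I_8} := ([set x in labs] :\ a)%SET.
have cS : #|S| = (size labs).-1.
  have : #|[set x in labs]%SET| = size labs by rewrite cardsE; apply/card_uniqP.
  by rewrite (cardsD1 a) inE al => <-.
have aS : a \notin S by rewrite !inE eqxx.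
have S3 : (3 <= #|S|)%N by rewrite cS; move: l7; case: (size labs) => // n; rewrite ltnS; apply: leq_trans.
have S7 : (#|S| <= 7)%N by rewrite cS; move: l8; case: (size labs).
have pe s : uniq (a :: s) -> {subset s <= S} -> (size labs <= (size s).+1)%N ->
    perm_eq (a :: s) labs.
  move=> us sS sz; apply: uniq_perm => //.
  have sub : {subset a :: s <= labs}.
    by move=> x; rewrite inE => /predU1P[->//|/sS]; rewrite !inE => /andP[].
  by case: (uniq_min_size us sub sz).
have [x [x' [y [y' [z [z' [u6 s6 H]]]]]]] := failure Dw aS S3 (st a al) S7.
exists x, x', y, y', z, z'.
have a6 s : {subset s <= S} -> a \notin s by move=> sS; apply: contra aS => /sS.
case: H => [[c6 T]|[g [gS g6 T]]].
  exists [::]; split; last by left.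
  apply: pe => //; last by have := etrans (esym cS) c6; case: (size labs) => // n /= ->.
  by rewrite cons_uniq u6 a6.
exists [:: g]; split; last by case: T => T; [left | right; exists g].
have sub : {subset [:: x; x'; y; y'; z; z'; g] <= S}.
  move=> t; rewrite -[[:: x; x'; y; y'; z; z'; g]]/(rcons [:: x; x'; y; y'; z; z'] g).
  by rewrite mem_rcons inE => /predU1P[->|/s6].
apply: pe => //; rewrite cons_uniq a6 //.
by rewrite -[[:: x; x'; y; y'; z; z'; g]]/(rcons [:: x; x'; y; y'; z; z'] g) rcons_uniq g6.
Qed.

Lemma stuck_holds labs i : uniq labs -> (7 <= size labs)%N -> stuck labs ->
  (i < size labs)%N -> exists (b : bool) p, [/\ canonical b p, holds w labs (i, (b, p)) &
    size labs = 7%N -> b].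
Proof.
move=> ul l7 st il.
have [x [x' [y [y' [z [z' [gs [pe H]]]]]]]] := stuck_failure ul l7 st (mem_nth ord0 il).
pose ix a := index a labs.
have pi : perm_eq (i :: map ix [:: x, x', y, y', z, z' & gs]) (iota 0 (size labs)).
  have -> : iota 0 (size labs) = map ix labs.
    apply: (@eq_from_nth _ 0%N) => [|j]; rewrite size_iota ?size_map // => jl.
    by rewrite (nth_map ord0) // nth_iota // /ix index_uniq.
  have -> : i = ix (nth ord0 labs i) by rewrite /ix index_uniq.
  exact: perm_map pe.
have nx a : a \in [:: x, x', y, y', z, z' & gs] -> nth ord0 labs (ix a) = a.
  by move=> a6; rewrite nth_index // -(perm_mem pe) in_cons a6 orbT.
have [n1 n2 n3] : [/\ nth ord0 labs (ix x) = x, nth ord0 labs (ix x') = x' &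
  nth ord0 labs (ix y) = y] by split; apply: nx; rewrite !inE eqxx ?orbT.
have [n4 n5 n6] : [/\ nth ord0 labs (ix y') = y', nth ord0 labs (ix z) = z &
  nth ord0 labs (ix z') = z'] by split; apply: nx; rewrite !inE eqxx ?orbT.
have ngs : map (nth ord0 labs) (map ix gs) = gs.
  rewrite -map_comp; apply: map_id_in => t tg; apply: nx.
  by rewrite !inE tg !orbT.
case: H => [T|[g gsE F]].
  have [p cp hp] : exists2 p, canonical true p & holds w labs (i, (true, p)).
    apply: (canonical_holds (p := map ix [:: x, x', y, y', z, z' & gs])).
    by split=> //; rewrite /= n1 n2 n3 n4 n5 n6 ngs.
  by exists true, p.
have [p cp hp] : exists2 p, canonical false p & holds w labs (i, (false, p)).
  apply: (canonical_holds (p := map ix [:: x, x', y, y', z, z' & gs])).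
  split=> //=; exists (ix g); first by rewrite gsE.
  by rewrite n1 n2 n3 n4 n5 n6 nx // gsE !inE eqxx !orbT.
exists false, p; split=> // l7'; have := perm_size pe; by rewrite l7' gsE.
Qed.

(** The symmetric notion: all three points serve as centres, whereas [tight_pair] omits the point
    [e]. *)
Definition tight_line l a b c : Prop := {in l &, forall x y,
  uniq [:: x; y; a; b; c] -> [/\ quartet w a x y b c, quartet w b x y c a & quartet w c x y a b]}.

Definition tight_lines (lines : seq (nat * nat * nat)) l : Prop :=
  {in lines, forall t, tight_line l (nth ord0 l t.1.1) (nth ord0 l t.1.2) (nth ord0 l t.2)}.

Lemma has_lines_tight labs (lines : seq (nat * nat * nat)) s acc : uniq labs ->
  {in acc, forall o, valid w labs o} -> perm_eq s (iota 0 (size labs)) ->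
  all (fun t => all (fun i => i < size labs)%N [:: t.1.1; t.1.2; t.2]) lines ->
  has_lines lines s acc -> tight_lines lines (map (nth ord0 labs) s).
Proof.
move=> ul va pe bnd hl [[a b] c] tl.
have sz : size s = size labs by rewrite (perm_size pe) size_iota.
have us : uniq s by rewrite (perm_uniq pe) iota_uniq.
have /and4P[/= al bl cl _] := allP bnd _ tl.
have /and3P[h1 h2 h3] := allP hl _ tl.
move=> _ _ /mapP[i si ->] /mapP[j sj ->]; rewrite !(nth_map 0%N) ?sz //.
have lt k : k \in s -> (k < size labs)%N by rewrite (perm_mem pe) mem_iota.
have lts k : (k < size labs)%N -> (nth 0%N s k < size labs)%N.
  by move=> kl; apply: lt; rewrite mem_nth ?sz.
have [ilt jlt] := (lt _ si, lt _ sj).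
move=> /(@map_uniq _ _ (nth ord0 labs) [:: i; j; nth 0%N s a; nth 0%N s b; nth 0%N s c]) u5.
have rot x y z t v : uniq [:: x; y; z; t; v] = uniq [:: x; y; t; v; z] :> bool.
  by apply/perm_uniq; rewrite !perm_cons (perm_catC [:: z] [:: t; v]).
have u5' := u5; rewrite rot in u5'; have u5'' := u5'; rewrite rot in u5''.
have [q1 _] := has_line_tight ul va h1 u5 ilt jlt.
have [q2 _] := has_line_tight ul va h2 u5' ilt jlt.
by have [q3 _] := has_line_tight ul va h3 u5'' ilt jlt.
Qed.

(** The points are relabelled so that the pattern at the first one becomes [std7]; the search varies
    the other six. *)
Lemma stuck_Fano labs : uniq labs -> size labs = 7%N -> stuck labs ->
  exists l, [/\ uniq l, size l = 7%N, {subset l <= labs} & tight_lines Fano_lines l].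
Proof.
case: labs => // a labs0; set labs := a :: labs0 => ul s7 st.
have [|x [x' [y [y' [z [z' [gs [pe H]]]]]]]] := stuck_failure ul _ st (mem_head _ _).
  by rewrite s7.
have gs0 : gs = [::].
  by have := perm_size pe; rewrite s7 /=; case: gs {pe H}.
have T : three_lines w a x x' y y' z z' [::] by case: H => [|[g]]; rewrite gs0.
rewrite {H}gs0 in pe.
pose l := [:: a; x; x'; y; y'; z; z'].
have ul1 : uniq l by rewrite (perm_uniq pe).
have stl : stuck l.
  move=> t tl; have := st t; rewrite -(perm_mem pe) => /(_ tl).
  suff -> : [set x in labs]%SET = [set x in l]%SET by [].
  by apply/setP => i; rewrite !finset.in_set -(perm_mem pe).
have okd : {in [:: with_trie std7] :: [seq dom 7 [:: true] e | e <- iota 1 6],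
    forall d, exists2 o, o \in d & valid w l o}.
  move=> d; rewrite in_cons => /predU1P[->|/mapP[e ein ->]].
    by exists (with_trie std7); rewrite ?mem_head.
  have el : (e < size l)%N by move: ein; rewrite mem_iota => /andP[_].
  have [|b [p [cp hp /(_ erefl) bt]]] := stuck_holds ul1 _ stl el; first by [].
  exists (with_trie (e, (b, p))); last by [].
  by have := mem_dom (bs := [:: true]) _ cp (proj1 hp); rewrite bt => /(_ isT).
have [acc va /hasP[s sin hl]] := solveP (@valid_clash _ w l ul1) Fano_search okd (fun _ => ltac:(by [])).
have ps : perm_eq s (iota 0 (size l)).
  by apply: (allP (_ : all (fun s => perm_eq s (iota 0 7)) Fano_labels)) sin.
exists (map (nth ord0 l) s); split.
- rewrite map_inj_in_uniq ?(perm_uniq ps) ?iota_uniq // => i j.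
  by rewrite !(perm_mem ps) !mem_iota => il jl /eqP; rewrite nth_uniq // => /eqP.
- by rewrite size_map (perm_size ps) size_iota.
- move=> _ /mapP[i + ->]; rewrite (perm_mem ps) mem_iota => il.
  by rewrite -(perm_mem pe) mem_nth.
- exact: has_lines_tight hl.
Qed.

Lemma stuck_MK labs : uniq labs -> size labs = 8%N -> stuck labs ->
  exists l, [/\ uniq l, size l = 8%N & tight_lines MK_lines l].
Proof.
case: labs => // a labs0; set labs := a :: labs0 => ul s8 st.
have [|x [x' [y [y' [z [z' [gs [pe H]]]]]]]] := stuck_failure ul _ st (mem_head _ _).
  by rewrite s8.
have [g gsE] : exists g, gs = [:: g].
  by have := perm_size pe; rewrite s8 /=; case: gs {pe H} => // g [|//] _; exists g.
rewrite {}gsE in pe H.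
have stl l : perm_eq l labs -> stuck l.
  move=> pl t tl; have := st t; rewrite -(perm_mem pl) => /(_ tl).
  suff -> : [set x in labs]%SET = [set x in l]%SET by [].
  by apply/setP => i; rewrite !finset.in_set -(perm_mem pl).
have doms l o : uniq l -> size l = 8%N -> stuck l -> valid w l o ->
    {in [:: o] :: [seq dom 8 [:: true; false] e | e <- iota 1 7],
      forall d, exists2 o, o \in d & valid w l o}.
  move=> ul1 sl st1 vo d; rewrite in_cons => /predU1P[->|/mapP[e ein ->]].
    by exists o; rewrite ?mem_head.
  have el : (e < size l)%N by move: ein; rewrite mem_iota sl => /andP[_].
  have [|b [p [cp hp _]]] := stuck_holds ul1 _ st1 el; first by rewrite sl.
  exists (with_trie (e, (b, p))); last by [].
  have := mem_dom (bs := [:: true; false]) _ cp (proj1 hp); rewrite sl; apply.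
  by case: b {cp hp}.
case: H => [T|[_ [<-] F]].
  (* This order turns the pattern at [a] into [std8], where label 1 is the point off the three
     lines. *)
  pose l := [:: a; g; x; x'; y; y'; z; z'].
  have pl : perm_eq l labs.
    by rewrite -(permPr pe); apply/seq.permP => P /=; ring.
  have ul1 : uniq l by rewrite (perm_uniq pl).
  have [acc va /hasP[s sin hl]] := solveP (@valid_clash _ w l ul1) MK_search
    (doms l (with_trie std8) ul1 erefl (stl _ pl) ltac:(by [])) (fun _ => ltac:(by [])).
  have ps : perm_eq s (iota 0 (size l)).
    by apply: (allP (_ : all (fun s => perm_eq s (iota 0 8)) MK_labels)) sin.
  exists (map (nth ord0 l) s); split.
  - rewrite map_inj_in_uniq ?(perm_uniq ps) ?iota_uniq // => i j.
    by rewrite !(perm_mem ps) !mem_iota => il jl /eqP; rewrite nth_uniq // => /eqP.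
  - by rewrite size_map (perm_size ps) size_iota.
  - exact: has_lines_tight hl.
pose l := [:: a; x; x'; g; y; y'; z; z'].
have pl : perm_eq l labs.
  by rewrite -(permPr pe); apply/seq.permP => P /=; ring.
have ul1 : uniq l by rewrite (perm_uniq pl).
have vs : valid w l (with_trie std8') by split=> //; split=> //; exists 3%N.
by have [] := solveP (@valid_clash _ w l ul1) MK_search'
  (doms l _ ul1 erefl (stl _ pl) vs) (fun _ => ltac:(by [])).
Qed.

End Stuck.

(** * The Fano configuration *)

Section Alternating.
Variables (B : comNzRingType) (x : triple -> B).

Lemma bxP i j k : i != j -> bx x j i k = - bx x i j k.
Proof.
move=> ij; rewrite /bx triP -mulNr; congr (_ * _).
rewrite /sb; case: (ltngtP i j) (ij) => [||/val_inj->]; rewrite ?eqxx // => _ _.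
  by case: (k < i)%N; case: (k < j)%N; rewrite ?expr0 ?expr1 ?opprK.
by case: (k < i)%N; case: (k < j)%N; rewrite ?expr0 ?expr1 ?opprK.
Qed.

Lemma bxR i j k : j != k -> bx x i k j = - bx x i j k.
Proof.
move=> jk; rewrite /bx triR -mulNr; congr (_ * _).
rewrite /sb; case: (ltngtP j k) (jk) => [||/val_inj->]; rewrite ?eqxx // => _ _.
  by case: (j < i)%N; case: (k < i)%N; rewrite ?expr0 ?expr1 ?opprK.
by case: (j < i)%N; case: (k < i)%N; rewrite ?expr0 ?expr1 ?opprK.
Qed.

End Alternating.

Section Congruence.
Variables (A : comNzRingType) (Q : set A).
Hypothesis iQ : ideal Q.

Lemma cong_mul x y x' y' : Q (x - y) -> Q (x' - y') -> Q (x * x' - y * y').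
Proof.
case: iQ => _ QD QM q q'.
have -> : x * x' - y * y' = x' * (x - y) + y * (x' - y') by ring.
by apply: QD; exact: QM.
Qed.

Lemma cong_sym x y : Q (x - y) -> Q (y - x).
Proof. by move=> q; rewrite -opprB; exact: idealN. Qed.

End Congruence.

Section Tight.
Variables (R : realType) (w : cochar R).
Local Notation W := (W w).
Local Notation VJ := (initial_degeneration w).
Local Notation q := (bx (@qpt R)).

(** The least of the three weights is attained twice, and the quartet makes one of them strictly
    largest. *)
Lemma quartet_tie u s t v e : dressian w -> uniq [:: u; s; t; v; e] ->
  quartet w u s t v e -> W u s v + W u t e = W u s e + W u t v.
Proof.
move=> Dw u5 [h1 h2].
have p1 : uniq [:: u; s; v; t; e] by rewrite (perm_uniq (_ : perm_eq _ [:: u; s; t; v; e])) //;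
  apply/seq.permP => P /=; ring.
have p2 : uniq [:: u; s; e; t; v] by rewrite (perm_uniq (_ : perm_eq _ [:: u; s; t; v; e])) //;
  apply/seq.permP => P /=; ring.
move: h1 h2 (Dw _ _ _ _ _ p1) (Dw _ _ _ _ _ p2).
rewrite !(WR w u v t) !(WR w u e v) !(WR w u e t).
by move=> h1 h2 [] h3 [] h4; lra.
Qed.

(** The heaviest product drops out, so the initial form of the relation is a binomial. *)
Lemma quartet_cong Q u s t v e : VJ Q -> uniq [:: u; s; t; v; e] ->
  quartet w u s t v e -> Q (q u s v * q u t e - q u s e * q u t v).
Proof.
move=> VQ u5 qu; have tie := quartet_tie (VJ_dressian VQ) u5 qu.
have [h1 h2] := qu; have [iQ _ _] := VJ_prime VQ.
have mu1 : W u s v + W u t e <= W u s e + W u t v by rewrite tie.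
have := inrel_VJ u5 (ltW h1) (lexx _) mu1 VQ.
rewrite /inrel eqxx -tie eqxx gt_eqF // sub0r => /(idealN iQ).
by rewrite opprD opprK.
Qed.

End Tight.

(* One binomial for each of the seven lines; multiplied together, they say that
   a monomial is congruent to its opposite. *)
Lemma Fano_cong (A : comNzRingType) (Q : set A) (b : nat -> nat -> nat -> A) :
  prime_ideal Q -> ~ Q (1 + 1) ->
  (forall i j k, uniq [:: i; j; k] -> all (fun i => i < 7)%N [:: i; j; k] ->
    [/\ ~ Q (b i j k), b j i k = - b i j k & b i k j = - b i j k]) ->
  {in Fano_lines, forall t, let: (a, c, d) := t in
    forall x y, uniq [:: x; y; a; c; d] -> (x < 7)%N -> (y < 7)%N ->
    [/\ Q (b a x c * b a y d - b a x d * b a y c),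
        Q (b c x d * b c y a - b c x a * b c y d) &
        Q (b d x a * b d y c - b d x c * b d y a)]} -> False.
Proof.
move=> [iQ Q1 QP] Q2 alt rel.
have nQ i j k : uniq [:: i; j; k] -> all (fun i => i < 7)%N [:: i; j; k] -> ~ Q (b i j k).
  by move=> u l; case: (alt _ _ _ u l).
have aP i j k : uniq [:: i; j; k] -> all (fun i => i < 7)%N [:: i; j; k] ->
    b j i k = - b i j k by move=> u l; case: (alt _ _ _ u l).
have aR i j k : uniq [:: i; j; k] -> all (fun i => i < 7)%N [:: i; j; k] ->
    b i k j = - b i j k by move=> u l; case: (alt _ _ _ u l).
have [r1 _ _] := rel (0, 1, 2)%N isT 3%N 5%N isT isT isT.
have [r2 _ _] := rel (0, 3, 4)%N isT 1%N 5%N isT isT isT.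
have [r3 _ _] := rel (0, 5, 6)%N isT 1%N 3%N isT isT isT.
have [r4 _ _] := rel (1, 3, 5)%N isT 2%N 4%N isT isT isT.
have [r5 _ _] := rel (1, 4, 6)%N isT 0%N 3%N isT isT isT.
have [_ r6 _] := rel (2, 3, 6)%N isT 0%N 1%N isT isT isT.
have [_ _ r7] := rel (2, 4, 5)%N isT 0%N 1%N isT isT isT.
(* The binomials, some of them reversed, are chosen so that both products run over the same fourteen
   brackets; reordering the indices leaves opposite signs. *)
have := cong_mul iQ r1 (cong_mul iQ (cong_sym iQ r2) (cong_mul iQ r3 (cong_mul iQ r4
  (cong_mul iQ (cong_sym iQ r5) (cong_mul iQ (cong_sym iQ r6) (cong_sym iQ r7)))))).
rewrite (aP 0 3 6)%N // (aP 1 3 2)%N // (aP 0 5 2)%N // (aP 1 5 4)%N // (aP 0 3 2)%N //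
  (aP 1 3 6)%N // (aP 0 5 4)%N // (aP 1 5 2)%N // (aP 0 1 4)%N // (aP 0 1 6)%N //.
rewrite (aR 0 1 3)%N // (aR 0 2 5)%N // (aR 0 3 5)%N // (aR 1 3 4)%N // (aR 0 2 3)%N //
  (aR 0 1 5)%N // (aR 0 4 5)%N // (aR 1 2 3)%N // (aR 1 4 5)%N // (aR 1 2 5)%N //.
set M := (X in Q X); have {M}-> : M = (1 + 1) * (- 1 * (b 0%N 1%N 3%N * b 0%N 2%N 5%N * b 0%N 1%N 4%N * b 0%N 3%N 5%N *
  b 0%N 1%N 5%N * b 0%N 3%N 6%N * b 1%N 2%N 3%N * b 1%N 4%N 5%N * b 0%N 1%N 6%N * b 1%N 3%N 4%N * b 0%N 2%N 3%N * b 1%N 3%N 6%N *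
  b 0%N 4%N 5%N * b 1%N 2%N 5%N)) by rewrite /M; ring.
case/QP=> // /QP[N1|]; last by do 13![case/QP; last exact: nQ]; exact: nQ.
by case: (iQ) => _ _ QM; apply: Q1; have := QM (-1) _ N1; rewrite mulrNN mulr1.
Qed.

Lemma prime_two (F : numFieldType) (A : comNzRingType) (f : {rmorphism F -> A}) (Q : set A) :
  prime_ideal Q -> ~ Q (1 + 1).
Proof.
move=> [[_ _ QM] Q1 _] /(QM (f 2^-1)).
by rewrite -(rmorph1 f) -rmorphD -rmorphM mulVf ?pnatr_eq0 // rmorph1.
Qed.

Section Chain.
Variables (R : realType) (w : cochar R).
Local Notation VJ := (initial_degeneration w).
Hypothesis VJ0 : exists Q, VJ Q.
Implicit Types (S : {set 'I_8}) (e : 'I_8).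

Lemma not_stuck7 labs : uniq labs -> size labs = 7%N -> ~ stuck w labs.
Proof.
move=> ul sl st; have [Q VQ] := VJ0.
have [l [u7 s7 _ tl]] := stuck_Fano (VJ_dressian VQ) ul sl st.
pose b i j k := bx (@qpt R) (nth ord0 l i) (nth ord0 l j) (nth ord0 l k).
have Q2 : ~ Q (1 + 1) by exact: (prime_two (@iL R) (VJ_prime VQ)).
apply: (@Fano_cong _ Q b (VJ_prime VQ) Q2) => [i j k u /and4P[il jl kl _]|].
  move: u; rewrite /= !inE negb_or andbT => /andP[/andP[ij ik] jk].
  split; first exact: (bx_qptN VQ).
    by apply: bxP; rewrite nth_uniq ?s7.
  by apply: bxR; rewrite nth_uniq ?s7.
move=> [[a c] d] tF x y u5 x7 y7.
have /and3P[a7 c7 d7] : [&& a < 7, c < 7 & d < 7]%N.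
  by apply: (allP (_ : all (fun t => [&& t.1.1 < 7, t.1.2 < 7 & t.2 < 7]%N) Fano_lines)) tF.
have un i1 i2 i3 i4 i5 : uniq [:: i1; i2; i3; i4; i5] -> all (fun i => i < 7)%N [:: i1; i2; i3; i4; i5] ->
    uniq (map (nth ord0 l) [:: i1; i2; i3; i4; i5]).
  move=> u /allP lt; rewrite map_inj_in_uniq // => i j /lt il /lt jl /eqP.
  by rewrite nth_uniq ?s7 // => /eqP.
have lx : nth ord0 l x \in l by rewrite mem_nth ?s7.
have ly : nth ord0 l y \in l by rewrite mem_nth ?s7.
have [|q1 q2 q3] := tl _ tF _ _ lx ly.
  by apply: (un x y a c d) => //=; rewrite x7 y7 a7 c7 d7.
have p : perm_eq [:: a; x; y; c; d] [:: x; y; a; c; d] by apply/seq.permP => P /=; ring.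
have p' : perm_eq [:: c; x; y; d; a] [:: x; y; a; c; d] by apply/seq.permP => P /=; ring.
have p'' : perm_eq [:: d; x; y; a; c] [:: x; y; a; c; d] by apply/seq.permP => P /=; ring.
split.
- by apply: (quartet_cong VQ _ q1); apply: (un a x y c d); rewrite ?(perm_uniq p) //= x7 y7 a7 c7 d7.
- by apply: (quartet_cong VQ _ q2); apply: (un c x y d a); rewrite ?(perm_uniq p') //= x7 y7 a7 c7 d7.
- by apply: (quartet_cong VQ _ q3); apply: (un d x y a c); rewrite ?(perm_uniq p'') //= x7 y7 a7 c7 d7.
Qed.

Lemma realized_not_stuck S : ~ stuck w (enum S) ->
  (forall e, e \in S -> realized w (S :\ e)%SET) -> realized w S.
Proof.
move=> /existsNP[e /not_implyP[]]; rewrite mem_enum => eS /contrapT ge re.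
rewrite -(finset.setD1K eS); apply: realized_extend => //; first by rewrite !inE eqxx.
  have <- : [set x in enum S]%SET = S by apply/setP => x; rewrite finset.in_set mem_enum.
  exact: ge.
exact: re.
Qed.

Lemma realized_le6 S : (3 <= #|S| <= 6)%N -> realized w S.
Proof.
have [m] := ubnP #|S|; elim: m S => // m IHm S Sm /andP[S3 S6].
have [c3|c4] := leqP #|S| 3.
  have cS : #|S| == 3 by rewrite eqn_leq c3.
  exact: (realized_base w (exist _ S cS)).
have [e eS] : exists e, e \in S.
  by apply/set0Pn; rewrite -card_gt0; exact: leq_trans S3.
have cD : #|S| = #|(S :\ e)%SET|.+1 by rewrite (cardsD1 e) eS.
have eD : e \notin (S :\ e)%SET by rewrite !inE eqxx.
have D3 : (3 <= #|(S :\ e)%SET|)%N by rewrite -ltnS -cD.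
have D5 : (#|(S :\ e)%SET| <= 5)%N by rewrite -ltnS -cD.
rewrite -(finset.setD1K eS); apply: realized_extend => //.
  apply: contrapT => ng; have [Q VQ] := VJ0.
  have D7 : (#|(S :\ e)%SET| <= 7)%N by exact: leq_trans D5 _.
  have [x [x' [y [y' [z [z' [u6 s6 _]]]]]]] := failure (VJ_dressian VQ) eD D3 ng D7.
  have s6' : {subset [:: x; x'; y; y'; z; z'] <= enum (S :\ e)%SET}.
    by move=> t /s6; rewrite mem_enum.
  have := uniq_leq_size u6 s6'; rewrite -cardE => /leq_trans/(_ D5); by [].
apply: IHm; first by rewrite -ltnS -cD.
by rewrite D3 (leq_trans D5).
Qed.

Lemma realized7 S : #|S| = 7%N -> realized w S.
Proof.
move=> S7; apply: realized_not_stuck => [|e eS].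
  by apply: not_stuck7; rewrite ?enum_uniq // -cardE.
have cD : #|S| = #|(S :\ e)%SET|.+1 by rewrite (cardsD1 e) eS.
by apply: realized_le6; move: cD; rewrite S7 => -[<-].
Qed.

Lemma realized_all : ~ stuck w (enum 'I_8) -> realized w [set: 'I_8]%SET.
Proof.
move=> ns; apply: realized_not_stuck => [|e eS].
  by move: ns; congr (~ stuck w _); apply: eq_enum => i; rewrite !inE.
apply: realized7; have := cardsD1 e [set: 'I_8]%SET.
by rewrite cardsT card_ord eS => -[].
Qed.

End Chain.

(** * The Moebius-Kantor configuration *)

Definition sort3 (i j k : nat) : nat * nat * nat :=
  let: (i, j) := if (i < j)%N then (i, j) else (j, i) in
  let: (j, k) := if (j < k)%N then (j, k) else (k, j) in
  let: (i, j) := if (i < j)%N then (i, j) else (j, i) in (i, j, k).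

Lemma sort3_sym (V : Type) (g : nat -> nat -> nat -> V) i j k :
  (forall i j k, g i j k = g j i k) -> (forall i j k, g i j k = g i k j) ->
  g (sort3 i j k).1.1 (sort3 i j k).1.2 (sort3 i j k).2 = g i j k.
Proof.
move=> gP gR; have e1 : g j i k = g i j k by rewrite gP.
have e2 : g i k j = g i j k by rewrite gR.
have e3 : g j k i = g i j k by rewrite gR e1.
have e4 : g k i j = g i j k by rewrite gP e2.
have e5 : g k j i = g i j k by rewrite gP e3.
by rewrite /sort3; do ![case: ifP => _]; rewrite /= ?e1 ?e2 ?e3 ?e4 ?e5.
Qed.

Definition orientations (t : nat * nat * nat) : seq (nat * nat * nat) :=
  let: (a, b, c) := t in
  [:: (a, b, c); (b, c, a); (c, a, b); (a, c, b); (b, a, c); (c, b, a)]%N.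

Definition flags : seq (nat * nat * nat) := flatten (map orientations MK_lines).

Definition step_ok (s : nat * nat * nat * nat * nat) : bool :=
  let: (a, b, c, x, y) := s in
  [&& (a, b, c) \in flags, uniq [:: x; y; a; b; c], x < 8 & y < 8]%N.

(* By the tie at [a], the weight of [a x b] follows from those of [a x c],
   [a y b] and [a y c]. *)
Definition deduce (known : seq (nat * nat * nat)) s :=
  let: (a, b, c, x, y) := s in
  if [&& step_ok s, sort3 a x c \in known, sort3 a y b \in known & sort3 a y c \in known]
  then sort3 a x b :: known else known.

(* The first eight weights determine an element of the lineality space. The ninth
   is needed to reach all the bases by such steps; it depends linearly on the
   others, through sixteen ties. *)
Definition MK_seeds : seq (nat * nat * nat) :=
  [:: (1,2,3); (1,2,7); (2,4,5); (0,2,5); (0,2,6); (0,1,2); (1,2,5); (0,4,5); (0,3,5)]%N.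

(** 39 steps and 9 seeds for the 48 = 56 - 8 bases, so each step reaches a new one. *)
Definition MK_steps : seq (nat * nat * nat * nat * nat) :=
  [:: (0,1,5,3,2); (0,1,5,4,2); (1,5,0,3,2); (1,5,0,4,2); (1,4,2,3,0); (1,4,2,7,0);
      (2,4,1,0,5); (2,4,1,3,0); (2,4,1,7,0); (1,7,3,0,2); (1,7,3,5,0); (2,7,5,0,1);
      (5,7,2,0,1); (5,7,2,4,0); (0,3,4,2,1); (3,4,0,5,1); (0,6,7,1,2); (0,6,7,5,1);
      (2,6,3,1,0); (2,6,3,4,0); (4,6,5,0,2); (4,6,5,1,0); (4,6,5,3,0); (4,6,5,7,0);
      (5,6,4,1,0); (5,6,4,2,0); (5,6,4,3,0); (5,6,4,7,0); (0,3,4,6,1); (0,7,6,3,1);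
      (0,7,6,4,1); (6,7,0,1,4); (6,7,0,2,1); (6,7,0,3,1); (1,3,7,6,0); (3,7,1,2,0);
      (3,7,1,4,0); (3,7,1,5,0); (2,3,6,5,0)]%N.

Definition triples8 : seq (nat * nat * nat) :=
  [seq t <- [seq (p.1, p.2, k) | p <- [seq (i, j) | i <- iota 0 8, j <- iota 0 8], k <- iota 0 8] |
    t.1.1 < t.1.2 < t.2]%N.

(** * Ties determine the weights of the bases *)

Section Weights.
Variables (R : realFieldType) (f : nat -> nat -> nat -> R).
Hypothesis fP : forall i j k, f i j k = f j i k.
Hypothesis fR : forall i j k, f i j k = f i k j.
Hypothesis tie : forall a b c x y, step_ok (a, b, c, x, y) ->
  f a x b + f a y c = f a x c + f a y b.

Let F (t : nat * nat * nat) : R := f t.1.1 t.1.2 t.2.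

Let F_sort i j k : F (sort3 i j k) = f i j k. Proof. exact: sort3_sym. Qed.

Let tieF a b c x y : step_ok (a, b, c, x, y) ->
  F (sort3 a x b) + F (sort3 a y c) = F (sort3 a x c) + F (sort3 a y b).
Proof. by rewrite !F_sort; exact: tie. Qed.

(** Solution of the linear system given by the first eight seeds, normalized by [b 0 = 0]: adding a
    constant to [b] can be compensated in [c]. *)
Let b i : R := nth 0 [:: 0; F (1,2,5)%N - F (0,2,5)%N; F (2,4,5)%N - F (0,4,5)%N;
  F (1,2,3)%N - F (0,1,2)%N; F (2,4,5)%N - F (0,2,5)%N; F (1,2,5)%N - F (0,1,2)%N;
  F (0,2,6)%N - F (0,2,5)%N - F (0,1,2)%N + F (1,2,5)%N; F (1,2,7)%N - F (0,1,2)%N] i.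

Let c : R := F (0,2,5)%N + F (0,1,2)%N - F (2,4,5)%N - F (1,2,5)%N + F (0,4,5)%N.

Let K t : Prop := F t = b t.1.1 + b t.1.2 + b t.2 + c.

Let K_sort i j k : K (sort3 i j k) <-> f i j k = b i + b j + b k + c.
Proof.
rewrite /K F_sort; suff -> : b (sort3 i j k).1.1 + b (sort3 i j k).1.2 + b (sort3 i j k).2 =
  b i + b j + b k by [].
by rewrite /sort3; do ![case: ifP => _] => /=; ring.
Qed.

Let K_seeds : {in MK_seeds, forall t, K t}.
Proof.
have last : F (0,3,5)%N = b 0 + b 3 + b 5 + c.
  have t1 := @tieF 5 1 0 3 2 isT; have t2 := @tieF 0 3 4 6 2 isT.
  have t3 := @tieF 1 7 3 5 2 isT; have t4 := @tieF 4 6 5 7 2 isT.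
  have t5 := @tieF 2 6 3 4 0 isT; have t6 := @tieF 2 4 1 0 5 isT.
  have t7 := @tieF 4 6 5 0 2 isT; have t8 := @tieF 2 7 5 0 1 isT.
  have t9 := @tieF 0 1 5 3 2 isT; have t10 := @tieF 3 2 6 0 7 isT.
  have t11 := @tieF 5 7 2 4 1 isT; have t12 := @tieF 2 4 1 3 5 isT.
  have t13 := @tieF 0 7 6 3 2 isT; have t14 := @tieF 0 3 4 2 5 isT.
  have t15 := @tieF 3 7 1 2 0 isT; have t16 := @tieF 6 7 0 3 4 isT.
  move: t1 t2 t3 t4 t5 t6 t7 t8 t9 t10 t11 t12 t13 t14 t15 t16.
  rewrite /sort3 /b /c /=; lra.
move=> t; rewrite !inE.
do ![case/predU1P => [->|]; first by rewrite /K /b /c /=; lra].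
by move=> /eqP->.
Qed.

(** Ties are linear and hold for lineality vectors, so agreement with such a vector passes from the
    seeds along the steps to all bases. *)
Lemma MK_weights : exists (b : nat -> R) (c : R),
  {in triples8, forall t, t \notin MK_lines -> f t.1.1 t.1.2 t.2 = b t.1.1 + b t.1.2 + b t.2 + c}.
Proof.
exists b, c.
have sound known steps : {in known, forall t, K t} -> {in foldl deduce known steps, forall t, K t}.
  elim: steps known => [|[[[[a1 b1] c1] x] y] steps IH] //= known kK; apply: IH.
  case: ifP => // /and4P[ok /kK/K_sort k1 /kK/K_sort k2 /kK/K_sort k3] t.
  rewrite inE => /predU1P[->|/kK//]; apply/K_sort.
  by have := tie ok; rewrite k1 k2 k3; lra.
have all48 : all (fun t => (t \in MK_lines) || (t \in foldl deduce MK_seeds MK_steps)) triples8.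
  by vm_compute.
move=> t t8 tl; have := allP all48 t t8; rewrite (negPf tl) => /sound.
by apply; exact: K_seeds.
Qed.

End Weights.

Definition tri8 (i j k : nat) : triple := tri (inord i) (inord j) (inord k).

Lemma tri8_sort i j k :
  tri8 (sort3 i j k).1.1 (sort3 i j k).1.2 (sort3 i j k).2 = tri8 i j k.
Proof.
apply: (sort3_sym (g := tri8)) => a b c; first by rewrite /tri8 triP.
by rewrite /tri8 triR.
Qed.

Lemma mem_triples8 i j k : ((i, j, k) \in triples8) = [&& i < j, j < k & k < 8]%N.
Proof.
rewrite mem_filter; apply/andP/idP.
  move=> [/andP[ij jk] /allpairsP[[p c] [_ + [_ _ ck]]]].
  by rewrite mem_iota -ck => /andP[_ k8]; apply/and3P.
move=> /and3P[ij jk k8]; split; first by rewrite ij jk.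
have j8 := ltn_trans jk k8; have i8 := ltn_trans ij j8.
apply/allpairsP; exists ((i, j), k); rewrite mem_iota k8; split=> //.
by apply/allpairsP; exists (i, j); rewrite !mem_iota i8 j8.
Qed.

Lemma sort3_triples8 i j k : uniq [:: i; j; k] -> all (fun i => i < 8)%N [:: i; j; k] ->
  sort3 i j k \in triples8.
Proof.
move=> u /and4P[i8 j8 k8 _].
have [ij ik jk] : [/\ i != j, i != k & j != k].
  by move: u; rewrite /= !inE negb_or andbT => /andP[/andP[-> ->] ->].
rewrite /sort3; case: (ltngtP i j) ij => // ij _; case: (ltngtP i k) ik => // ik _;
  case: (ltngtP j k) jk => // jk _;
  do ?[by have := ltn_trans ij (ltn_trans jk ik); rewrite ltnn];
  do ?[by have := ltn_trans ij (ltn_trans ik jk); rewrite ltnn];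
  by rewrite ?(ij, ik, jk, leq_gtF (ltnW ij), leq_gtF (ltnW ik), leq_gtF (ltnW jk))
    mem_triples8 ?(ij, ik, jk, i8, j8, k8).
Qed.

Lemma tri8_surj (t : triple) : exists i j k, (i, j, k) \in triples8 /\ t = tri8 i j k.
Proof.
elim/triple_ind: t => i j k /andP[ij jk]; exists (i : nat), (j : nat), (k : nat).
by rewrite mem_triples8 ij jk ltn_ord /tri8 !inord_val.
Qed.

Lemma inord_uniq (s : seq nat) : uniq s -> all (fun i => i < 8)%N s ->
  uniq (map (fun i => inord i : 'I_8) s).
Proof.
move=> us /allP s8; rewrite map_inj_in_uniq // => i j /s8 i8 /s8 j8 /(congr1 val).
by rewrite /= !inordK.
Qed.

Lemma tri8_inj p q : p \in triples8 -> q \in triples8 ->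
  tri8 p.1.1 p.1.2 p.2 = tri8 q.1.1 q.1.2 q.2 -> p = q.
Proof.
case: p => [[i j] k]; case: q => [[a b] c]; rewrite !mem_triples8 /=.
have lt x y z : [&& x < y, y < z & z < 8]%N -> ((inord x : 'I_8) < (inord y : 'I_8) < (inord z : 'I_8))%N.
  move=> /and3P[xy yz z8]; have y8 := ltn_trans yz z8; have x8 := ltn_trans xy y8.
  by rewrite !inordK // xy yz.
have inj x y : (x < 8)%N -> (y < 8)%N -> (inord x : 'I_8) = inord y -> x = y.
  by move=> x8 y8 /(congr1 val); rewrite /= !inordK.
move=> hp hq E; have [e1 e2 e3] := tnth3_tri (lt _ _ _ hp).
have [d1 d2 d3] := tnth3_tri (lt _ _ _ hq).
rewrite -/(tri8 i j k) E in e1 e2 e3; rewrite -/(tri8 a b c) in d1 d2 d3.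
case/and3P: hp => ij jk k8; case/and3P: hq => ab bc c8.
have [j8 b8] := (ltn_trans jk k8, ltn_trans bc c8).
have [i8 a8] := (ltn_trans ij j8, ltn_trans ab b8).
by congr (_, _, _); apply: inj => //; rewrite -?e1 -?e2 -?e3.
Qed.

Lemma Qsp_tri8 p : p \in triples8 -> Qsp_nonbasis (tri8 p.1.1 p.1.2 p.2) = (p \in MK_lines).
Proof.
have val8 q : q \in MK_lines -> val (tri8 q.1.1 q.1.2 q.2) = ijk q.1.1.+1 q.1.2.+1 q.2.+1.
  move=> ql; rewrite val_tri //.
  have /andP[u8 s8] : uniq [:: q.1.1; q.1.2; q.2] && all (fun i => i < 8)%N [:: q.1.1; q.1.2; q.2].
    by apply: (allP (_ : all (fun q => uniq [:: q.1.1; q.1.2; q.2] &&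
      all (fun i => i < 8)%N [:: q.1.1; q.1.2; q.2]) MK_lines)) ql.
  exact: (inord_uniq u8 s8).
have sub : {subset MK_lines <= triples8} by apply/allP; vm_compute.
have QE t : Qsp_nonbasis t = (val t \in [seq val (tri8 q.1.1 q.1.2 q.2) | q <- MK_lines]).
  have -> : [seq val (tri8 q.1.1 q.1.2 q.2) | q <- MK_lines] =
      [seq ijk q.1.1.+1 q.1.2.+1 q.2.+1 | q <- MK_lines] by apply/eq_in_map => q /val8.
  by [].
move=> pt; rewrite QE; apply/mapP/idP => [[q ql /val_inj E]|pl]; last by exists p.
by rewrite (tri8_inj pt (sub _ ql) E).
Qed.

Section PermCochar.
Variables (R : realType) (s : 'S_8).
Implicit Types (x y : cochar R) (t : triple).

Lemma perm_triple_inj : injective (perm_triple s).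
Proof.
move=> t t' /(congr1 val) /= e; apply: val_inj.
exact: imset_inj (@perm_inj _ s) _ _ e.
Qed.

Lemma perm_cocharE x t : perm_cochar s x (perm_triple s t) = x t.
Proof.
rewrite /perm_cochar sum_ffunE (bigD1 t) //= big1 => [|t' t't].
  by rewrite addr0 !ffunE eqxx; exact: mulr1.
by rewrite !ffunE (inj_eq perm_triple_inj) eq_sym (negPf t't); exact: mulr0.
Qed.

Definition pull x : cochar R := [ffun t => x (perm_triple s t)].

Lemma perm_cocharK x : pull (perm_cochar s x) = x.
Proof. by apply/ffunP => t; rewrite ffunE perm_cocharE. Qed.

Lemma pullK x : perm_cochar s (pull x) = x.
Proof.
apply/ffunP => t; have [g _ gK] := injF_bij perm_triple_inj.
by rewrite -[t in LHS]gK perm_cocharE ffunE gK.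
Qed.

Lemma perm_triple_tri i j k : uniq [:: i; j; k] ->
  perm_triple s (tri i j k) = tri (s i) (s j) (s k).
Proof.
move=> u; apply: val_inj; rewrite /= !val_tri //.
  by rewrite !imsetU !imset_set1.
by rewrite (map_inj_uniq (@perm_inj _ s) [:: i; j; k]).
Qed.

End PermCochar.

(** * Coordinates on the cone *)

Section Cone.
Variable R : realType.
Implicit Types (x y : cochar R) (a : triple -> R) (b : 'I_8 -> R) (c : R) (t : triple).

(** Without a sign condition on [a] this describes the linear span of the cone; [CspP] adds the
    signs. *)
Definition cone_coords a b c x : Prop := forall t,
  x t = (if Qsp_nonbasis t then a t else 0) + \sum_(i in val t) b i + c.

Lemma cone_coordsP a b c x : cone_coords a b c x <->
  x = \sum_(l | Qsp_nonbasis l) a l *: e_vec R l +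
      (\sum_i b i *: (\sum_(l : triple | i \in val l) e_vec R l) + [ffun=> c]).
Proof.
have E t : (\sum_(l | Qsp_nonbasis l) a l *: e_vec R l +
      (\sum_i b i *: (\sum_(l : triple | i \in val l) e_vec R l) + [ffun=> c])) t =
    (if Qsp_nonbasis t then a t else 0) + \sum_(i in val t) b i + c.
  have e l : e_vec R l t = (l == t)%:R by rewrite ffunE eq_sym.
  rewrite ffunE sum_ffunE ffunE sum_ffunE ffunE addrA; congr (_ + _ + _).
    rewrite big_mkcond (bigD1 t) //= big1 => [|l /negPf lt].
      by rewrite addr0 ffunE e eqxx; case: ifP => // _; exact: mulr1.
    by rewrite ffunE e lt; case: ifP => // _; exact: mulr0.
  rewrite [RHS]big_mkcond; apply: eq_bigr => i _; rewrite ffunE sum_ffunE.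
  have [it|it] := boolP (i \in val t); last first.
    rewrite big1 => [|l il]; first exact: mulr0.
    by rewrite e; case: eqP it => // <-; rewrite il.
  rewrite (bigD1 t) //= big1 => [|l /andP[_ /negPf lt]]; last by rewrite e lt.
  by rewrite e eqxx addr0; exact: mulr1.
split=> [xE|-> t //]; by apply/ffunP => t; rewrite E.
Qed.

Lemma CspP x : Csp R x <-> exists a b c, (forall t, 0 <= a t) /\ cone_coords a b c x.
Proof.
split=> [[a [y [a0 [b [c ->]] xE]]]|[a [b [c [a0 /cone_coordsP xE]]]]].
  by exists a, b, c; split=> //; apply/cone_coordsP.
by exists a, (\sum_i b i *: (\sum_(l : triple | i \in val l) e_vec R l) + [ffun=> c]);
  split=> //; exists b, c.
Qed.

Lemma sum_tri8 b i j k : uniq [:: i; j; k] -> all (fun i => i < 8)%N [:: i; j; k] ->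
  \sum_(m in val (tri8 i j k)) b m = b (inord i) + b (inord j) + b (inord k).
Proof.
move=> u i8; have u' : uniq [:: inord i : 'I_8; inord j; inord k] by exact: inord_uniq u i8.
move: (u'); rewrite /= !inE negb_or andbT => /andP[/andP[ij ik] jk].
rewrite val_tri // -finset.setUA big_setU1 /= ?big_setU1 ?big_set1 /= ?addrA //.
  by rewrite !inE.
by rewrite !inE negb_or ij.
Qed.

Lemma cone_coords_tri8 a b c x i j k : cone_coords a b c x ->
  uniq [:: i; j; k] -> all (fun i => i < 8)%N [:: i; j; k] ->
  x (tri8 i j k) = (if sort3 i j k \in MK_lines then a (tri8 i j k) else 0) +
    (b (inord i) + b (inord j) + b (inord k)) + c.
Proof.
move=> xE u i8; rewrite xE sum_tri8 //; congr (_ + _ + _).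
by rewrite -(tri8_sort i j k) Qsp_tri8 ?sort3_triples8 //; case: (sort3 i j k) => [[]].
Qed.

(** A functional that kills the lineality space, each index occurring equally often with both signs.
    When the last three triples are bases, it reads off the coefficient of the nonbasis [i j k]. *)
Definition gap x i j k u v : R :=
  x (tri8 i j k) + x (tri8 i u v) - x (tri8 i u j) - x (tri8 i v k).

Definition gap_ok (p : nat * nat * nat) u v : bool :=
  let: (i, j, k) := p in
  [&& step_ok (i, j, k, u, v), sort3 i u v \notin MK_lines, sort3 i u j \notin MK_lines &
      sort3 i v k \notin MK_lines].

Lemma gap_ex p : p \in MK_lines -> exists u v, gap_ok p u v.
Proof.
move=> pl; have H : all (fun p => has (fun u => has (gap_ok p u) (iota 0 8)) (iota 0 8)) MK_lines.
  by vm_compute.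
by have /hasP[u _ /hasP[v _ ok]] := allP H p pl; exists u, v.
Qed.

Lemma gap_coords a b c x i j k u v : cone_coords a b c x -> (i, j, k) \in MK_lines ->
  gap_ok (i, j, k) u v -> gap x i j k u v = a (tri8 i j k).
Proof.
move=> xE pl /and4P[/and4P[_ u5 u8 v8] n1 n2 n3].
have [i8 j8 k8 ijk8] : [/\ i < 8, j < 8, k < 8 & sort3 i j k == (i, j, k)]%N.
  have H : all (fun p => [&& p.1.1 < 8, p.1.2 < 8, p.2 < 8 & sort3 p.1.1 p.1.2 p.2 == p]%N)
    MK_lines by vm_compute.
  by apply/and4P; exact: (allP H _ pl).
have [w1 w2 [w3 w4]] : [/\ uniq [:: i; j; k], uniq [:: i; u; v] &
    uniq [:: i; u; j] /\ uniq [:: i; v; k]].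
  move: u5; rewrite /= !inE !negb_or !andbT.
  move=> /and4P[/and4P[uv ui uj uk] /and3P[vi vj vk] /andP[ij ik] jk].
  by rewrite ![i == u]eq_sym ![i == v]eq_sym uv ui uj vi vk ij ik jk.
rewrite /gap !(cone_coords_tri8 xE) //; do ?by apply/and4P.
rewrite (eqP ijk8) pl (negPf n1) (negPf n2) (negPf n3); ring.
Qed.

End Cone.

Section Hull.
Variables (R : realType) (s : 'S_8).
Implicit Types (x y : cochar R).

(** The affine hull lies in the linear span, and this is all that is needed: signs near [w] are
    recovered from gaps. *)
Lemma affine_hull_coords y : affine_hull (perm_cochar s @` Csp R)%classic y ->
  exists a b c, cone_coords a b c (pull s y).
Proof.
pose P y := exists a b c, cone_coords a b c (pull s y).
have P0 : P 0.
  exists (fun=> 0), (fun=> 0), 0 => t.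
  by rewrite !ffunE; case: ifP => _; rewrite big1 // !addr0.
have PD x1 x2 : P x1 -> P x2 -> P (x1 + x2).
  move=> [a [b [c E]]] [a' [b' [c' E']]].
  exists (fun t => a t + a' t), (fun i => b i + b' i), (c + c') => t.
  have := E t; have := E' t; rewrite !ffunE => -> ->; rewrite big_split /=.
  by case: ifP => _; ring.
have PZ r x : P x -> P (r *: x).
  move=> [a [b [c E]]]; exists (fun t => r * a t), (fun i => r * b i), (r * c) => t.
  have := E t; rewrite !ffunE => ->; rewrite -mulr_sumr.
  rewrite -[LHS]/(r * _); case: ifP => _; ring.
move=> [n [r [x [xC _ ->]]]]; apply: (big_ind P) => // k _; apply: PZ.
have [z /CspP[a [b [c [_ E]]]] <-] := xC k.
by exists a, b, c; rewrite perm_cocharK.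
Qed.

End Hull.

Section Configuration.
Variables (R : realType) (w : cochar R) (l : seq 'I_8).
Hypotheses (Dw : dressian w) (ul : uniq l) (sl : size l = 8%N).
Hypothesis tl : tight_lines w MK_lines l.
Local Notation L := (nth ord0 l).

Lemma step_uniq a b c x y : step_ok (a, b, c, x, y) ->
  uniq [:: L a; L x; L y; L b; L c].
Proof.
move=> /and4P[/flattenP[_ /mapP[[[i j] k] ql ->] ao] u5 x8 y8].
have /and3P[i8 j8 k8] : [&& i < 8, j < 8 & k < 8]%N.
  by apply: (allP (_ : all (fun p => [&& p.1.1 < 8, p.1.2 < 8 & p.2 < 8]%N) MK_lines)) ql.
have [a8 b8 c8] : [/\ a < 8, b < 8 & c < 8]%N.
  by move: ao; rewrite !inE => /or4P[|||/or3P[]] /eqP[-> -> ->].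
rewrite -[[:: L a; L x; L y; L b; L c]]/(map L [:: a; x; y; b; c]).
have pu : perm_eq [:: a; x; y; b; c] [:: x; y; a; b; c] by apply/seq.permP => P /=; ring.
rewrite map_inj_in_uniq ?(perm_uniq pu) // => m n.
have lt z : z \in [:: a; x; y; b; c] -> (z < 8)%N.
  by rewrite !inE => /or4P[||| /orP[]] /eqP->.
by move=> /lt m8 /lt n8 /eqP; rewrite nth_uniq ?sl // => /eqP.
Qed.

Lemma step_quartet a b c x y : step_ok (a, b, c, x, y) ->
  quartet w (L a) (L x) (L y) (L b) (L c).
Proof.
move=> ok; have := step_uniq ok.
move: ok => /and4P[/flattenP[_ /mapP[[[i j] k] ql ->] ao] _ x8 y8] u5.
have [lx ly] : L x \in l /\ L y \in l by rewrite !mem_nth ?sl.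
have sw u v t p q : quartet w u v t p q -> quartet w u v t q p.
  by move=> [h1 h2]; split; move: h1 h2; rewrite (WR w u q p); lra.
have pu : perm_eq [:: L a; L x; L y; L b; L c] [:: L x; L y; L i; L j; L k].
  by move: ao; rewrite !inE => /or4P[|||/or3P[]] /eqP[-> -> ->];
    apply/seq.permP => P /=; ring.
have [|q1 q2 q3] := tl ql lx ly; first by rewrite -(perm_uniq pu).
by move: ao; rewrite !inE => /or4P[|||/or3P[]] /eqP[-> -> ->]; do ?exact: sw.
Qed.

Lemma MK_relint : exists s : 'S_8, relint (perm_cochar s @` Csp R)%classic w.
Proof.
have inj : injective (fun i : 'I_8 => L i).
  by move=> i j /eqP; rewrite nth_uniq ?sl // => /eqP/val_inj.
pose s := perm inj; exists s.
have sL i : (i < 8)%N -> s (inord i) = L i by move=> i8; rewrite permE inordK.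
pose f i j k := W w (L i) (L j) (L k).
have pf i j k : uniq [:: i; j; k] -> all (fun i => i < 8)%N [:: i; j; k] ->
    pull s w (tri8 i j k) = f i j k.
  move=> u /[dup] lt8 /and4P[i8 j8 k8 _].
  by rewrite ffunE perm_triple_tri ?(inord_uniq u lt8) // !sL.
have [|i j k|a b c x y ok|b [c wE]] := @MK_weights R f.
- by move=> i j k; rewrite /f WP.
- by rewrite /f WR.
- exact: quartet_tie (step_uniq ok) (step_quartet ok).
(* [a] is the excess of [w] over the lineality vector; it vanishes on bases. *)
pose bt (i : 'I_8) := b i; pose a t := pull s w t - \sum_(i in val t) bt i - c.
have u8 p : p \in triples8 -> uniq [:: p.1.1; p.1.2; p.2] /\ all (fun i => i < 8)%N [:: p.1.1; p.1.2; p.2].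
  case: p => [[i j] k]; rewrite mem_triples8 => /and3P[ij jk k8].
  have j8 := ltn_trans jk k8; rewrite /= !inE negb_or (ltn_trans ij j8) j8 k8.
  by rewrite !ltn_eqF // (ltn_trans ij jk).
have wc : cone_coords a bt c (pull s w).
  move=> t; case: ifP => [_|]; first by rewrite /a; ring.
  have [i [j [k [t8 ->]]]] := tri8_surj t; rewrite (Qsp_tri8 t8) => /negbT nl.
  have [/= u lt8] := u8 _ t8; case/and4P: (lt8) => i8 j8 k8 _.
  by rewrite pf // sum_tri8 // (wE _ t8 nl) /bt !inordK // add0r.
have sub p : p \in MK_lines -> p \in triples8.
  have H : all (mem triples8) MK_lines by vm_compute.
  by move=> pl; exact: (allP H _ pl).
(* The coefficient is a gap of [w], positive by the first inequality of a quartet centred at a point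
   of the line. *)
have a0 p : p \in MK_lines -> 0 < a (tri8 p.1.1 p.1.2 p.2).
  move: p => [[i j] k] pl; have [u [v ok]] := gap_ex pl.
  rewrite -(gap_coords wc pl ok) /gap.
  have [st _ _ _] := and4P ok; have [h1 h2] := step_quartet st.
  have [_ u5 lu lv] := and4P st; have [/= _ /and4P[i8 j8 k8 _]] := u8 _ (sub _ pl).
  have [w1 w2 [w3 w4]] : [/\ uniq [:: i; j; k], uniq [:: i; u; v] &
      uniq [:: i; u; j] /\ uniq [:: i; v; k]].
    move: u5; rewrite /= !inE !negb_or !andbT.
    move=> /and4P[/and4P[uv ui uj uk] /and3P[vi vj vk] /andP[ij ik] jk].
    by rewrite ![i == u]eq_sym ![i == v]eq_sym uv ui uj vi vk ij ik jk.
  rewrite !pf //; do ?by apply/and4P.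
  by move: h1; rewrite /f; lra.
have aQ t : Qsp_nonbasis t -> exists2 p, p \in MK_lines & t = tri8 p.1.1 p.1.2 p.2.
  have [i [j [k [t8 ->]]]] := tri8_surj t; rewrite (Qsp_tri8 t8) => pl.
  by exists (i, j, k).
have [//|p0 p0l pmin] := @seq_min _ _ (fun p => a (tri8 p.1.1 p.1.2 p.2)) MK_lines.
split.
  exists (pull s w); last exact: pullK.
  apply/CspP; exists (fun t => if Qsp_nonbasis t then a t else 0), bt, c; split=> [t|t].
    by case: ifP => // /aQ[p pl ->]; exact/ltW/a0.
  by rewrite wc; case: ifP.
have m0 := a0 _ p0l; set m := a _ in m0.
exists (m / 5) => [|y /affine_hull_coords[a' [b' [c' yc]]] close]; first by lra.
exists (pull s y); last exact: pullK.
apply/CspP; exists (fun t => if Qsp_nonbasis t then a' t else 0), b', c'; split=> [t|t]; last first.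
  by rewrite yc; case: ifP.
case: ifP => // /aQ[[[i j] k] pl ->]; have [u [v ok]] := gap_ex pl.
have am := pmin _ pl; rewrite -/m in am.
have near t' : `|pull s y t' - pull s w t'| < m / 5 by rewrite !ffunE; exact: close.
rewrite -(gap_coords yc pl ok) /gap /=; rewrite /= -(gap_coords wc pl ok) /gap in am.
have := near (tri8 i j k); have := near (tri8 i u v).
have := near (tri8 i u j); have := near (tri8 i v k).
by rewrite !ltr_norml => /andP[? ?] /andP[? ?] /andP[? ?] /andP[? ?]; lra.
Qed.

End Configuration.

Local Open Scope classical_set_scope.

Theorem theorem1p4 (R : realType) (w : cochar R) :
  TGr0 w ->
  ~ (exists s : 'S_8, relint (perm_cochar s @` Csp R) w) ->
  irreducible (initial_degeneration w).
Proof.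
move=> /TGr0_VJ VQ nMK; have [Q /VJ_dressian Dw] := VQ.
have ns : ~ stuck w (enum 'I_8).
  move=> st; apply: nMK; have s8 : size (enum 'I_8) = 8%N by rewrite size_enum_ord.
  have [l [ul sl tl]] := stuck_MK Dw (enum_uniq _) s8 st.
  exact: MK_relint Dw ul sl tl.
have [k [iota [v [vlo sp]]]] := realized_all VQ ns.
have insT : [set t : triple | val t \subset [set: 'I_8]%SET]%SET = [set: triple]%SET.
  by apply/setP => t; rewrite !inE finset.subsetT.
rewrite {}insT in vlo sp.
by apply: (irreducible_generic (v := v) _ _ sp) => t; have [] := vlo t (finset.in_setT t).
Qed.
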